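(* In the STAR-RIS typical-UE model below, assume $a_c>a_t\tau_c$, put $\tau_c^*=\frac{\tau_c}{a_c-a_t\tau_c}$ and define the ergodic rate $R_{t,STAR}=\mathbb E\big[\log_2(1+\gamma_t)\mathbf 1\{\gamma_{t\to c}>\tau_c\}\big]$. Then $$R_{t,STAR}=\frac{1}{\ln2}\int_{a_t\tau_c^*}^\infty\frac{\bar F_{t,STAR}(z)}{1+z}\,dz+\log_2(1+a_t\tau_c^* )\,\bar F_{t,STAR}(a_t\tau_c^* ),$$ where $\bar F_{t,STAR}(z)=\mathbb P(\gamma_t>z)$ is given for $z>0$ by $$\bar F_{t,STAR}(z)=\sum_{\chi\in\{\mathrm T,\mathrm R\}}\int_0^\infty\!\!\int_0^\infty\pi\lambda_Br_1f_{RU}(r_2)\sum_{m=0}^{k-1}\frac{(-1)^m}{m!}\left[\frac{d^m}{dx^m}e^{V_\chi(z;x)}\right]_{x=1}dr_1\,dr_2,$$ with $V_\chi(z;x)=-\frac{z(r_1r_2)^\alpha}{a_t\theta_r\beta_\chi P_BC_r}n_0^2x-\frac12\pi\lambda_Br_1^2F\!\left(\frac{\theta_Iz\beta_{\mathrm T}}{a_t\theta_r\beta_\chi}x\right)-\frac12\pi\lambda_Br_1^2F\!\left(\frac{\theta_Iz\beta_{\mathrm R}}{a_t\theta_r\beta_\chi}x\right)$.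
   Context: STAR-RIS typical-UE model. Constants: $\lambda_B,P_B,C_r,\theta_r,\theta_I>0$, noise power $n_0^2\ge0$, $\alpha>2$, integer $k\ge1$, $\beta_{\mathrm T}\in(0,1)$, $\beta_{\mathrm R}=1-\beta_{\mathrm T}$, $0<a_t<a_c$ with $a_t+a_c=1$, threshold $\tau_c>0$. Random elements, mutually independent unless stated: $r_1$ with density $2\pi\lambda_Br e^{-\pi\lambda_Br^2}$; $r_2$ with a density $f_{RU}$ on $(0,\infty)$; $\chi$ uniform on $\{\mathrm T,\mathrm R\}$; $G\sim\Gamma(k,\theta_r)$ (shape $k$, scale $\theta_r$); conditionally on $r_1$, independent Poisson point processes $\Phi^{\mathrm T},\Phi^{\mathrm R}$ on $\{y\in\mathbb R^2:\|y\|>r_1\}$, each of intensity $\lambda_B/2$, with i.i.d. exponential marks $g_y$ of mean $\theta_I$. Set $S=\beta_\chi P_BC_r(r_1r_2)^{-\alpha}G$, $I_t=\sum_{\psi\in\{\mathrm T,\mathrm R\}}\sum_{y\in\Phi^\psi}\beta_\psi P_BC_r(\|y\|r_2)^{-\alpha}g_y$, $\gamma_{t\to c}=\frac{a_cS}{a_tS+I_t+n_0^2}$, $\gamma_t=\frac{a_tS}{I_t+n_0^2}$. Let $\delta=2/\alpha$ and $F(y)={}_2F_1(1,-\delta;1-\delta;-y)=1+\int_1^\infty\frac{2yt}{t^\alpha+y}dt$ for $y\ge0$. *)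

(* Defs.v *)
From HB Require Import structures.
From mathcomp Require Import all_boot all_order all_algebra.
From mathcomp Require Import all_classical all_reals all_analysis.
Set Implicit Arguments. Unset Strict Implicit. Unset Printing Implicit Defensive.
Import Order.TTheory GRing.Theory Num.Def Num.Theory.
Import numFieldNormedType.Exports.
Local Open Scope classical_set_scope.
Local Open Scope ring_scope.

Section STAR.
Variable R : realType.
Notation leb := (@lebesgue_measure R).

Definition norm2 (y : R * R) : R := Num.sqrt (y.1 ^+ 2 + y.2 ^+ 2).

Definition log2 (x : R) : R := ln x / ln 2.

Definition pois (mu : R) (n : nat) : R := mu ^+ n / (n`!)%:R * expR (- mu).

(* F(y) = 2F1(1,-2/alpha;1-2/alpha;-y) = 1 + int_1^oo 2 y t/(t^alpha + y) dt *)
Definition Fhyp (alpha y : R) : R :=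
  1 + fine (\int[leb]_(t in `[1%R, +oo[) (2 * y * t / (t `^ alpha + y))%:E)%E.

(* a set of (location, mark) pairs whose locations lie in a bounded region *)
Definition bounded_loc (A : set ((R * R) * R)) : Prop :=
  exists M : R, forall p, A p -> `|p.1.1| <= M /\ `|p.1.2| <= M.

(* mean measure, given r1 = r, of a marked PPP of intensity lam/2 on
   {y : ||y|| > r} with i.i.d. exponential marks of mean thI *)
Definition ppp_mean (lam thI r : R) (A : set ((R * R) * R)) : R :=
  fine ((lam / 2)%:E *
   \int[leb]_(u in [set: R]) \int[leb]_(v in [set: R])
     \int[leb]_(g in `[0%R, +oo[)
       (((((u : R), (v : R)), (g : R)) \in A)%:R * (r < norm2 ((u : R), (v : R)))%R%:R
          * (expR (- (g / thI)) / thI))%:E)%E.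

Definition count_in (x y g : nat -> R) (A : set ((R * R) * R)) : \bar R :=
  (\sum_(j <oo) ((((x j, y j), g j) \in A)%:R)%:E)%E.

(* beta_chi, with chi = true for T and false for R *)
Definition beta (betaT : R) (c : bool) : R := if c then betaT else 1 - betaT.

Definition Vchi (lamB PB Cr thr thI n0 alpha betaT at_ : R) (c : bool)
  (z r1 r2 x : R) : R :=
  - (z * (r1 * r2) `^ alpha / (at_ * thr * beta betaT c * PB * Cr)) * n0 ^+ 2 * x
  - 2^-1 * pi * lamB * r1 ^+ 2
      * Fhyp alpha (thI * z * betaT / (at_ * thr * beta betaT c) * x)
  - 2^-1 * pi * lamB * r1 ^+ 2
      * Fhyp alpha (thI * z * (1 - betaT) / (at_ * thr * beta betaT c) * x).

Definition Fbar_formula (lamB PB Cr thr thI n0 alpha betaT at_ : R) (k : nat)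
  (fRU : R -> R) (z : R) : \bar R :=
  (\sum_(c <- [:: true; false])
    \int[leb]_(r2 in `]0%R, +oo[) \int[leb]_(r1 in `]0%R, +oo[)
      (pi * lamB * r1 * fRU r2 *
        \sum_(m < k) ((-1) ^+ m / (m`!)%:R *
          derive1n m (fun x => expR (Vchi lamB PB Cr thr thI n0 alpha betaT at_ c z r1 r2 x)) 1))%:E)%E.

End STAR.

(* Main.v *)
Require Import Defs.
From HB Require Import structures.
From mathcomp Require Import all_boot all_order all_algebra.
From mathcomp Require Import all_classical all_reals all_analysis.
From mathcomp Require Import measurable_realfun ring lra.
Import Order.TTheory GRing.Theory Num.Def Num.Theory.
Import numFieldNormedType.Exports.
Local Open Scope classical_set_scope.
Local Open Scope ring_scope.

(** Condition on the two distances [(r1, r2)] and on the branch [chi].  If [J] is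
    the total interference normalised by the distance [r2], then [gamma_t > z]
    means [G > z * thr * X] with [X] affine in [J], and, [G] being Gamma with an
    integer shape [k], the conditional probability is
    [E sum_(m < k) (z X)^m / m! * exp (- z X) = sum_(m < k) (-z)^m / m! * L^(m) z],
    where [L] is the Laplace transform of [X].  The count laws only give access
    to simple functions of the Poisson points, for which (after truncating the
    counts) this is an identity between finite sums of exponentials.  Shot noise
    is an increasing limit of such simple functionals; the Laplace transforms
    involved are completely monotone, so that, slopes of convex functions being
    squeezed by difference quotients, pointwise convergence of the transforms
    carries over to all their derivatives.  The limit transform is computed in
    polar coordinates and produces [Fhyp].  Letting [z -> 0] shows that the
    interference is almost surely finite, void probabilities show that it is
    positive, and the rate follows from the layer-cake formula for [ln (1 + x)],
    since [gamma_tc > tauc] is the event [gamma_t > a_t * tauc_star]. *)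

(** The law is known only through counts in bounded disjoint sets. Convergence of the interference
    series and the signs of the marks are not given pointwise and have to be recovered almost
    surely. This matters because [fine] sends an infinite sum to 0 and division by 0 returns 0:
    unless the interference is finite and, when [n0 = 0], positive, [gamma_t] takes a default value.
    The approximation runs through the closed events [z <= gamma_t]: when the simple interference
    increases, these decrease exactly to the limiting event, so continuity from above applies. The
    strict inequality of the theorem comes back by letting thresholds decrease to [z], using
    continuity of the tail in [z]. Convexity replaces moment bounds: no derivative of a transform is
    ever dominated directly. The constant 1 in [Fhyp] has a probabilistic origin. Its two
    occurrences in [Vchi] add up to [- pi * lamB * r1 ^+ 2], the exponent of the density of [r1], so
    the formula shows only the prefactor [pi * lamB * r1]. *)

Section completely_monotone.
Local Notation "f ^` ()" := (derive1 f) : ring_scope.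
Local Notation "f ^` ( n )" := (derive1n n f) : ring_scope.
Context {R : realType}.
Implicit Types f g : R -> R.

(** Only the open half-line is considered: a Laplace transform need not be differentiable at 0. *)
Definition smooth_pos f := forall m (x : R), 0 < x -> derivable (f^`(m)) x 1.

Definition completely_monotone f :=
  smooth_pos f /\ forall m (x : R), 0 < x -> 0 <= (-1) ^+ m * f^`(m) x.

Lemma derive1nSl f m : f^`(m.+1) = (f^`())^`(m).
Proof. by rewrite /derive1n iterSr. Qed.

Lemma near_derive1n f g (m : nat) (x : R) :
  (\near x, f x = g x) -> \near x, f^`(m) x = g^`(m) x.
Proof.
elim: m => [//|m ih] /ih /near_join; apply: filterS => y yfg.
by rewrite 2!derive1nS 2!derive1E; exact: near_eq_derive.
Qed.

(** Two mean value steps: a nonnegative second derivative makes the first one nondecreasing, and the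
    secant slope between [a] and [b] is a value of the first derivative in between. *)
Lemma tangent_below (g : R -> R) (a b : R) :
  0 < a -> 0 < b ->
  (forall x : R, 0 < x -> derivable g x 1) ->
  (forall x : R, 0 < x -> derivable g^`() x 1) ->
  (forall x : R, 0 < x -> 0 <= g^`()^`() x) ->
  g a + g^`() a * (b - a) <= g b.
Proof.
move=> a0 b0 dg ddg g2.
have isd (h : R -> R) : (forall x : R, 0 < x -> derivable h x 1) ->
    forall x : R, 0 < x -> is_derive x 1 h (h^`() x).
  by move=> dh x x0; rewrite derive1E; exact/derivableP/dh.
have cw (h : R -> R) (u v : R) : (forall x : R, 0 < x -> derivable h x 1) -> 0 < u ->
    {within `[u, v], continuous h}.
  move=> dh u0; apply: derivable_within_continuous => x.
  by rewrite in_itv/= => /andP[ux _]; apply: dh; exact: lt_le_trans ux.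
have posI (u v x : R) : 0 < u -> x \in `]u, v[ -> 0 < x.
  by move=> u0; rewrite in_itv/= => /andP[ux _]; exact: lt_trans ux.
have mono (u v : R) : 0 < u -> u <= v -> g^`() u <= g^`() v.
  move=> u0 uv.
  have [c] := @MVT_segment R g^`() g^`()^`() u v uv
    (fun x xuv => isd _ ddg x (posI _ _ _ u0 xuv)) (cw _ _ _ ddg u0).
  rewrite in_itv/= => /andP[uc cv] guv; rewrite -subr_ge0 guv.
  by rewrite mulr_ge0 ?subr_ge0// g2//; exact: lt_le_trans uc.
have [ab|ba] := leP a b.
  have [c] := @MVT_segment R g g^`() a b ab
    (fun x xuv => isd _ dg x (posI _ _ _ a0 xuv)) (cw _ _ _ dg a0).
  rewrite in_itv/= => /andP[ac cb] gab.
  rewrite -lerBrDl gab ler_wpM2r ?subr_ge0//; exact: mono.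
have [c] := @MVT_segment R g g^`() b a (ltW ba)
    (fun x xuv => isd _ dg x (posI _ _ _ b0 xuv)) (cw _ _ _ dg b0).
rewrite in_itv/= => /andP[bc ca] gab.
have : g^`() c * (a - b) <= g^`() a * (a - b).
  by rewrite ler_wpM2r ?subr_ge0 ?(ltW ba)//; apply: mono => //; exact: lt_le_trans bc.
by rewrite -gab; lra.
Qed.

(* The slopes of a convex function are squeezed by difference quotients, and
   these converge. *)
Lemma cvg_derive_convex (g_ : nat -> R -> R) (g : R -> R) (x : R) : 0 < x ->
  (forall n (y : R), 0 < y -> derivable (g_ n) y 1) ->
  (forall n (y : R), 0 < y -> derivable (g_ n)^`() y 1) ->
  (forall n (y : R), 0 < y -> 0 <= (g_ n)^`()^`() y) ->
  (forall y : R, 0 < y -> g_ ^~ y @ \oo --> g y) ->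
  derivable g x 1 ->
  (fun n => (g_ n)^`() x) @ \oo --> g^`() x.
Proof.
move=> x0 dg ddg g2 gg dgx; apply/cvgrPdist_le => /= e e0.
have := dgx; rewrite /derivable => /cvg_ex[/= l]; under eq_fun do rewrite scaler1.
move=> gl; have -> : g^`() x = l.
  by rewrite derive1E; apply/cvg_lim => //; under eq_fun do rewrite scaler1.
have /cvgrPdist_le/(_ (e / 2)) := gl.
rewrite divr_gt0// => /(_ isT)/= [d /= d0 dl].
(* Below [d], so that both difference quotients of [g] are within [e / 2] of the derivative, and
   below [x], so that [x - h] stays in the half-line. *)
pose h := Num.min (d / 2) (x / 2).
have h0 : 0 < h by rewrite /h lt_min !divr_gt0.
have hd : h < d by rewrite /h gt_min; apply/orP; left; rewrite ltr_pdivrMr//; lra.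
have hx : h < x by rewrite /h gt_min; apply/orP; right; rewrite ltr_pdivrMr//; lra.
have xh0 : 0 < x - h by rewrite subr_gt0.
have hx0 : 0 < h + x by rewrite addr_gt0.
have quot (k : R) : `|k| < d -> k != 0 -> `|l - k^-1 * (g (k + x) - g x)| <= e / 2.
  by move=> kd k0; apply: dl => //=; rewrite sub0r normrN.
have lp : `|l - h^-1 * (g (h + x) - g x)| <= e / 2.
  by apply: quot; rewrite ?gtr0_norm ?gt_eqF.
have lm : `|l - h^-1 * (g x - g (x - h))| <= e / 2.
  have := quot (- h); rewrite normrN gtr0_norm// oppr_eq0 gt_eqF// => /(_ hd isT).
  by rewrite invrN mulNr -mulrN opprB [- h + x]addrC.
have cp : h^-1 * (g_ n (h + x) - g_ n x) @[n --> \oo] --> h^-1 * (g (h + x) - g x).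
  by apply: cvgM; [exact: cvg_cst|apply: cvgB; exact: gg].
have cm : h^-1 * (g_ n x - g_ n (x - h)) @[n --> \oo] --> h^-1 * (g x - g (x - h)).
  by apply: cvgM; [exact: cvg_cst|apply: cvgB; exact: gg].
have e20 : 0 < e / 2 by rewrite divr_gt0.
move/cvgrPdist_le : cp => /(_ _ e20) cp.
move/cvgrPdist_le : cm => /(_ _ e20) cm.
near=> n.
have cpn : `|h^-1 * (g (h + x) - g x) - h^-1 * (g_ n (h + x) - g_ n x)| <= e / 2.
  by near: n.
have cmn : `|h^-1 * (g x - g (x - h)) - h^-1 * (g_ n x - g_ n (x - h))| <= e / 2.
  by near: n.
have ub : (g_ n)^`() x <= h^-1 * (g_ n (h + x) - g_ n x).
  rewrite ler_pdivlMl// mulrC.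
  have := tangent_below (g_ n) x (h + x) x0 hx0 (dg n) (ddg n) (g2 n).
  by rewrite addrK; lra.
have lb : h^-1 * (g_ n x - g_ n (x - h)) <= (g_ n)^`() x.
  rewrite ler_pdivrMl// mulrC.
  have := tangent_below (g_ n) x (x - h) x0 xh0 (dg n) (ddg n) (g2 n).
  have -> : x - h - x = - h by ring.
  by rewrite mulrN; lra.
move: lp lm cpn cmn ub lb; rewrite !ler_distl => /andP[? ?] /andP[? ?] /andP[? ?] /andP[? ?].
by move=> ? ?; apply/andP; split; lra.
Unshelve. all: by end_near. Qed.

Lemma derive1_signr (m : nat) (f : R -> R) (x : R) : derivable f x 1 ->
  (fun y => (-1) ^+ m * f y)^`() x = (-1) ^+ m * f^`() x.
Proof.
move=> df; have d : is_derive x 1 f (f^`() x) by rewrite derive1E; exact/derivableP.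
have d' : is_derive x 1 (fun y => (-1) ^+ m * f y) ((-1) ^+ m * f^`() x).
  exact: (is_deriveZ ((-1) ^+ m) d).
by rewrite derive1E derive_val.
Qed.

Lemma cvg_signr (m : nat) (u : R^nat) (l : R) : u @ \oo --> l ->
  (fun n => (-1) ^+ m * u n) @ \oo --> (-1) ^+ m * l.
Proof. by move=> ul; apply: cvgM => //; exact: cvg_cst. Qed.

(** Induction on the order. With the sign [(-1) ^+ m], the derivative of order [m] has as second
    derivative the nonnegative signed derivative of order [m + 2]; it is therefore convex, and
    [cvg_derive_convex] gains one order. *)
Lemma cvg_completely_monotone (f_ : nat -> R -> R) (f : R -> R) :
  (forall n, completely_monotone (f_ n)) ->
  (forall x : R, 0 < x -> f_ ^~ x @ \oo --> f x) ->
  smooth_pos f ->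
  forall m (x : R), 0 < x -> (fun n => (f_ n)^`(m) x) @ \oo --> f^`(m) x.
Proof.
move=> cmf ff sf; elim=> [|m ih] x x0; first exact: ff.
have dsig (h : R -> R) y : derivable h y 1 ->
    derivable (fun y => (-1) ^+ m * h y) y 1 by move=> dh; exact: derivableM.
have sE n y : 0 < y ->
    (fun z => (-1) ^+ m * (f_ n)^`(m) z)^`() y = (-1) ^+ m * (f_ n)^`(m.+1) y.
  by move=> y0; rewrite derive1_signr ?derive1nS//; exact: (cmf n).1.
have sE2 n (y : R) : 0 < y ->
    \near y, (-1) ^+ m * (f_ n)^`(m.+1) y =
      (fun z => (-1) ^+ m * (f_ n)^`(m) z)^`() y.
  by move=> y0; near=> z; rewrite sE//; near: z; exact: lt_nbhsr.
have : (fun n => (fun z => (-1) ^+ m * (f_ n)^`(m) z)^`() x) @ \oo -->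
    (fun z => (-1) ^+ m * f^`(m) z)^`() x.
  apply: (@cvg_derive_convex (fun n z => (-1) ^+ m * (f_ n)^`(m) z)) => //.
  - by move=> n y y0; apply: dsig; exact: (cmf n).1.
  - move=> n y y0; apply: near_eq_derivable (sE2 n y y0) _.
    by apply: dsig; exact: (cmf n).1.
  - move=> n y y0; rewrite derive1E -(near_eq_derive _ (sE2 n y y0))//.
    rewrite -derive1E derive1_signr; last exact: (cmf n).1.
    rewrite -derive1nS; have := (cmf n).2 m.+2 y y0.
    by rewrite 2!exprS !mulN1r opprK.
  - by move=> y y0; apply: cvgM; [exact: cvg_cst|exact: ih].
  - by apply: dsig; exact: sf.
under eq_fun do rewrite sE//.
rewrite (derive1_signr m _ _ (sf m x x0)) -derive1nS.
move=> /(cvg_signr m); rewrite signrMK.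
by under eq_fun do rewrite signrMK.
Unshelve. all: by end_near. Qed.

Lemma completely_monotone_lim (f_ : nat -> R -> R) (f : R -> R) :
  (forall n, completely_monotone (f_ n)) ->
  (forall x : R, 0 < x -> f_ ^~ x @ \oo --> f x) ->
  smooth_pos f -> completely_monotone f.
Proof.
move=> cmf ff sf; split=> // m x x0.
have := cvg_completely_monotone _ _ cmf ff sf m x x0.
move=> /(cvg_signr m) c.
rewrite -(cvg_lim _ c)//; apply: limr_ge; first by apply/cvg_ex; eexists; exact: c.
by near=> n; exact: (cmf n).2.
Unshelve. all: by end_near. Qed.

Section exponential_sum.
Context {I : finType} (w X : I -> R).
Hypotheses (w0 : forall i, 0 <= w i) (X0 : forall i, 0 <= X i).

Let is_derive_expsum m (x : R) :
  is_derive x 1 (fun x => \sum_(i : I) (w i * (- X i) ^+ m) * expR (- (x * X i)))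
    (\sum_(i : I) (w i * (- X i) ^+ m.+1) * expR (- (x * X i))).
Proof.
elim: (index_enum I) => [|i s ds].
  by under eq_fun do rewrite big_nil; rewrite big_nil; exact: is_derive_cst.
under eq_fun do rewrite big_cons; rewrite big_cons.
have dh : is_derive x 1 (fun x => (w i * (- X i) ^+ m) * expR (- (x * X i)))
    ((w i * (- X i) ^+ m.+1) * expR (- (x * X i))).
  by apply: is_derive_eq; rewrite /GRing.scale/= exprSr; ring.
exact: is_deriveD.
Qed.

Lemma derive1n_expsum m :
  (fun x => \sum_(i : I) w i * expR (- (x * X i)))^`(m) =
  (fun x => \sum_(i : I) (w i * (- X i) ^+ m) * expR (- (x * X i))).
Proof.
elim: m => [|m ih].
  by apply/funext => x; rewrite derive1n0; apply: eq_bigr => i _; rewrite expr0 mulr1.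
rewrite derive1nS {}ih; apply/funext => x; rewrite derive1E.
by have := is_derive_expsum m x => ?; rewrite derive_val.
Qed.

(** This is the Laplace transform of the measure with mass [w i] at [X i]; each differentiation
    brings down a factor [- X i]. *)
Lemma completely_monotone_expsum :
  completely_monotone (fun x => \sum_(i : I) w i * expR (- (x * X i))).
Proof.
split=> [m x _|m x _]; rewrite derive1n_expsum.
  by have [] := is_derive_expsum m x.
rewrite mulr_sumr; apply: sumr_ge0 => i _.
rewrite mulrA mulr_ge0 ?expR_ge0// mulrCA mulr_ge0//.
by rewrite -exprMn mulN1r opprK exprn_ge0.
Qed.

End exponential_sum.
End completely_monotone.

(** * Smoothness of the hypergeometric function by differentiation under the integral *)

Section Fhyp_smooth.
Local Notation "f ^` ()" := (derive1 f) : ring_scope.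
Local Notation "f ^` ( n )" := (derive1n n f) : ring_scope.
Context {R : realType}.
Notation leb := (@lebesgue_measure R).
Variable alpha : R.
Hypothesis alpha2 : 2 < alpha.

Let D : set R := `[1%R, +oo[.
Let mD : measurable (D : set (measurableTypeR R)). Proof. exact: measurable_itv. Qed.

(** Measurability is imported from [powR], which inverts nonnegative reals; the square brings every
    real there, and at 0 both sides are 0. *)
Lemma measurable_invr : measurable_fun [set: R] (@GRing.inv R).
Proof.
have -> : @GRing.inv R = fun x => x * (x ^+ 2) `^ (- 1).
  apply/funext => x; rewrite powR_inv1 ?sqr_ge0//.
  by have [->|x0] := eqVneq x 0; [rewrite invr0 mul0r|rewrite expr2 invfM mulVKf].
apply: measurable_funM => //; apply: (measurableT_comp (measurable_powR _)).
exact: measurable_funX.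
Qed.

Lemma powR_continuous (a x : R) : 0 < x -> {for x, continuous (@powR R ^~ a)}.
Proof.
move=> x0; apply: differentiable_continuous; apply/derivable1_diffP.
by have [] := is_derive1_powR a x0.
Qed.

Lemma powRN_cvgy (a : R) : 0 < a -> (x `^ (- a)) @[x --> +oo] --> (0 : R).
Proof.
move=> a0; apply/cvgrPdist_le => /= e e0; near=> x.
have x0 : 0 < x by near: x; exact: nbhs_pinfty_gt.
have ex : e^-1 `^ a^-1 <= x by near: x; exact: nbhs_pinfty_ge.
rewrite sub0r normrN ger0_norm ?powR_ge0// powRN.
rewrite -[leRHS]invrK lef_pV2 ?posrE ?invr_gt0 ?powR_gt0//.
rewrite -[leLHS]powRr1 ?invr_ge0 ?(ltW e0)// -(mulVf (lt0r_neq0 a0)) powRrM.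
by apply: ge0_ler_powR; rewrite ?nnegrE ?powR_ge0 ?ltW.
Unshelve. all: by end_near. Qed.

(** Mass of the envelope that dominates the integrand and all its derivatives in [y]. The primitive
    is a multiple of t^(2 - alpha), which vanishes at infinity because [2 < alpha]. *)
Lemma integral_powR_tail :
  (\int[leb]_(t in D) (2 * t `^ (1 - alpha))%:E = (2 / (alpha - 2))%:E)%E.
Proof.
rewrite (@ge0_continuous_FTC2y _ _ (fun t => 2 / (2 - alpha) * t `^ (2 - alpha)) _ 0).
- by rewrite powR1 mulr1 sub0e -EFinN -mulrN -invrN opprB.
- by move=> x x1; rewrite mulr_ge0// powR_ge0.
- apply/continuous_within_itvcyP; split.
  + move=> x; rewrite in_itv/= andbT => x1; apply: cvgM; first exact: cvg_cst.
    by apply: powR_continuous; exact: lt_trans x1.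
  + apply: cvg_at_right_filter; apply: cvgM; first exact: cvg_cst.
    exact: powR_continuous.
- rewrite -[X in _ --> X](mulr0 (2 / (2 - alpha))); apply: cvgM; first exact: cvg_cst.
  by rewrite -(opprB alpha); apply: powRN_cvgy; rewrite subr_gt0.
- move=> x x1; apply: derivableM => //.
  by have [] := is_derive1_powR (2 - alpha) (lt_trans ltr01 x1).
- apply: cvg_at_right_filter; apply: cvgM; first exact: cvg_cst.
  exact: powR_continuous.
- move=> x; rewrite in_itv/= andbT => x1.
  have x0 : 0 < x by exact: lt_trans x1.
  have dx := is_derive1_powR (2 - alpha) x0.
  have dM : is_derive x 1 (fun t => 2 / (2 - alpha) * t `^ (2 - alpha))
      (2 / (2 - alpha) * ((2 - alpha) * x `^ (2 - alpha - 1))).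
    by apply: is_derive_eq; rewrite /GRing.scale/=; ring.
  rewrite derive1E derive_val.
  rewrite mulrA divfK; last by rewrite lt_eqF// subr_lt0.
  by congr (_ * _ `^ _); ring.
Qed.

Let k (m : nat) (y t : R) := 2 * t `^ (1 + alpha) / (t `^ alpha + y) ^+ m.+1.

Let den_gt0 (y t : R) : 0 <= y -> D t -> 0 < t `^ alpha + y.
Proof.
move=> y0; rewrite /D/= in_itv/= andbT => t1.
by rewrite ltr_pwDl// powR_gt0//; exact: lt_le_trans t1.
Qed.

(** Derivative of order [m] in [y] of the integrand of [Fhyp]. Since 2yt/(t^alpha + y) = 2t - 2t^(1
    + alpha)/(t^alpha + y), all orders from 1 on come from a power of the denominator. *)
Definition hyp_integrand (m : nat) (y t : R) : R :=
  if m is m'.+1 then (-1) ^+ m' * m`!%:R * k m y t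
  else 2 * y * t / (t `^ alpha + y).

Lemma is_derive_hyp_integrand m (y t : R) : 0 < y -> D t ->
  is_derive y 1 (fun y => hyp_integrand m y t) (hyp_integrand m.+1 y t).
Proof.
move=> y0 Dt; have d0 := den_gt0 y t (ltW y0) Dt.
have t0 : 0 < t by move: Dt; rewrite /D/= in_itv/= andbT; exact: lt_le_trans.
have dV p : is_derive y 1 (fun y => ((t `^ alpha + y) ^+ p.+1)^-1)
    (- p.+1%:R / (t `^ alpha + y) ^+ p.+2).
  have dn0 : (t `^ alpha + y) ^+ p.+1 != 0 by rewrite expf_neq0// gt_eqF.
  have dp : is_derive y 1 (fun y => (t `^ alpha + y) ^+ p.+1)
     (p.+1%:R * (t `^ alpha + y) ^+ p).
    have -> : (fun y => (t `^ alpha + y) ^+ p.+1) = (fun y => t `^ alpha + y) ^+ p.+1.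
      by apply/funext => z; rewrite exprfctE.
    have d1 : is_derive y 1 (fun y : R => t `^ alpha + y) 1.
      rewrite -[X in is_derive _ _ _ X]add0r.
      exact: (is_deriveD (is_derive_cst (t `^ alpha) y 1) (is_derive_id y 1)).
    apply: (@is_derive_eq _ _ _ _ _ _ _ _ (is_deriveX p.+1 d1)).
    by rewrite /GRing.scale/= mulr1.
  have dI := @is_deriveV _ (fun y => (t `^ alpha + y) ^+ p.+1) _ _ _ dn0 dp.
  apply: (is_derive_eq dI); rewrite /GRing.scale/= !exprS.
  have := expf_neq0 p (lt0r_neq0 d0); move: (_ ^+ p) => q q0.
  by field; rewrite q0 gt_eqF.
case: m => [|m].
  rewrite /=; have := dV 0%N => dV0.
  have tt : t `^ (1 + alpha) = t * t `^ alpha.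
    by rewrite powRD ?(gt_eqF t0) ?implybT// powRr1// ltW.
  have E : (fun y => 2 * y * t / (t `^ alpha + y)) =
     (fun y => (2 * t) * (y * ((t `^ alpha + y) ^+ 1)^-1)).
    by apply/funext => z; rewrite expr1; ring.
  rewrite E; apply: is_derive_eq.
  rewrite /GRing.scale/= /k tt /= expr0 factS fact0 muln1 !mul1r.
  field.
  by rewrite gt_eqF.
rewrite /=; have := dV m.+1 => dVm.
have E : (fun y => (-1) ^+ m * m.+1`!%:R * k m.+1 y t) =
   (fun y => ((-1) ^+ m * m.+1`!%:R * (2 * t `^ (1 + alpha))) *
     (((t `^ alpha + y) ^+ m.+2)^-1)).
  by apply/funext => z; rewrite /k; ring.
rewrite E; apply: is_derive_eq.
rewrite /GRing.scale/= /k (factS m.+1) natrM [in RHS]exprS; field.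
by rewrite expf_neq0// gt_eqF.
Qed.

(** The factor [y] covers [m = 0], where the numerator contains [y]; the factorial covers [m > 0],
    where the denominator is at least t^(2 alpha). The bound is locally uniform in [y], as
    domination requires. *)
Lemma hyp_integrand_bound m (y t : R) : 0 <= y -> D t ->
  `|hyp_integrand m y t| <= (y + m`!%:R) * (2 * t `^ (1 - alpha)).
Proof.
move=> y0 Dt; have d0 := den_gt0 y t y0 Dt.
have t1 : 1 <= t by move: Dt; rewrite /D/= in_itv/= andbT.
have t0 : 0 < t by exact: lt_le_trans t1.
have ta0 : 0 < t `^ alpha by exact: powR_gt0.
have tB : t `^ (1 - alpha) = t / t `^ alpha.
  by rewrite powRD ?(gt_eqF t0) ?implybT// powRr1 ?(ltW t0)// powRN.
have tt : t `^ (1 + alpha) = t * t `^ alpha.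
  by rewrite powRD ?(gt_eqF t0) ?implybT// powRr1// ltW.
have t1a : 1 <= t `^ alpha.
  by rewrite -(powRr0 t) ler_powR// ltW// (lt_trans _ alpha2).
have dt : t `^ alpha <= t `^ alpha + y by rewrite lerDl.
case: m => [|m] /=.
  rewrite ger0_norm; last by rewrite divr_ge0 ?(ltW d0)// !mulr_ge0// ltW.
  rewrite fact0 tB -mulrA [2 * y]mulrC -!mulrA.
  rewrite [leRHS]mulrDl; apply: (@le_trans _ _ (y * (2 * (t / t `^ alpha)))).
    by rewrite ler_wpM2l// ler_wpM2l// ler_wpM2l ?(ltW t0)// lef_pV2 ?posrE.
  by rewrite lerDl !mulr_ge0 ?invr_ge0// ltW.
rewrite 2!normrM normr_sign mul1r normr_nat /k.
rewrite ger0_norm; last by rewrite divr_ge0 ?exprn_ge0 ?(ltW d0)// mulr_ge0 ?powR_ge0.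
rewrite [leRHS]mulrDl; apply: ler_wpDl; first by rewrite !mulr_ge0 ?powR_ge0.
rewrite ler_wpM2l// tB tt -mulrA ler_wpM2l// -mulrA ler_wpM2l ?(ltW t0)//.
rewrite ler_pdivrMr ?exprn_gt0// mulrC ler_pdivlMr// -expr2.
apply: (@le_trans _ _ ((t `^ alpha + y) ^+ 2)).
  by rewrite ler_sqr ?nnegrE ?(ltW d0)// ltW.
by rewrite ler_weXn2l// (le_trans t1a).
Qed.

Lemma measurable_hyp_integrand m (y : R) : measurable_fun setT (hyp_integrand m y).
Proof.
have mp (a : R) : measurable_fun [set: R] (@powR R ^~ a) by exact: measurable_powR.
have mi (p : nat) : measurable_fun [set: R] (fun t : R => ((t `^ alpha + y) ^+ p)^-1).
  apply: (measurableT_comp measurable_invr).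
  by apply: measurable_funX; apply: measurable_funD => //; exact: measurable_cst.
case: m => [|m] /=.
  apply: measurable_funM; first exact: measurable_funM.
  by have := mi 1%N; under eq_fun do rewrite expr1.
apply: measurable_funM => //; rewrite /k; apply: measurable_funM; last exact: mi.
exact: measurable_funM.
Qed.

Lemma integrable_powR_tail (c : R) :
  leb.-integrable D (EFin \o (fun t => c * (2 * t `^ (1 - alpha)))).
Proof.
have -> : EFin \o (fun t => c * (2 * t `^ (1 - alpha))) =
    (fun t => c%:E * (2 * t `^ (1 - alpha))%:E)%E by apply/funext.
apply: integrableZl => //.
apply/integrableP; split.
  by apply/measurable_EFinP; apply: measurable_funTS; apply: measurable_funM.
under eq_integral do rewrite gee0_abs ?lee_fin ?mulr_ge0 ?powR_ge0//.
by rewrite integral_powR_tail ltry.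
Qed.

Lemma integrable_hyp_integrand m (y : R) : 0 <= y ->
  leb.-integrable D (EFin \o hyp_integrand m y).
Proof.
move=> y0; apply: le_integrable (integrable_powR_tail (y + m`!%:R)) => //.
  by apply/measurable_EFinP; apply: measurable_funTS; exact: measurable_hyp_integrand.
move=> t Dt /=; rewrite lee_fin (le_trans (hyp_integrand_bound m y t y0 Dt))//.
exact: ler_norm.
Qed.

Let H m y := (\int[leb]_(t in D) hyp_integrand m y t)%R.

Let is_derive_H m (y : R) : 0 < y -> is_derive y 1 (H m) (H m.+1 y).
Proof.
move=> y0.
(* A neighbourhood of [y] inside the half-line on which [y + 1] bounds the parameter, hence gives
   one envelope. *)
have Iy : (`]0, y + 1[%classic : set R) y by rewrite /= in_itv/= y0 ltrDl ltr01.
have pos x : (`]0, y + 1[%classic : set R) x -> 0 < x by rewrite /= in_itv/= => /andP[].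
have d1 x t : (`]0, y + 1[%classic : set R) x -> D t ->
    partial1of2 (hyp_integrand m) x t = hyp_integrand m.+1 x t.
  move=> /pos x0 Dt; rewrite /partial1of2 derive1E.
  by have := is_derive_hyp_integrand m x t x0 Dt => dx; rewrite derive_val.
have G0 (t : R) : 0 <= (y + 1 + m.+1`!%:R) * (2 * t `^ (1 - alpha)).
  by rewrite mulr_ge0 ?mulr_ge0 ?powR_ge0// !addr_ge0// ltW.
have gub x t : (`]0, y + 1[%classic : set R) x -> D t ->
    `|partial1of2 (hyp_integrand m) x t| <= (y + 1 + m.+1`!%:R) * (2 * t `^ (1 - alpha)).
  move=> Ix Dt; rewrite d1//.
  apply: (le_trans (hyp_integrand_bound m.+1 x t (ltW (pos _ Ix)) Dt)).
  rewrite ler_wpM2r ?mulr_ge0 ?powR_ge0// lerD2r.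
  by move: Ix; rewrite /= in_itv/= => /andP[_ /ltW].
have intf x : (`]0, y + 1[%classic : set R) x -> leb.-integrable D (EFin \o hyp_integrand m x).
  by move=> /pos/ltW; exact: integrable_hyp_integrand.
have der x t : (`]0, y + 1[%classic : set R) x -> D t -> derivable (hyp_integrand m ^~ t) x 1.
  by move=> /pos x0 Dt; have [] := is_derive_hyp_integrand m x t x0 Dt.
have iG := integrable_powR_tail (y + 1 + m.+1`!%:R).
apply: DeriveDef.
  exact (derivable_under_integral mD Iy intf der G0 iG gub).
rewrite -derive1E (differentiation_under_integral mD Iy intf der G0 iG gub).
rewrite /H /Rintegral; congr fine; apply: eq_integral => t /set_mem Dt.
by rewrite d1.
Qed.

Lemma derive1n_hyp m (y : R) : 0 < y ->
  (fun y => Fhyp alpha y - 1)^`(m) y = (\int[leb]_(t in D) hyp_integrand m y t)%R.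
Proof.
elim: m y => [|m ih] y y0; first by rewrite derive1n0 /Fhyp addrC addKr.
rewrite derive1nS derive1E.
have := is_derive_H m y y0 => dH.
rewrite -[RHS](@derive_val _ _ _ _ _ _ _ dH); apply: near_eq_derive.
by near=> z; apply: ih; near: z; exact: lt_nbhsr.
Unshelve. all: by end_near. Qed.

Lemma smooth_pos_hyp : smooth_pos (fun y => Fhyp alpha y - 1).
Proof.
move=> m y y0; have [dH _] := is_derive_H m y y0.
apply: near_eq_derivable dH; near=> z; apply/esym/derive1n_hyp.
by near: z; exact: lt_nbhsr.
Unshelve. all: by end_near. Qed.

Lemma Fhyp_ge1 (y : R) : 0 <= y -> 0 <= Fhyp alpha y - 1.
Proof.
move=> y0; rewrite /Fhyp addrC addKr; apply: fine_ge0; apply: integral_ge0 => t Dt.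
rewrite lee_fin; have t0 : 0 <= t by move: Dt; rewrite /= in_itv/= andbT; exact: le_trans.
by rewrite divr_ge0 ?(ltW (den_gt0 y t y0 Dt))// !mulr_ge0.
Qed.

(** Dropping [y] from the denominator leaves the envelope. The linear bound makes [Fhyp] tend to 1
    at 0, which will identify the total mass of the limit transform. *)
Lemma Fhyp_le (y : R) : 0 <= y -> Fhyp alpha y - 1 <= y * (2 / (alpha - 2)).
Proof.
move=> y0; have iy := integrable_hyp_integrand 0 y y0.
rewrite /Fhyp addrC addKr -lee_fin fineK; last exact: integrable_fin_num iy.
rewrite EFinM -integral_powR_tail -integralZl//; last first.
  by have := integrable_powR_tail 1; apply: eq_integrable => // x _ /=; rewrite mul1r.
apply: le_integral => //; first exact: (integrable_powR_tail y).
move=> t /set_mem Dt.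
have t1 : 1 <= t by move: Dt; rewrite /D/= in_itv/= andbT.
have t0 : 0 < t by exact: lt_le_trans t1.
have ta0 : 0 < t `^ alpha by exact: powR_gt0.
have tB : t `^ (1 - alpha) = t / t `^ alpha.
  by rewrite powRD ?(gt_eqF t0) ?implybT// powRr1 ?(ltW t0)// powRN.
rewrite -EFinM lee_fin tB.
have -> : y * (2 * (t / t `^ alpha)) = 2 * y * t / t `^ alpha by ring.
rewrite ler_wpM2l ?mulr_ge0 ?(ltW t0)//.
by rewrite lef_pV2 ?posrE ?lerDl// den_gt0.
Qed.

End Fhyp_smooth.

(** * Finite measures with a density *)

Section density_measure.
Local Open Scope ereal_scope.
Context {d : measure_display} {T : measurableType d} {R : realType}.
Variables (mu : {measure set T -> \bar R}) (f : T -> R).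

(** The proofs are arguments so that the measure and finiteness structures can be attached to the
    term itself. *)
Definition mdensity of measurable_fun [set: T] f & (forall x, (0 <= f x)%R) &
    \int[mu]_x (f x)%:E < +oo : set T -> \bar R := fun A => \int[mu]_(x in A) (f x)%:E.

Hypotheses (mf : measurable_fun [set: T] f) (f0 : forall x, (0 <= f x)%R)
  (foo : \int[mu]_x (f x)%:E < +oo).
Local Notation nu := (mdensity mf f0 foo).

Let mEf : measurable_fun [set: T] (fun x => (f x)%:E).
Proof. exact/measurable_EFinP. Qed.

Let nu0 : nu set0 = 0. Proof. by rewrite /mdensity integral_set0. Qed.

Let nu_ge0 A : 0 <= nu A. Proof. by apply: integral_ge0 => x _; rewrite lee_fin. Qed.

Let nu_sigma_additive : semi_sigma_additive nu.
Proof.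
move=> /= F mF tF mUF; rewrite /mdensity; apply: cvg_toP.
  apply: ereal_nondecreasing_is_cvgn => m n mn.
  by apply: lee_sum_nneg_natr => // k _ _; apply: integral_ge0 => x _; rewrite lee_fin.
rewrite ge0_integral_bigcup//=; first exact: measurable_funTS.
by move=> x _; rewrite lee_fin.
Qed.

HB.instance Definition _ := isMeasure.Build _ _ _ nu nu0 nu_ge0 nu_sigma_additive.

Let nu_fin : fin_num_fun nu.
Proof.
move=> A mA; rewrite ge0_fin_numE//; apply: le_lt_trans foo.
by apply: ge0_subset_integral => // x _; rewrite lee_fin.
Qed.

HB.instance Definition _ := Measure_isFinite.Build _ _ _ nu nu_fin.

Import HBNNSimple.

Let integral_mdensity_nnsfun (h : {nnsfun T >-> R}) :
  \int[nu]_x (h x)%:E = \int[mu]_x ((h x)%:E * (f x)%:E).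
Proof.
under [LHS]eq_integral do rewrite fimfunE -fsumEFin//.
rewrite [LHS]ge0_integral_fsum//; last 2 first.
  - by move=> r; exact/measurable_EFinP/measurableT_comp.
  - by move=> n x _; rewrite EFinM nnfun_muleindic_ge0.
under [RHS]eq_integral.
  move=> x xD; rewrite fimfunE -fsumEFin// ge0_mule_fsuml; last first.
    by move=> r; rewrite EFinM nnfun_muleindic_ge0.
  over.
rewrite [RHS]ge0_integral_fsum//; last 2 first.
  - move=> r; apply: emeasurable_funM => //.
    exact/measurable_EFinP/measurableT_comp.
  - by move=> n x _; rewrite mule_ge0 ?lee_fin// -lee_fin EFinM nnfun_muleindic_ge0.
apply: eq_fsbigr => r _; rewrite integralZl_indic_nnsfun// integral_indic// setIT.
have [r0|r0] := ltP r 0%R.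
  have -> : h @^-1` [set r] = set0.
    by apply/seteqP; split=> // x /= hr; move: r0; rewrite -hr ltNge fun_ge0.
  rewrite measure0 mule0 integral0_eq// => x _.
  by rewrite indic0 mulr0 mul0e.
under eq_integral do rewrite EFinM -muleA.
rewrite ge0_integralZl_EFin//; last 2 first.
- by move=> x _; rewrite mule_ge0 ?lee_fin.
- by apply: emeasurable_funM => //; exact/measurable_EFinP.
congr (_ * _); rewrite /nu/= /mdensity integral_mkcond; apply: eq_integral => x _.
rewrite patchE indicE; case: ifPn => _; first by rewrite mul1e.
by rewrite mul0e.
Qed.

Lemma ge0_integral_mdensity (h : T -> \bar R) : measurable_fun [set: T] h ->
  (forall x, 0 <= h x) -> \int[nu]_x h x = \int[mu]_x (h x * (f x)%:E).
Proof.
move=> mh h0; pose h_ := nnsfun_approx measurableT mh.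
have ch x : (h_ n x)%:E @[n --> \oo] --> h x by exact: cvg_nnsfun_approx.
transitivity (limn (fun n => \int[nu]_x (h_ n x)%:E)).
  rewrite -monotone_convergence//=.
  - by apply: eq_integral => x _; apply/esym/cvg_lim => //; exact: ch.
  - by move=> n; exact/measurable_EFinP.
  - by move=> n x _; rewrite lee_fin.
  - by move=> x _ a b ab; rewrite lee_fin//; exact/lefP/nd_nnsfun_approx.
under eq_fun do rewrite integral_mdensity_nnsfun.
rewrite -monotone_convergence//=.
- apply: eq_integral => x _; apply/cvg_lim => //.
  by apply: cvgeZr => //; exact: ch.
- by move=> n; apply: emeasurable_funM => //; exact/measurable_EFinP.
- by move=> n x _; rewrite mule_ge0 ?lee_fin.
- move=> x _ a b ab; rewrite lee_wpmul2r ?lee_fin//.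
  exact/lefP/nd_nnsfun_approx.
Qed.

End density_measure.

(** * Gamma tails and the exponential mark *)

Section gamma_tail.
Local Notation "f ^` ()" := (derive1 f) : ring_scope.
Context {R : realType}.
Notation leb := (@lebesgue_measure R).

Lemma is_derive_cvg_at_right (F : R -> R) (x l : R) : is_derive x 1 F l ->
  F y @[y --> x^'+] --> F x.
Proof.
move=> [dF _]; have cF : {for x, continuous F}.
  by apply: differentiable_continuous; exact/derivable1_diffP.
exact: cvg_at_right_filter.
Qed.

(* tail of the Gamma distribution of shape k and scale 1 *)
Definition gamma_tail (k : nat) (x : R) : R :=
  \sum_(m < k) x ^+ m / m`!%:R * expR (- x).

Lemma gamma_tailE k x :
  gamma_tail k x = \sum_(m < k) x ^+ m / m`!%:R * expR (- x).
Proof. by []. Qed.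

(** The derivatives of the summands telescope, leaving the last one: minus the tail is a primitive
    of the Gamma density. *)
Lemma is_derive_gamma_tail k (x : R) :
  is_derive x 1 (gamma_tail k.+1) (- (x ^+ k / k`!%:R * expR (- x))).
Proof.
elim: k => [|k ih].
  have -> : gamma_tail 1 = fun x => expR (- x).
    by apply/funext => y; rewrite /gamma_tail big_ord1 expr0 fact0 divr1 mul1r.
  by apply: is_derive_eq; rewrite expr0 fact0 divr1 mul1r /GRing.scale/= mulrN1.
have -> : gamma_tail k.+2 = fun x => gamma_tail k.+1 x + (k.+1`!%:R)^-1 * (x ^+ k.+1 * expR (- x)).
  by apply/funext => y; rewrite /gamma_tail big_ord_recr/= mulrA [_ * y ^+ _]mulrC.
have dX : is_derive x 1 (fun x : R => x ^+ k.+1) (k.+1%:R * x ^+ k).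
  have := is_deriveX k.+1 (is_derive_id x 1).
  have -> : (id : R -> R) ^+ k.+1 = fun x => x ^+ k.+1.
    by apply/funext => z; rewrite exprfctE.
  by move=> h; apply: (is_derive_eq h); rewrite /GRing.scale/= mulr1.
apply: is_derive_eq; rewrite /GRing.scale/=.
have kf : k.+1`!%:R = k.+1%:R * k`!%:R :> R by rewrite factS natrM.
have kf0 : k`!%:R != 0 :> R by rewrite pnatr_eq0 -lt0n fact_gt0.
have k0 : k.+1%:R != 0 :> R by rewrite pnatr_eq0.
rewrite kf; move: (k`!%:R) (k.+1%:R) kf0 k0 => a b a0 b0.
by field; rewrite a0 b0.
Qed.

Lemma gamma_tail_ge0 k (x : R) : 0 <= x -> 0 <= gamma_tail k x.
Proof.
by move=> x0; apply: sumr_ge0 => m _; rewrite mulr_ge0 ?expR_ge0// divr_ge0 ?exprn_ge0.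
Qed.

Lemma gamma_tail0 k : gamma_tail k.+1 0 = 1.
Proof.
rewrite /gamma_tail big_ord_recl/= big1 ?addr0 => [|i _].
  by rewrite expr0 fact0 divr1 mul1r oppr0 expR0.
by rewrite expr0n/= !mul0r.
Qed.

Lemma gamma_tail_cvgy k : gamma_tail k x @[x --> +oo] --> 0.
Proof.
have term m : (x ^+ m / m`!%:R * expR (- x)) @[x --> +oo] --> (0 : R).
  apply/cvgrPdist_le => /= e e0; near=> x.
  have x0 : 0 < x by near: x; exact: nbhs_pinfty_gt.
  (* Since e^x is at least x^(m+1)/(m+1)!, the term is at most (m+1)/x. *)
  have xe : m.+1%:R / e <= x by near: x; apply: nbhs_pinfty_ge; exact: num_real.
  rewrite sub0r normrN ger0_norm; last first.
    by rewrite mulr_ge0 ?expR_ge0// divr_ge0// exprn_ge0// ltW.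
  rewrite expRN ler_pdivrMr ?expR_gt0//.
  have h : x ^+ m.+1 / m.+1`!%:R <= expR x.
    by apply: le_trans (expR_ge1Dxn m (ltW x0)); rewrite lerDr.
  rewrite -ler_pdivrMl//; apply: le_trans h; rewrite ler_pdivrMl//.
  rewrite exprSr factS natrM invfM.
  rewrite [leRHS](_ : _ = x ^+ m / m`!%:R * (x * e / m.+1%:R)); last by ring.
  rewrite ler_peMr ?divr_ge0 ?exprn_ge0 ?(ltW x0)//.
  by rewrite ler_pdivlMr// mul1r -ler_pdivrMr.
elim: k => [|k ih].
  rewrite (_ : gamma_tail 0 = fun=> 0); first exact: cvg_cst.
  by apply/funext => x; rewrite /gamma_tail big_ord0.
rewrite (_ : gamma_tail k.+1 =
  fun x => gamma_tail k x + x ^+ k / k`!%:R * expR (- x)); last first.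
  by apply/funext => x; rewrite /gamma_tail big_ord_recr.
by rewrite -[X in _ --> X](addr0 (0 : R)); apply: cvgD.
Unshelve. all: by end_near. Qed.

(** The sum is a partial sum of the series of e^x, multiplied by e^(-x). *)
Lemma gamma_tail_le1 k (x : R) : 0 <= x -> gamma_tail k x <= 1.
Proof.
move=> x0; rewrite -(expRxMexpNx_1 x) /gamma_tail -mulr_suml.
rewrite ler_wpM2r ?expR_ge0//.
have := @nondecreasing_cvgn_le _ _ _ (is_cvg_series_exp_coeff x) k.
rewrite /expR /series/= big_mkord; apply.
apply/nondecreasing_seqP => n; rewrite big_nat_recr//= lerDl.
by rewrite divr_ge0// exprn_ge0.
Qed.

Lemma continuous_gamma_tail k : continuous (gamma_tail k).
Proof.
case: k => [|k] x.
  rewrite (_ : gamma_tail 0 = fun=> 0); first exact: cvg_cst.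
  by apply/funext => y; rewrite /gamma_tail big_ord0.
apply: differentiable_continuous; apply/derivable1_diffP.
by have [] := is_derive_gamma_tail k x.
Qed.

Lemma integral_gamma_tail k (theta xi : R) : (0 < k)%N -> 0 < theta -> 0 <= xi ->
  (\int[leb]_(g in `[xi, +oo[)
     (g ^+ k.-1 * expR (- (g / theta)) / ((k.-1)`!%:R * theta ^+ k))%:E
   = (gamma_tail k (xi / theta))%:E)%E.
Proof.
case: k => // k _ th0 xi0 /=.
have th : theta != 0 by rewrite gt_eqF.
have dF (x : R) : is_derive x 1 (fun g => - gamma_tail k.+1 (g / theta))
   (x ^+ k * expR (- (x / theta)) / (k`!%:R * theta ^+ k.+1)).
  have d1 := is_derive_gamma_tail k (x / theta).
  have d2 : is_derive x 1 (fun g => g / theta) theta^-1.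
    by apply: is_derive_eq; rewrite /GRing.scale/=; ring.
  have dc := @is_derive1_comp _ (gamma_tail k.+1) (fun g => g / theta) x _ _ d1 d2.
  apply: (is_derive_eq (is_deriveN dc)).
  rewrite expr_div_n exprS.
  have kf0 : k`!%:R != 0 :> R by rewrite pnatr_eq0 -lt0n fact_gt0.
  have t0 : theta ^+ k != 0 by rewrite expf_neq0.
  move: (k`!%:R) (theta ^+ k) (x ^+ k) kf0 t0 => a b c a0 b0.
  by field; rewrite a0 b0 th.
have cf : continuous (fun x : R => x ^+ k * expR (- (x / theta)) / (k`!%:R * theta ^+ k.+1)).
  move=> x; apply: cvgM; last exact: cvg_cst.
  apply: cvgM; first exact: exprn_continuous.
  apply: (cvg_comp (fun x : R => - (x / theta)) expR); last exact: continuous_expR.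
  by apply: cvgN; apply: cvgM; [exact: cvg_id|exact: cvg_cst].
rewrite (@ge0_continuous_FTC2y _ _ (fun g => - gamma_tail k.+1 (g / theta)) _ 0).
- by rewrite sub0e -EFinN opprK.
- move=> x xix; have x0 : 0 <= x by exact: le_trans xix.
  by rewrite divr_ge0 ?mulr_ge0 ?expR_ge0 ?exprn_ge0// ltW.
- exact: continuous_subspaceT.
- rewrite -oppr0; apply: cvgN.
  apply: (cvg_comp (fun g => g / theta) (gamma_tail k.+1)); last exact: gamma_tail_cvgy.
  by apply: gt0_cvgMly; rewrite ?invr_gt0//; exact: cvg_id.
- by move=> x _; have [] := dF x.
- exact: (is_derive_cvg_at_right _ _ _ (dF xi)).
- by move=> x _; rewrite derive1E; have := dF x => ?; rewrite derive_val.
Qed.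

(** One minus the Laplace transform of an exponential mark: the mark average inside the exponent of
    a Poisson functional. *)
Lemma integral_exp_mark (c theta : R) : 0 <= c -> 0 < theta ->
  (\int[leb]_(g in `[0%R, +oo[)
     ((1 - expR (- (c * g))) * (expR (- (g / theta)) / theta))%:E
   = (c * theta / (1 + c * theta))%:E)%E.
Proof.
move=> c0 th0; have th : theta != 0 by rewrite gt_eqF.
have cth : 0 < 1 + c * theta by rewrite ltr_pwDl// mulr_ge0// ltW.
pose F (g : R) := (1 + c * theta)^-1 * expR (- ((c + theta^-1) * g)) - expR (- (g / theta)).
have dF (x : R) : is_derive x 1 F
   ((1 - expR (- (c * x))) * (expR (- (x / theta)) / theta)).
  apply: is_derive_eq; rewrite /GRing.scale/=.
  rewrite mulrDl opprD expRD [theta^-1 * x]mulrC.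
  move: (expR _) (expR _) => a b; field; rewrite th/=.
  by rewrite gt_eqF// -(mulrC c).
have cf : continuous (fun x : R => (1 - expR (- (c * x))) * (expR (- (x / theta)) / theta)).
  move=> x; apply: cvgM.
    apply: cvgB; first exact: cvg_cst.
    apply: (cvg_comp (fun x : R => - (c * x)) expR); last exact: continuous_expR.
    by apply: cvgN; apply: cvgM; [exact: cvg_cst|exact: cvg_id].
  apply: cvgM; last exact: cvg_cst.
  apply: (cvg_comp (fun x : R => - (x / theta)) expR); last exact: continuous_expR.
  by apply: cvgN; apply: cvgM; [exact: cvg_id|exact: cvg_cst].
have lim a : 0 < a -> expR (- (a * x)) @[x --> +oo] --> (0 : R).
  move=> a0; apply: (cvg_comp (fun x : R => a * x) (fun x : R => expR (- x))).
    by apply: gt0_cvgMry => //; exact: cvg_id.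
  exact: cvgr_expR.
rewrite (@ge0_continuous_FTC2y _ _ F _ 0).
- rewrite sub0e -EFinN /F !mulr0 mul0r oppr0 expR0; congr EFin; field.
  by rewrite gt_eqF.
- move=> x x0; rewrite mulr_ge0 ?divr_ge0 ?expR_ge0 ?(ltW th0)//.
  by rewrite subr_ge0 expR_le1 oppr_le0 mulr_ge0.
- exact: continuous_subspaceT.
- rewrite /F -[X in _ --> X](subr0 0) -[X in _ --> X - _](mulr0 (1 + c * theta)^-1).
  apply: cvgB.
    apply: cvgM; first exact: cvg_cst.
    by apply: lim; rewrite ltr_wpDl// invr_gt0.
  under eq_fun do rewrite mulrC; apply: lim; by rewrite invr_gt0.
- by move=> x _; have [] := dF x.
- exact: (is_derive_cvg_at_right _ _ _ (dF 0)).
- by move=> x _; rewrite derive1E; have := dF x => ?; rewrite derive_val.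
Qed.

End gamma_tail.

(** * Polar coordinates through the area of disks *)

Section disk.
Local Notation "f ^` ()" := (derive1 f) : ring_scope.
Context {R : realType}.
Notation leb := (@lebesgue_measure R).
Local Notation mR := (measurableTypeR R).

(** Chord lengths are integrated with u = s sin x, which turns the integrand into 2 s^2 cos^2 x; its
    primitive is s^2 (x + sin x cos x). *)
Lemma integral_half_disk (s : R) : 0 <= s ->
  (\int[leb]_(u in `[(- s)%R, s]) (2 * Num.sqrt (s ^+ 2 - u ^+ 2))%:E
   = (pi * s ^+ 2)%:E)%E.
Proof.
rewrite le_eqVlt => /predU1P[<-|s0].
  by rewrite oppr0 set_itv1 integral_set1 expr0n mulr0.
have pi0 : 0 < pi / 2 :> R by rewrite divr_gt0// pi_gt0.
have piN : - (pi / 2) < pi / 2 :> R by rewrite gtrN.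
pose F (x : R) := s * sin x.
have dF (x : R) : is_derive x 1 F (s * cos x).
  by apply: is_derive_eq; rewrite /GRing.scale/=; ring.
have F'E : F^`() = fun x => s * cos x.
  by apply/funext => x; rewrite derive1E; have := dF x => ?; rewrite derive_val.
have cF' : continuous (fun x : R => s * cos x).
  by move=> x; apply: cvgM; [exact: cvg_cst|exact: continuous_cos].
have cF : continuous F.
  by move=> x; apply: cvgM; [exact: cvg_cst|exact: continuous_sin].
have Fa : F (- (pi / 2)) = - s by rewrite /F sinN sin_pihalf mulrN1.
have Fb : F (pi / 2) = s by rewrite /F sin_pihalf mulr1.
have cG : continuous (fun u : R => 2 * Num.sqrt (s ^+ 2 - u ^+ 2)).
  move=> x; apply: cvgM; first exact: cvg_cst.
  apply: (cvg_comp (fun u : R => s ^+ 2 - u ^+ 2) (@Num.sqrt R)); last exact: sqrt_continuous.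
  by apply: cvgB; [exact: cvg_cst|exact: exprn_continuous].
have := @integration_by_substitution_increasing R F
  (fun u => 2 * Num.sqrt (s ^+ 2 - u ^+ 2)) (- (pi / 2)) (pi / 2) (ltW piN).
rewrite Fa Fb F'E => ->; last first.
- exact: continuous_subspaceT.
- split.
  + by move=> x _; have [] := dF x.
  + by apply: cvg_at_right_filter; exact: cF.
  + by apply: cvg_at_left_filter; exact: cF.
- by apply/cvg_ex; exists (s * cos (pi / 2)); apply: cvg_at_left_filter; exact: cF'.
- by apply/cvg_ex; exists (s * cos (- (pi / 2))); apply: cvg_at_right_filter; exact: cF'.
- by move=> x _; exact: cF'.
- by move=> x y xI yI xy; rewrite /F ltr_pM2l// ltr_sin.
pose H (x : R) := s ^+ 2 * (x + sin x * cos x).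
have dH (x : R) : is_derive x 1 H (2 * s ^+ 2 * cos x ^+ 2).
  apply: is_derive_eq; rewrite /GRing.scale/=.
  apply/eqP; rewrite -subr_eq0; apply/eqP.
  transitivity (s ^+ 2 * (1 - (cos x ^+ 2 + sin x ^+ 2))); first by ring.
  by rewrite cos2Dsin2 subrr mulr0.
have cH : continuous H.
  move=> x; apply: differentiable_continuous; apply/derivable1_diffP.
  by have [] := dH x.
transitivity (\int[leb]_(x in `[(- (pi / 2))%R, (pi / 2)%R]) (2 * s ^+ 2 * cos x ^+ 2)%:E)%E.
  apply: eq_integral => x; rewrite inE/= in_itv/= => xI; congr EFin.
  have c0 : 0 <= cos x by exact: cos_ge0_pihalf.
  rewrite /= /F [(_ * _) x]/GRing.mul/=.
  have -> : s ^+ 2 - (s * sin x) ^+ 2 = (s * cos x) ^+ 2.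
    by rewrite !exprMn cos2sin2; ring.
  by rewrite sqrtr_sqr ger0_norm ?mulr_ge0 ?(ltW s0)//; ring.
rewrite (@continuous_FTC2 _ _ H)//.
- rewrite -EFinB /H sinN cosN cos_pihalf; congr EFin.
  by rewrite !mulr0 !addr0; lra.
- apply: continuous_subspaceT => x; apply: cvgM; first exact: cvg_cst.
  rewrite expr2; under eq_fun do rewrite expr2.
  by apply: cvgM; exact: continuous_cos.
- split.
  + by move=> x _; have [] := dH x.
  + by apply: cvg_at_right_filter; exact: cH.
  + by apply: cvg_at_left_filter; exact: cH.
- by move=> x _; rewrite derive1E; have := dH x => ?; rewrite derive_val.
Qed.

Definition sqnorm (p : mR * mR) : mR := p.1 ^+ 2 + p.2 ^+ 2.

Lemma measurable_sqnorm : measurable_fun setT sqnorm.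
Proof.
apply: measurable_funD; apply: measurable_funX.
  exact: measurable_fst.
exact: measurable_snd.
Qed.

Lemma sqnorm_ge0 p : 0 <= sqnorm p.
Proof. by rewrite addr_ge0 ?sqr_ge0. Qed.

Lemma sqr_le_sqrt (a v : R) : 0 <= a -> (v ^+ 2 <= a) = (`|v| <= Num.sqrt a).
Proof.
move=> a0; rewrite -{1}(sqr_sqrtr a0) -(real_normK (num_real v)).
by rewrite ler_sqr ?nnegrE ?sqrtr_ge0.
Qed.

Lemma disk_area (t : R) :
  ((leb \x leb) (sqnorm @^-1` `]-oo, t]) = (pi * Num.max t 0)%:E)%E.
Proof.
have [t0|t0] := ltP t 0.
  have -> : sqnorm @^-1` `]-oo, t] = set0.
    apply/seteqP; split=> // p /=; rewrite in_itv/= => pt.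
    by have := sqnorm_ge0 p; rewrite leNgt => /negP; apply; exact: le_lt_trans t0.
  by rewrite measure0 mulr0.
rewrite -[in RHS](sqr_sqrtr t0) -integral_half_disk ?sqrtr_ge0//.
rewrite [in RHS]integral_mkcond; apply: eq_integral => u _ /=.
have secE : xsection (sqnorm @^-1` `]-oo, t]) u = [set v | v ^+ 2 <= t - u ^+ 2].
  apply/seteqP; split => v; rewrite /xsection/= inE/= in_itv/= /sqnorm/= lerBrDl//.
rewrite secE patchE mem_setE in_itv/= sqr_sqrtr//.
have -> : (- Num.sqrt t <= u <= Num.sqrt t) = (u ^+ 2 <= t).
  by rewrite -ler_norml sqr_le_sqrt.
have [ut|ut] := leP (u ^+ 2) t.
  have d0 : 0 <= t - u ^+ 2 by rewrite subr_ge0.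
  have -> : [set v | v ^+ 2 <= t - u ^+ 2] =
      `[(- Num.sqrt (t - u ^+ 2))%R, Num.sqrt (t - u ^+ 2)]%classic.
    by apply/seteqP; split => v /=; rewrite in_itv/= -ler_norml sqr_le_sqrt.
  rewrite lebesgue_measure_itv/= lte_fin; case: ifPn => [_|].
    by rewrite -EFinB; congr EFin; ring.
  rewrite -leNgt => h; have : Num.sqrt (t - u ^+ 2) = 0.
    by apply/eqP; rewrite eq_le sqrtr_ge0 andbT; have := sqrtr_ge0 (t - u ^+ 2); lra.
  by move=> ->; rewrite mulr0.
have -> : [set v | v ^+ 2 <= t - u ^+ 2] = set0; last by rewrite measure0.
apply/seteqP; split => // v /= /(le_trans (sqr_ge0 v)).
by rewrite subr_ge0 leNgt ut.
Qed.

Let pushm : {measure set mR -> \bar R} :=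
  measure_function_pushforward__canonical__measure_function_Measure
    (leb \x leb)%E measurable_sqnorm.

Let nng_piV : 0 <= pi^-1 :> R. Proof. by rewrite invr_ge0 pi_ge0. Qed.

Let mNy0 : measurable (`]-oo, (0 : R)[%classic : set mR).
Proof. exact: measurable_itv. Qed.

(** The image of planar measure under [sqnorm] is [pi] times Lebesgue measure on the nonnegative
    half-line. Adding Lebesgue measure on the negative half-line gives a measure agreeing with [leb]
    on all intervals, to which uniqueness applies. *)
Let lebesgue_sqnorm (A : set mR) : measurable A ->
  (leb A = mscale (NngNum nng_piV) pushm A
           + leb (A `&` `]-oo, 0%R[))%E.
Proof.
move=> mA; rewrite -[RHS]/(_ A + mrestr leb mNy0 A)%E -measure_addE.
apply: lebesgue_measure_unique => // X [[a b]] _ <-.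
rewrite /= /msum 2!big_ord_recl big_ord0 adde0/= /mrestr/= /mscale/= /pushforward.
have [ba|ab] := leP b a.
  by rewrite set_itv_ge ?bnd_simp -?leNgt//= preimage_set0 set0I !measure0 mule0 add0e.
have -> : sqnorm @^-1` `]a, b] = sqnorm @^-1` `]-oo, b] `\` sqnorm @^-1` `]-oo, a].
  apply/seteqP; split => p /=; rewrite !in_itv/=.
    by move=> /andP[ap pb]; split=> //; apply/negP; rewrite -ltNge.
  by move=> [pb /negP]; rewrite -ltNge pb andbT.
have mI t : measurable (sqnorm @^-1` (`]-oo, t]%classic : set mR)).
  by rewrite -[X in measurable X]setTI; apply: measurable_sqnorm.
rewrite measureD//; last by rewrite [ltLHS]disk_area ltry.
rewrite setIidr; last first.
  by move=> p /=; rewrite !in_itv/= => /le_trans; apply; exact: ltW.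
rewrite /= !disk_area.
have -> : ((pi^-1)%:E * ((pi * Num.max b 0)%:E - (pi * Num.max a 0)%:E))%E =
   (Num.max b 0 - Num.max a 0)%:E.
  rewrite -EFinB -EFinM; congr EFin; rewrite -mulrBr mulKf//.
  exact/lt0r_neq0/pi_gt0.
rewrite lebesgue_measure_itv/= lte_fin ab -EFinB.
have [b0|b0] := ltP b 0.
  rewrite setIidl; last by move=> x /=; rewrite !in_itv/= => /andP[_ /le_lt_trans]; exact.
  have a0 : a < 0 by exact: lt_trans b0.
  by rewrite (max_r (ltW a0)) subrr add0e lebesgue_measure_itv/= lte_fin ab.
have [a0|a0] := ltP a 0.
  have -> : `]a, b] `&` `]-oo, 0[ = `]a, 0[%classic.
    apply/seteqP; split => x /=; rewrite !in_itv/=; first by move=> [/andP[-> _] ->].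
    by move=> /andP[-> x0]; rewrite x0; split=> //=; rewrite (le_trans (ltW x0)).
  by rewrite lebesgue_measure_itv/= lte_fin a0 -EFinB -EFinD subr0 sub0r.
have -> : `]a, b] `&` `]-oo, 0[ = set0.
  apply/seteqP; split => // x /=; rewrite !in_itv/= => -[/andP[ax _] x0].
  by move: (lt_trans ax x0); rewrite ltNge a0.
by rewrite measure0 adde0.
Qed.

(** The variable is the squared radius, for which area has the constant density [pi]; no planar
    change of variables is needed. *)
Lemma ge0_integral_radial (phi : mR -> \bar R) : measurable_fun setT phi ->
  (forall w, 0 <= phi w)%E ->
  (\int[leb]_u \int[leb]_v phi ((u : R) ^+ 2 + (v : R) ^+ 2)%R
   = pi%:E * \int[leb]_(w in `[0%R, +oo[) phi w)%E.
Proof.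
move=> mphi phi0.
transitivity (\int[leb \x leb]_p (phi \o sqnorm) p)%E.
  have mps : measurable_fun setT (phi \o sqnorm).
    by apply: measurableT_comp => //; exact: measurable_sqnorm.
  have ps0 p : (0 <= (phi \o sqnorm) p)%E by exact: phi0.
  by rewrite (fubini_tonelli1 _ mps ps0).
have -> : (\int[leb \x leb]_p (phi \o sqnorm) p =
    \int[pushm]_(w in `[0%R, +oo[) phi w)%E.
  rewrite (ge0_integral_pushforward measurable_sqnorm)//; last exact: measurable_funTS.
  congr (integral _ _ _); apply/seteqP; split => // p _ /=.
  by rewrite in_itv/= andbT sqnorm_ge0.
rewrite (@eq_measure_integral _ _ _ _ (mscale (NngNum nng_piV) pushm) leb).
  rewrite ge0_integral_mscale//; last exact: measurable_funTS.
  by rewrite muleA -EFinM/= divff ?mul1e//; exact/lt0r_neq0/pi_gt0.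
move=> A mA A0; have AE : A `&` `]-oo, 0%R[ = set0.
  apply/seteqP; split => // x /= [/A0/=]; rewrite !in_itv/= andbT => x0.
  by rewrite ltNge x0.
by have := lebesgue_sqnorm A mA; rewrite AE measure0 adde0.
Qed.

End disk.

(** * The Laplace exponent of the shot noise *)

Section interference_exponent.
Local Notation "f ^` ()" := (derive1 f) : ring_scope.
Context {R : realType}.
Notation leb := (@lebesgue_measure R).
Variables (alpha : R).
Hypothesis alpha2 : 2 < alpha.

(** The substitution w = r^2 t^2 is made on compact intervals; monotone convergence along increasing
    unions gives the half-lines. Continuity is asked off 0 only, because of the powers in the
    application. *)
Lemma integral_square_substitution (psi : R -> R) (r : R) : 0 < r ->
  (forall w, 0 < w -> {for w, continuous psi}) -> (forall w, 0 < w -> 0 <= psi w) ->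
  (\int[leb]_(w in `[(r ^+ 2)%R, +oo[) (psi w)%:E
   = \int[leb]_(t in `[1%R, +oo[) (psi (r ^+ 2 * t ^+ 2) * (r ^+ 2 * (2 * t)))%:E)%E.
Proof.
move=> r0 cpsi psi0; have r20 : 0 < r ^+ 2 by rewrite exprn_gt0.
pose F (t : R) := r ^+ 2 * t ^+ 2.
have dF (x : R) : is_derive x 1 F (r ^+ 2 * (2 * x)).
  by rewrite /F; under eq_fun do rewrite expr2; apply: is_derive_eq;
    rewrite /GRing.scale/=; ring.
have F'E : F^`() = fun x => r ^+ 2 * (2 * x).
  by apply/funext => x; rewrite derive1E; have := dF x => ?; rewrite derive_val.
have cF' : continuous (fun x : R => r ^+ 2 * (2 * x)).
  move=> x; apply: cvgM; first exact: cvg_cst.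
  by apply: cvgM; [exact: cvg_cst|exact: cvg_id].
have cF : continuous F.
  move=> x; apply: differentiable_continuous; apply/derivable1_diffP.
  by have [] := dF x.
have Fpos (t : R) : 1 <= t -> 0 < F t.
  by move=> t1; rewrite mulr_gt0// exprn_gt0// (lt_le_trans _ t1).
pose A (n : nat) := `[(r ^+ 2)%R, F n.+1%:R]%classic.
pose B (n : nat) := `[1%R, (n.+1%:R : R)]%classic.
have eqn n : (\int[leb]_(w in A n) (psi w)%:E =
    \int[leb]_(t in B n) (psi (r ^+ 2 * t ^+ 2) * (r ^+ 2 * (2 * t)))%:E)%E.
  have n1 : 1 <= n.+1%:R :> R by rewrite ler1n.
  have F1 : F 1 = r ^+ 2 by rewrite /F expr1n mulr1.
  rewrite /A -[X in `[X, _]%classic]F1.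
  rewrite (@integration_by_substitution_increasing R F psi)//.
  - by apply: eq_integral => t _; rewrite F'E.
  - move=> x y; rewrite !in_itv/= => /andP[x1 _] /andP[y1 _] xy.
    by rewrite /F ltr_pM2l// ltr_sqr// nnegrE (le_trans ler01).
  - by rewrite F'E => x _; exact: cF'.
  - by rewrite F'E; apply/cvg_ex; exists (r ^+ 2 * (2 * 1)); apply: cvg_at_right_filter; exact: cF'.
  - by rewrite F'E; apply/cvg_ex; exists (r ^+ 2 * (2 * n.+1%:R)); apply: cvg_at_left_filter; exact: cF'.
  - split.
    + by move=> x _; have [] := dF x.
    + by apply: cvg_at_right_filter; exact: cF.
    + by apply: cvg_at_left_filter; exact: cF.
  - apply: continuous_in_subspaceT => w; rewrite inE/= in_itv/= => /andP[Fw _].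
    by apply: cpsi; apply: lt_le_trans Fw; exact: Fpos.
have UA : \bigcup_n A n = `[(r ^+ 2)%R, +oo[%classic.
  apply/seteqP; split => [w [n _]|w] /=; rewrite !in_itv/= ?andbT; first by case/andP.
  (* Here w is at most r^2 (N+1), which is at most r^2 (N+1)^2. *)
  move=> rw; pose N := Num.truncn (w / r ^+ 2); exists N => //; rewrite /A/= in_itv/= rw/=.
  rewrite /F -ler_pdivrMl// mulrC.
  apply: (@le_trans _ _ (N.+1%:R)); first exact/ltW/truncnS_gt.
  by rewrite expr2 ler_peMl// ler1n.
have UB : \bigcup_n B n = `[(1:R)%R, +oo[%classic.
  apply/seteqP; split => [t [n _]|t] /=; rewrite !in_itv/= ?andbT; first by case/andP.
  move=> t1; exists (Num.truncn t) => //; rewrite /B/= in_itv/= t1/=.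
  exact/ltW/truncnS_gt.
have pos w : (`[(r ^+ 2)%R, +oo[%classic : set R) w -> 0 < w.
  by rewrite /= in_itv/= andbT; exact: lt_le_trans.
have mpsi : measurable_fun (`]0%R, +oo[%classic : set R) psi.
  apply: open_continuous_measurable_fun; first exact: interval_open.
  by move=> w; rewrite inE/= in_itv/= andbT; exact: cpsi.
have mpsi2 : measurable_fun (`]0%R, +oo[%classic : set R)
    (fun t => psi (r ^+ 2 * t ^+ 2) * (r ^+ 2 * (2 * t))).
  apply: measurable_funM; last first.
    by apply: measurable_funTS; exact: continuous_measurable_fun.
  apply: open_continuous_measurable_fun; first exact: interval_open.
  move=> t; rewrite inE/= in_itv/= andbT => t0.
  apply: (continuous_comp (cF t)); apply: cpsi.
  by rewrite mulr_gt0// exprn_gt0.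
have Apos n w : A n w -> 0 < w.
  by rewrite /A/= in_itv/= => /andP[+ _]; exact: lt_le_trans.
have Bpos n w : B n w -> 0 < w.
  by rewrite /B/= in_itv/= => /andP[+ _]; exact: lt_le_trans.
have cA : (\int[leb]_(w in A n) (psi w)%:E @[n --> \oo] -->
    \int[leb]_(w in \bigcup_n A n) (psi w)%:E)%E.
  apply: ge0_nondecreasing_set_cvg_integral.
  - apply/nondecreasing_seqP => n; apply/subsetPset => w; rewrite /A/= !in_itv/=.
    move=> /andP[-> wn] /=; rewrite (le_trans wn)// /F ler_pM2l// ler_sqr ?nnegrE//.
    by rewrite ler_nat.
  - by move=> n; exact: measurable_itv.
  - move=> n; apply/measurable_EFinP; apply: measurable_funS mpsi => //.
    by move=> w /Apos; rewrite /= in_itv/= andbT.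
  - by move=> n w /Apos w0; rewrite lee_fin psi0.
have cB : (\int[leb]_(t in B n) (psi (r ^+ 2 * t ^+ 2) * (r ^+ 2 * (2 * t)))%:E @[n --> \oo] -->
    \int[leb]_(t in \bigcup_n B n) (psi (r ^+ 2 * t ^+ 2) * (r ^+ 2 * (2 * t)))%:E)%E.
  apply: ge0_nondecreasing_set_cvg_integral.
  - apply/nondecreasing_seqP => n; apply/subsetPset => w; rewrite /B/= !in_itv/=.
    by move=> /andP[-> wn] /=; rewrite (le_trans wn)// ler_nat.
  - by move=> n; exact: measurable_itv.
  - move=> n; apply/measurable_EFinP; apply: measurable_funS mpsi2 => //.
    by move=> w /Bpos; rewrite /= in_itv/= andbT.
  - move=> n w /Bpos w0; rewrite lee_fin; apply: mulr_ge0.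
      by apply: psi0; rewrite mulr_gt0// exprn_gt0.
    by apply: mulr_ge0; [exact: ltW|apply: mulr_ge0 => //; exact: ltW].
rewrite -UA -UB -(cvg_lim _ cA)// -(cvg_lim _ cB)//.
by congr (limn _); apply/funext => n; exact: eqn.
Qed.

(* Laplace exponent of the interference of one marked Poisson process *)
Lemma interference_exponent (lam theta r c : R) : 0 <= lam -> 0 < theta -> 0 < r -> 0 <= c ->
  ((lam / 2)%:E * \int[leb]_u \int[leb]_v \int[leb]_(g in `[0%R, +oo[)
     ((1 - expR (- (c * norm2 (u, v) `^ (- alpha) * g))) * (r < norm2 (u, v))%R%:R
        * (expR (- (g / theta)) / theta))%:E
   = (2^-1 * pi * lam * r ^+ 2 * (Fhyp alpha (c * theta * r `^ (- alpha)) - 1))%:E)%E.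
Proof.
move=> lam0 th0 r0 c0.
have a2 : 0 < alpha / 2 by rewrite divr_gt0// (lt_trans _ alpha2).
set b := c * theta; have b0 : 0 <= b by rewrite mulr_ge0// ltW.
(* The mark average from [integral_exp_mark] as a function of the squared distance w, after
   multiplying numerator and denominator by w^(alpha/2). *)
pose psi (w : R) := b / (w `^ (alpha / 2) + b).
pose phi (w : R) : \bar R := ((r ^+ 2 < w)%R%:R * psi w)%:E.
have psi0 w : 0 <= psi w by rewrite divr_ge0// addr_ge0// powR_ge0.
have phi0 w : (0 <= phi w)%E by rewrite lee_fin mulr_ge0.
have inner (u v : R) : (\int[leb]_(g in `[0%R, +oo[)
     ((1 - expR (- (c * norm2 (u, v) `^ (- alpha) * g))) * (r < norm2 (u, v))%R%:R
        * (expR (- (g / theta)) / theta))%:E = phi (u ^+ 2 + v ^+ 2)%R)%E.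
  rewrite /phi; set w := u ^+ 2 + v ^+ 2.
  have w0 : 0 <= w by rewrite addr_ge0 ?sqr_ge0.
  have nE : norm2 (u, v) = Num.sqrt w by [].
  have -> : (r < norm2 (u, v)) = (r ^+ 2 < w).
    by rewrite nE -{2}(sqr_sqrtr w0) ltr_sqr ?nnegrE ?sqrtr_ge0 ?(ltW r0).
  have [rw|rw] := ltP (r ^+ 2) w; last first.
    by rewrite mul0r; apply: integral0_eq => g _; rewrite mulr0 mul0r.
  rewrite mul1r; under eq_integral do rewrite mulr1.
  have wp : 0 < w by apply: le_lt_trans rw; exact: sqr_ge0.
  rewrite integral_exp_mark ?mulr_ge0 ?powR_ge0//; congr EFin.
  rewrite nE -powR12_sqrt// -powRrM mulrN [2^-1 * _]mulrC powRN.
  have W0 : 0 < w `^ (alpha / 2) by exact: powR_gt0.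
  rewrite /psi /b; field.
  by rewrite !gt_eqF// ltr_pwDl// mulr_ge0// ltW.
under eq_integral do under eq_integral do rewrite inner.
have mpsi : measurable_fun setT psi.
  apply: measurable_funM => //; apply: (measurableT_comp measurable_invr).
  by apply: measurable_funD => //; exact: measurable_powR.
have mphi : measurable_fun (setT : set (measurableTypeR R)) phi.
  apply/measurable_EFinP; apply: measurable_funM => //.
  by apply: measurableT_comp => //; exact: measurable_fun_ltr.
rewrite ge0_integral_radial//.
have -> : (\int[leb]_(w in `[0%R, +oo[) phi w = \int[leb]_(w in `](r ^+ 2)%R, +oo[) (psi w)%:E)%E.
  rewrite integral_mkcond [RHS]integral_mkcond; apply: eq_integral => w _.
  rewrite !patchE !mem_setE !in_itv/= !andbT /phi.
  have [rw|rw] := ltP (r ^+ 2) w; first by rewrite (ltW (le_lt_trans (sqr_ge0 r) rw)) mul1r.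
  by rewrite mul0r if_same.
rewrite integral_itv_obnd_cbnd; last by apply/measurable_EFinP; exact: measurable_funTS.
rewrite integral_square_substitution//; last first.
  move=> w w0; apply: cvgM; first exact: cvg_cst.
  apply: cvgV; first by rewrite gt_eqF// ltr_pwDl// powR_gt0.
  by apply: cvgD; [exact: powR_continuous|exact: cvg_cst].
(* After rescaling by r, psi(r^2 t^2) times the Jacobian 2 r^2 t is r^2 times the integrand of
   [Fhyp] at this [y]. *)
set y := b * r `^ (- alpha).
have y0 : 0 <= y by rewrite mulr_ge0// powR_ge0.
have -> : (\int[leb]_(t in `[1%R, +oo[) (psi (r ^+ 2 * t ^+ 2) * (r ^+ 2 * (2 * t)))%:E =
    \int[leb]_(t in `[1%R, +oo[) ((r ^+ 2)%:E * (hyp_integrand alpha 0 y t)%:E))%E.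
  apply: eq_integral => t; rewrite inE/= in_itv/= andbT => t1.
  have t0 : 0 < t by exact: lt_le_trans t1.
  rewrite -EFinM; congr EFin; rewrite /psi /=.
  rewrite powRM ?exprn_ge0 ?ltW// -!powR_mulrn ?ltW// -!powRrM.
  rewrite [2%:R * _]mulrC divfK// /y powRN.
  have ra : 0 < r `^ alpha by exact: powR_gt0.
  have ta : 0 < t `^ alpha by exact: powR_gt0.
  by field; rewrite !gt_eqF// ltr_pwDl// mulr_gt0.
rewrite integralZl//; last exact: (integrable_hyp_integrand alpha alpha2 0 y y0).
have -> : (\int[leb]_(t in `[1%R, +oo[) (hyp_integrand alpha 0 y t)%:E)%E =
    (Fhyp alpha y - 1)%:E.
  rewrite /Fhyp addrC addKr fineK//.
  exact: integrable_fin_num (integrable_hyp_integrand alpha alpha2 0 y y0).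
by rewrite -!EFinM; congr EFin; ring.
Qed.

End interference_exponent.

(** * Approximation by simple functions with bounded disjoint supports *)

Section simple_approximation.
Context {R : realType}.
Local Notation T := ((R * R) * R)%type.

Lemma measurable_norm2 : measurable_fun setT (@norm2 R).
Proof.
have -> : @norm2 R = fun y => (y.1 ^+ 2 + y.2 ^+ 2) `^ (2^-1).
  by apply/funext => y; rewrite powR12_sqrt// addr_ge0 ?sqr_ge0.
apply: (measurableT_comp (measurable_powR _)).
by apply: measurable_funD; apply: measurable_funX; [exact: measurable_fst|exact: measurable_snd].
Qed.

Lemma norm2_bound (y : R * R) : `|y.1| <= norm2 y /\ `|y.2| <= norm2 y.
Proof.
have h (a b : R) : `|a| <= Num.sqrt (a ^+ 2 + b ^+ 2).
  by rewrite -sqrtr_sqr ler_wsqrtr// lerDl sqr_ge0.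
by split; [exact: h|rewrite /norm2 addrC; exact: h].
Qed.

Definition simple_val {p : nat} (v : 'I_p -> R) (A : 'I_p -> set T) (x : T) : R :=
  \sum_(i < p) v i * (x \in A i)%:R.

(** Boundedness and disjointness are what the count law requires. Positivity of the values makes
    finiteness of the weighted sum of counts equivalent to finiteness of every count. *)
Definition simple_data {p : nat} (v : 'I_p -> R) (A : 'I_p -> set T) :=
  [/\ forall i, 0 < v i, forall i, measurable (A i) /\ bounded_loc (A i) &
      forall i j, i != j -> A i `&` A j = set0].

Import HBNNSimple.

Lemma simple_approximation (f : T -> R) : measurable_fun setT f ->
  (forall x, 0 <= f x) ->
  exists (p : nat -> nat) (v : forall n, 'I_(p n) -> R) (A : forall n, 'I_(p n) -> set T),
  [/\ forall n, simple_data (v n) (A n),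
      forall x, nondecreasing_seq (fun n => simple_val (v n) (A n) x) &
      forall x, simple_val (v n) (A n) x @[n --> \oo] --> f x].
Proof.
move=> mf f0.
have mEf : measurable_fun setT (EFin \o f) by exact/measurable_EFinP.
pose s (n : nat) := nnsfun_approx measurableT mEf n.
have /choice[sq sqE] : forall n, exists l : seq R, range (s n) = [set` l].
  by move=> n; apply/finite_seqP; exact: fimfunP.
have sqP n x : (x \in sq n) = (x \in range (s n)) by rewrite sqE mem_setE.
(* The value 0 is removed, so that all values are positive; its level set contributes nothing. *)
pose vals n : seq R := [seq v <- undup (sq n) | v != 0].
pose p n := size (vals n).
pose v n (i : 'I_(p n)) : R := nth 0 (vals n) i.
(* Level sets are cut by the disk of radius n. The radius grows with n, so monotonicity survives,
   and any given point is eventually inside. *)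
pose A n (i : 'I_(p n)) : set T := s n @^-1` [set v n i] `&` [set x | norm2 x.1 <= n%:R].
have uvals n : uniq (vals n) by rewrite filter_uniq// undup_uniq.
have vin n (i : 'I_(p n)) : v n i \in vals n by exact: mem_nth.
have valsP n x : x \in vals n -> 0 < x.
  rewrite mem_filter => /andP[x0]; rewrite mem_undup sqP.
  by rewrite inE/= => -[y _ yx]; rewrite lt_neqAle eq_sym x0 -yx fun_ge0.
have svE n x : simple_val (v n) (A n) x = (norm2 x.1 <= n%:R)%R%:R * s n x.
  rewrite /simple_val; have [xn|xn] := leP (norm2 x.1) n%:R; last first.
    rewrite mul0r big1// => i _; rewrite memNset ?mulr0// => -[_ /=].
    by rewrite leNgt xn.
  rewrite mul1r.
  have -> : \sum_(i < p n) v n i * (x \in A n i)%:R =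
      \sum_(y <- vals n) y * (y == s n x)%:R.
    rewrite (big_nth 0) big_mkord; apply: eq_bigr => i _; congr (_ * (nat_of_bool _)%:R).
    apply/idP/eqP => [|h]; first by rewrite inE => -[/= ->].
    by rewrite inE; split.
  have [sx|sx] := boolP (s n x \in vals n).
    rewrite (bigD1_seq (s n x))//= eqxx mulr1 big1 ?addr0// => y /negbTE ->.
    by rewrite mulr0.
  have s0 : s n x = 0.
    apply/eqP; apply: contraNT sx => s0; rewrite mem_filter s0/=.
    by rewrite mem_undup sqP inE; exists x.
  rewrite s0 big_seq big1// => y yv.
  by rewrite gt_eqF ?mulr0//; exact: valsP yv.
exists p, v, A; split.
- move=> n; split.
  + by move=> i; exact: (valsP n).
  + move=> i; split.
      apply: measurableI.
        by rewrite -[X in measurable X]setTI; exact: measurable_funP.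
      have mn : measurable_fun setT (fun x : T => norm2 x.1).
        by apply: (measurableT_comp measurable_norm2); exact: measurable_fst.
      have := measurable_fun_ler mn (measurable_cst (n%:R : R)).
      move=> /(_ measurableT [set true]); rewrite setTI; apply.
      by [].
    exists n%:R => x [_ /= xn]; have [h1 h2] := norm2_bound x.1.
    by split; [exact: le_trans h1 xn|exact: le_trans h2 xn].
  + move=> i j; apply: contra_neqP => /eqP/set0P[x [[/= xi _] [/= xj _]]].
    apply/val_inj/eqP; rewrite -(nth_uniq 0 (ltn_ord i) (ltn_ord j) (uvals n)).
    by apply/eqP; rewrite -[LHS]xi.
- move=> x m n mn; rewrite !svE ler_pM//.
    by rewrite ler_nat; case: leP => // xm; rewrite (le_trans xm)// ler_nat.
  exact/lefP/nd_nnsfun_approx.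
- move=> x; have sf : s n x @[n --> \oo] --> f x.
    have : (s n x)%:E @[n --> \oo] --> (f x)%:E.
      by apply: (cvg_nnsfun_approx measurableT mEf) => // y _; rewrite lee_fin.
    by move=> /fine_cvgP[].
  apply: cvg_trans sf; apply: near_eq_cvg; near=> n.
  rewrite svE (_ : _ <= _) ?mul1r//.
  near: n; exact: nbhs_infty_ger.
Unshelve. all: by end_near. Qed.

End simple_approximation.

(** * Products of finite measures *)

Section finite_product.
Local Open Scope ereal_scope.
Context {d1 d2 : measure_display} {T1 : measurableType d1} {T2 : measurableType d2}
  {R : realType}.
Variables (m1 : {finite_measure set T1 -> \bar R})
  (m2 : {finite_measure set T2 -> \bar R}).

(** A named copy of the product, to which finiteness can be attached so that it may enter a further
    product. *)
Definition fprod : set (T1 * T2) -> \bar R := m1 \x m2.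

HB.instance Definition _ := Measure.on fprod.

Let fprod_fin : fin_num_fun fprod.
Proof.
move=> A mA; rewrite ge0_fin_numE//; apply: (@le_lt_trans _ _ (fprod setT)).
  by apply: le_measure; rewrite ?inE.
rewrite -setXTT /fprod product_measure1E//.
by rewrite lte_mul_pinfty// ?fin_num_measure// ltey_eq fin_num_measure.
Qed.

HB.instance Definition _ := Measure_isFinite.Build _ _ _ fprod fprod_fin.

End finite_product.

(** * From boxes to the joint law of three variables on an event *)

Section joint_law.
Context {d : measure_display} {Omega : measurableType d} {R : realType}.
Local Notation mR := (measurableTypeR R).
Variables (P : probability Omega R) (X1 X2 X3 : Omega -> mR) (ev : set Omega).
Hypotheses (mX1 : measurable_fun setT X1) (mX2 : measurable_fun setT X2)
  (mX3 : measurable_fun setT X3) (mev : measurable ev).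
Variables m1 m2 m3 : {finite_measure set mR -> \bar R}.
Hypothesis box : forall B C D : set mR,
  measurable B -> measurable C -> measurable D ->
  (P (ev `&` (X1 @^-1` B `&` (X2 @^-1` C `&` X3 @^-1` D))) = m1 B * m2 C * m3 D)%E.

Let preim (X : Omega -> mR) (B : set mR) : measurable_fun setT X -> measurable B ->
  measurable (X @^-1` B).
Proof. by move=> mX mB; rewrite -[X in measurable X]setTI; exact: mX. Qed.

Let mX12 : measurable_fun setT (fun w => (X1 w, X2 w)).
Proof. exact: measurable_fun_pair. Qed.

Let mX : measurable_fun setT (fun w => ((X1 w, X2 w), X3 w)).
Proof. exact: measurable_fun_pair. Qed.

(** Uniqueness of product measures is used twice: for the first two variables with the third
    confined to a fixed set, then for the pair against the third. *)
Lemma joint_law_product (Y : set ((mR * mR) * mR)) : measurable Y ->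
  P (ev `&` [set w | Y ((X1 w, X2 w), X3 w)]) = (fprod m1 m2 \x m3)%E Y.
Proof.
have pair D (Z : set (mR * mR)) : measurable D -> measurable Z ->
    (P (ev `&` ([set w | Z (X1 w, X2 w)] `&` X3 @^-1` D)) = fprod m1 m2 Z * m3 D)%E.
  move=> mD mZ.
  have k0 : 0 <= fine (m3 D) by exact: fine_ge0.
  have m3D : (m3 D = (fine (m3 D))%:E)%E by rewrite fineK// fin_num_measure.
  have mE : measurable (ev `&` X3 @^-1` D) by apply: measurableI => //; exact: preim.
  pose m' : {measure set (mR * mR) -> \bar R} :=
    measure_function_pushforward__canonical__measure_function_Measure
    (mrestr P mE) mX12.
  (* The constant [m3 D] is absorbed into the second factor, which makes the restricted law an
     honest product of two measures. *)
  have := @product_measure_unique _ _ _ _ _ m1 (mscale (NngNum k0) m2) m'.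
  move=> /(_ _ Z mZ) H.
  transitivity (m' Z).
    rewrite /m' /= /pushforward /mrestr; congr (P _).
    by apply/seteqP; split => w /=; tauto.
  rewrite -H; last first.
    move=> B C mB mC; rewrite /m' /= /pushforward /mrestr /mscale/= -m3D.
    rewrite [(m3 D * _)%E]muleC muleA -box//; congr (P _).
    by apply/seteqP; split => w /=; tauto.
  rewrite /fprod /product_measure1/= /mscale/= -m3D ge0_integralZl//; first by rewrite muleC.
  exact: measurable_fun_xsection.
move=> mY.
pose m' : {measure set ((mR * mR) * mR) -> \bar R} :=
  measure_function_pushforward__canonical__measure_function_Measure (mrestr P mev) mX.
transitivity (m' Y).
  rewrite /m' /= /pushforward /mrestr; congr (P _).
  by apply/seteqP; split => w /=; tauto.
have boxm' : forall Z D, measurable Z -> measurable D ->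
    (m' (Z `*` D) = fprod m1 m2 Z * m3 D)%E.
  move=> Z D mZ mD; rewrite -[RHS]pair// /m' /= /pushforward /mrestr.
  by congr (P _); apply/seteqP; split => w /=; tauto.
by have /esym := @product_measure_unique _ _ _ _ _ (fprod m1 m2) m3 m' boxm' Y mY.
Qed.

End joint_law.

(** * The mean measure of the marked Poisson process as an integral *)

Section intensity.
Context {R : realType}.
Notation leb := (@lebesgue_measure R).
Local Notation mR := (measurableTypeR R).
Local Notation T := ((mR * mR) * mR)%type.

Definition leb2 : set (mR * mR) -> \bar R := (leb \x leb)%E.

HB.instance Definition _ := Measure.on leb2.

Let leb2_sigma_finite : sigma_finite [set: mR * mR] leb2.
Proof.
pose F n : set mR := `[(- n%:R)%R, (n%:R)%R]%classic.
have mF n : measurable (F n) by exact: measurable_itv.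
exists (fun n => F n `*` F n).
  apply/seteqP; split => // -[u v] _.
  pose N := maxn (Num.truncn `|u|).+1 (Num.truncn `|v|).+1.
  have h (a : R) : ((Num.truncn `|a|).+1 <= N)%N -> F N a.
    move=> aN; rewrite /F/= in_itv/= -ler_norml.
    by rewrite (le_trans (ltW (truncnS_gt _)))// ler_nat.
  by exists N => //; split; apply: h; rewrite ?leq_maxl ?leq_maxr.
move=> n; split; first exact: measurableX.
rewrite /leb2 product_measure1E//.
have Foo : (leb (F n) < +oo)%E.
  by rewrite /F lebesgue_measure_itv/=; case: ifPn => // _; rewrite -EFinB ltry.
by rewrite lte_mul_pinfty// ge0_fin_numE.
Qed.

HB.instance Definition _ := Measure_isSigmaFinite.Build _ _ _ leb2 leb2_sigma_finite.

Lemma ge0_integral_leb3 (f : T -> \bar R) : measurable_fun setT f ->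
  (forall p, 0 <= f p)%E ->
  (\int[leb2 \x leb]_p f p = \int[leb]_u \int[leb]_v \int[leb]_g f ((u, v), g))%E.
Proof.
move=> mf f0; rewrite (fubini_tonelli1 f mf f0).
have mF : measurable_fun setT (fubini_F leb f) by exact: measurable_fun_fubini_tonelli_F.
have F0 q : (0 <= fubini_F leb f q)%E by exact: integral_ge0.
exact: (@fubini_tonelli1 _ _ _ _ _ leb leb (fubini_F leb f) mF F0).
Qed.

Definition leb3 : set T -> \bar R := (leb2 \x leb)%E.

HB.instance Definition _ := Measure.on leb3.

Let leb3_sigma_finite : sigma_finite [set: T] leb3.
Proof.
have /sigma_finiteP[F [TF ndF Foo]] := sigma_finiteT leb2.
have /sigma_finiteP[G [TG ndG Goo]] := sigma_finiteT leb.
exists (fun n => F n `*` G n).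
  apply/seteqP; split => // -[u v] _.
  have [m _ Fu] : (\bigcup_i F i) u by rewrite -TF.
  have [n _ Gv] : (\bigcup_i G i) v by rewrite -TG.
  exists (maxn m n) => //; split => /=.
    exact: (subsetPset _ _ (ndF _ _ (leq_maxl m n))).
  exact: (subsetPset _ _ (ndG _ _ (leq_maxr m n))).
move=> n; have [mF F1] := Foo n; have [mG G1] := Goo n.
split; first exact: measurableX.
by rewrite /leb3 product_measure1E// lte_mul_pinfty// ge0_fin_numE.
Qed.

HB.instance Definition _ := Measure_isSigmaFinite.Build _ _ _ leb3 leb3_sigma_finite.

Variables (lam theta : R).
Hypotheses (lam0 : 0 <= lam) (theta0 : 0 < theta).

Definition ppp_weight (r : R) (p : T) : R :=
  (r < norm2 (p.1 : R * R))%R%:R * (0 <= p.2)%R%:R * (expR (- (p.2 / theta)) / theta).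

(** The mean measure applied to a function, written as one integral over triples, so that monotone
    convergence applies once and not three times. *)
Definition ppp_integral (r : R) (h : T -> R) : \bar R :=
  ((lam / 2)%:E * \int[leb2 \x leb]_p (h p * ppp_weight r p)%:E)%E.

Lemma ppp_weight_ge0 r p : 0 <= ppp_weight r p.
Proof. by rewrite !mulr_ge0// ?invr_ge0 ?expR_ge0// ltW. Qed.

Let mp2 : measurable_fun [set: mR * T] (fun x : mR * T => x.2.2 : mR).
Proof. by apply: measurableT_comp => //; exact: measurable_snd. Qed.

Lemma measurable_ppp_weight2 :
  measurable_fun [set: mR * T] (fun x : mR * T => ppp_weight x.1 x.2 : mR).
Proof.
apply: measurable_funM; first apply: measurable_funM.
- apply: measurableT_comp => //; apply: measurable_fun_ltr; first exact: measurable_fst.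
  apply: (measurableT_comp measurable_norm2).
  by apply: measurableT_comp; [exact: measurable_fst|exact: measurable_snd].
- by apply: measurableT_comp => //; apply: measurable_fun_ler.
- apply: measurable_funM => //; apply: (measurableT_comp (@measurable_expR R)).
  by apply: measurable_funN; exact: measurable_funM.
Qed.

Lemma measurable_ppp_weight r : measurable_fun [set: T] (ppp_weight r : T -> mR).
Proof.
have -> : ppp_weight r = (fun x : mR * T => ppp_weight x.1 x.2 : mR) \o (fun p : T => (r : mR, p)).
  by [].
apply: (measurableT_comp measurable_ppp_weight2).
by apply: measurable_fun_pair => //; exact: measurable_cst.
Qed.

Lemma ppp_integralE r (h : T -> R) : measurable_fun setT (h : T -> mR) ->
  (forall p, 0 <= h p) ->
  (ppp_integral r h = (lam / 2)%:E * \int[leb]_u \int[leb]_v \int[leb]_(g in `[0%R, +oo[)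
     (h ((u, v), g) * (r < norm2 (u, v))%R%:R * (expR (- (g / theta)) / theta))%:E)%E.
Proof.
move=> mh h0; rewrite /ppp_integral; congr (_ * _)%E.
rewrite ge0_integral_leb3.
- apply: eq_integral => u _; apply: eq_integral => v _.
  rewrite [RHS]integral_mkcond; apply: eq_integral => g _.
  rewrite patchE mem_setE in_itv/= andbT /ppp_weight/=.
  by case: (0 <= g); rewrite ?mulr1 ?mulr0 ?mul0r ?mulr0 ?mulrA.
- apply/measurable_EFinP; apply: measurable_funM => //; exact: measurable_ppp_weight.
- by move=> p; rewrite lee_fin mulr_ge0// ppp_weight_ge0.
Qed.

Lemma ppp_integral_ge0 r h : (forall p, 0 <= h p) -> (0 <= ppp_integral r h)%E.
Proof.
move=> h0; apply: mule_ge0; first by rewrite lee_fin divr_ge0.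
by apply: integral_ge0 => p _; rewrite lee_fin mulr_ge0 ?ppp_weight_ge0.
Qed.

Let mind (A : set T) : measurable A -> measurable_fun setT ((fun p => (p \in A)%:R) : T -> mR).
Proof. by move=> mA; exact: measurable_indic. Qed.

Lemma ppp_meanE r (A : set T) : measurable A ->
  ppp_mean lam theta r A = fine (ppp_integral r (fun p => (p \in A)%:R)).
Proof.
move=> mA; rewrite ppp_integralE//; exact: mind.
Qed.

Lemma ppp_mean_ge0 r (A : set T) : measurable A -> 0 <= ppp_mean lam theta r A.
Proof. by move=> mA; rewrite ppp_meanE// fine_ge0// ppp_integral_ge0. Qed.

Lemma integral_exp_mark1 : (\int[leb]_(g in `[0%R, +oo[) (expR (- (g / theta)) / theta)%:E = 1)%E.
Proof.
have := integral_gamma_tail 1 theta 0 isT theta0 (lexx _).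
rewrite mul0r gamma_tail0 => <-; apply: eq_integral => g _.
by rewrite expr0 fact0 !mul1r expr1.
Qed.

(** The indicator is dominated by that of a square of locations, and the mark density has mass 1.
    Hence the [fine] in [ppp_mean] loses nothing on bounded sets. *)
Lemma ppp_integral_indic_lty r (A : set T) : measurable A -> bounded_loc A ->
  (ppp_integral r (fun p => (p \in A)%:R) < +oo)%E.
Proof.
move=> mA [M0 AM0]; pose M := `|M0|.
have AM p : A p -> `|p.1.1| <= M /\ `|p.1.2| <= M.
  by move=> /AM0[h1 h2]; split; [exact: le_trans h1 (ler_norm _)|exact: le_trans h2 (ler_norm _)].
have M0' : 0 <= M by exact: normr_ge0.
pose I : set mR := `[(- M)%R, M]%classic.
have mI : measurable I by exact: measurable_itv.
have inI (a : R) : `|a| <= M -> a \in I by rewrite mem_setE in_itv/= -ler_norml.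
pose e (g : mR) : mR := (0 <= g)%R%:R * (expR (- (g / theta)) / theta).
have e0 g : 0 <= e g by rewrite mulr_ge0// divr_ge0 ?expR_ge0// ltW.
have me : measurable_fun setT e.
  apply: measurable_funM; first by apply: measurableT_comp => //; exact: measurable_fun_ler.
  apply: measurable_funM => //; apply: (measurableT_comp (@measurable_expR R)).
  by apply: measurable_funN; exact: measurable_funM.
have e1 : (\int[leb]_g (e g)%:E = 1)%E.
  rewrite -integral_exp_mark1 [RHS]integral_mkcond; apply: eq_integral => g _.
  by rewrite patchE mem_setE in_itv/= andbT /e; case: (0 <= g); rewrite ?mul1r ?mul0r.
pose H (p : T) : mR := \1_I p.1.1 * \1_I p.1.2 * e p.2.
have H0 p : 0 <= H p by apply: mulr_ge0; [exact: mulr_ge0|exact: e0].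
have m1I : measurable_fun setT (\1_I : mR -> R) by exact: measurable_indic.
have mH : measurable_fun setT H.
  apply: measurable_funM; first apply: measurable_funM.
  - apply: (measurableT_comp m1I).
    by apply: measurableT_comp; exact: measurable_fst.
  - apply: (measurableT_comp m1I).
    by apply: measurableT_comp; [exact: measurable_snd|exact: measurable_fst].
  - by apply: (measurableT_comp me); exact: measurable_snd.
apply: (@le_lt_trans _ _ ((lam / 2)%:E * \int[leb2 \x leb]_p (H p)%:E)%E).
  apply: lee_wpmul2l; first by rewrite lee_fin divr_ge0.
  apply: ge0_le_integral => //.
  - by move=> p _; rewrite lee_fin mulr_ge0 ?ppp_weight_ge0.
  - apply/measurable_EFinP; apply: measurable_funM; first exact: mind.
    exact: measurable_ppp_weight.
  - exact/measurable_EFinP.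
  - move=> p _; rewrite lee_fin /ppp_weight /H /e.
    have [/set_mem/AM[/= /inI h1 /inI h2]|_] := boolP (p \in A); last first.
      by rewrite mul0r; exact: H0.
    rewrite !indicE h1 h2 !mul1r -mulrA ler_piMl ?e0//.
    by rewrite lern1 leq_b1.
have Ioo : (leb I < +oo)%E.
  by rewrite /I lebesgue_measure_itv/=; case: ifPn => // _; rewrite -EFinB ltry.
rewrite ge0_integral_leb3//; last exact/measurable_EFinP.
have -> : (\int[leb]_u \int[leb]_v \int[leb]_g (H (u, v, g))%:E = leb I * leb I)%E.
  transitivity (\int[leb]_u ((\1_I u)%:E * leb I))%E.
    apply: eq_integral => u _.
    transitivity (\int[leb]_v ((\1_I u)%:E * (\1_I v)%:E))%E.
      apply: eq_integral => v _; rewrite /H/=.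
      under eq_integral do rewrite EFinM.
      rewrite ge0_integralZl_EFin ?e1 ?mule1//.
      + by move=> g _; rewrite lee_fin e0.
      + exact/measurable_EFinP.
    rewrite ge0_integralZl_EFin//; last exact/measurable_EFinP.
    by rewrite integral_indic// setIT.
  rewrite ge0_integralZr//; last exact/measurable_EFinP.
  by rewrite integral_indic// setIT.
by rewrite lte_mul_pinfty ?lee_fin ?divr_ge0// lte_mul_pinfty// ge0_fin_numE.
Qed.

Lemma ppp_mean_EFin r (A : set T) : measurable A -> bounded_loc A ->
  (ppp_mean lam theta r A)%:E = ppp_integral r (fun p => (p \in A)%:R).
Proof.
move=> mA bA; rewrite ppp_meanE// fineK// ge0_fin_numE ?ppp_integral_ge0//.
exact: ppp_integral_indic_lty.
Qed.

Lemma measurable_ppp_mean (A : set T) : measurable A ->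
  measurable_fun setT ((fun r => ppp_mean lam theta r A) : mR -> mR).
Proof.
move=> mA.
have -> : (fun r => ppp_mean lam theta r A) =
    fun r => fine (ppp_integral r (fun p => (p \in A)%:R)).
  by apply/funext => r; rewrite ppp_meanE.
apply: measurableT_comp; first exact: fine_measurable.
rewrite /ppp_integral; apply: measurable_funeM.
pose f (x : mR * T) : \bar R := ((x.2 \in A)%:R * ppp_weight x.1 x.2)%:E.
have mf : measurable_fun setT f.
  apply/measurable_EFinP; apply: measurable_funM; last exact: measurable_ppp_weight2.
  by apply: (measurableT_comp (mind A mA)); exact: measurable_snd.
have f0 x : (0 <= f x)%E by rewrite lee_fin mulr_ge0 ?ppp_weight_ge0.
exact: (@measurable_fun_fubini_tonelli_F _ _ _ _ _ leb3 f mf f0).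
Qed.

(** At most one indicator is nonzero at a given point, so a function vanishing at 0 acts value by
    value. *)
Lemma simple_valP {p : nat} (v : 'I_p -> R) (A : 'I_p -> set T) (phi : R -> R) x :
  simple_data v A -> phi 0 = 0 ->
  phi (simple_val v A x) = \sum_(i < p) phi (v i) * (x \in A i)%:R.
Proof.
move=> [_ _ disj] phi0.
have [[i Aix]|nA] := pselect (exists i, A i x).
  have xj j : j != i -> (x \in A j) = false.
    move=> ji; apply/negbTE/negP => /set_mem Ajx.
    by have := disj _ _ ji; rewrite -subset0 => /(_ x); apply.
  rewrite /simple_val (bigD1 i)//= big1 => [|j ji]; last by rewrite xj// mulr0.
  rewrite [RHS](bigD1 i)//= [in RHS]big1 => [|j ji]; last by rewrite xj// mulr0.
  by rewrite (mem_set Aix) !addr0 !mulr1.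
have xj j : (x \in A j) = false.
  by apply/negbTE/negP => /set_mem Ajx; apply: nA; exists j.
rewrite /simple_val !big1 ?phi0// => i _; by rewrite xj mulr0.
Qed.

(** Turns the exponent of a finite Poisson mixture into an integral, the form in which it has a
    monotone limit. *)
Lemma ppp_integral_simple {p : nat} (v : 'I_p -> R) (A : 'I_p -> set T) (r t : R) :
  simple_data v A -> 0 <= t ->
  (\sum_(i < p) ppp_mean lam theta r (A i) * (1 - expR (- (t * v i))))%:E =
  ppp_integral r (fun x => 1 - expR (- (t * simple_val v A x))).
Proof.
move=> sd t0; have [v0 mA _] := sd.
have q0 i : 0 <= 1 - expR (- (t * v i)).
  by rewrite subr_ge0 expR_le1 oppr_le0 mulr_ge0// ltW.
pose phi (s : R) := 1 - expR (- (t * s)).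
have phi0 : phi 0 = 0 by rewrite /phi mulr0 oppr0 expR0 subrr.
have l0 : 0 <= lam / 2 by rewrite divr_ge0.
rewrite /ppp_integral.
under eq_integral => x _.
  rewrite -/(phi _) (simple_valP v A phi x sd phi0) mulr_suml -sumEFin; over.
have mi i : measurable_fun setT
    (fun x : T => ((x \in A i)%:R * ppp_weight r x)%:E : \bar R).
  apply/measurable_EFinP; apply: measurable_funM; last exact: measurable_ppp_weight.
  exact: mind (mA i).1.
rewrite ge0_integral_sum//; last 2 first.
- move=> i; under eq_fun do rewrite -mulrA EFinM.
  exact: measurable_funeM.
- move=> i x _; rewrite lee_fin; apply: mulr_ge0; last exact: ppp_weight_ge0.
  apply: mulr_ge0 => //.
  exact: q0.
rewrite ge0_sume_distrr; last first.
  by move=> i _; apply: integral_ge0 => x _; rewrite lee_fin;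
    apply: mulr_ge0; [apply: mulr_ge0 => //; exact: q0|exact: ppp_weight_ge0].
rewrite -sumEFin; apply: eq_bigr => i _.
under [in RHS]eq_integral do rewrite -mulrA EFinM.
rewrite ge0_integralZl_EFin//; [|by move=> x _; rewrite lee_fin mulr_ge0 ?ppp_weight_ge0|exact: q0].
have [mAi bAi] := mA i.
by rewrite EFinM (ppp_mean_EFin r (A i) mAi bAi) /ppp_integral muleC muleCA.
Qed.

Lemma ppp_integral_cvg (h_ : nat -> T -> R) (h : T -> R) r :
  (forall n, measurable_fun setT (h_ n : T -> mR)) ->
  (forall n x, 0 <= h_ n x) -> (forall x, nondecreasing_seq (h_ ^~ x)) ->
  (forall x, h_ n x @[n --> \oo] --> h x) ->
  ppp_integral r (h_ n) @[n --> \oo] --> ppp_integral r h.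
Proof.
move=> mh h0 nd hh; apply: cvgeZl => //.
have -> : (\int[leb2 \x leb]_p (h p * ppp_weight r p)%:E =
    \int[leb2 \x leb]_p (limn (fun n => (h_ n p * ppp_weight r p)%:E)))%E.
  apply: eq_integral => x _; apply/esym/cvg_lim => //.
  by apply: cvg_EFin; [exact: nearW|apply: cvgMl; exact: hh].
apply: cvg_monotone_convergence => //.
- move=> n; apply/measurable_EFinP.
  by apply: measurable_funM; [exact: mh|exact: measurable_ppp_weight].
- by move=> n x _; rewrite lee_fin mulr_ge0 ?ppp_weight_ge0.
- by move=> x _ m n mn; rewrite lee_fin ler_wpM2r ?ppp_weight_ge0//; exact: nd.
Qed.

End intensity.

(** * Limits and special values of the mean measure *)

Section mean_measure.
Context {R : realType}.
Notation leb := (@lebesgue_measure R).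
Local Notation mR := (measurableTypeR R).
Local Notation T := ((mR * mR) * mR)%type.
Variables (alpha lam theta : R).
Hypotheses (alpha2 : 2 < alpha) (lam0 : 0 < lam) (theta0 : 0 < theta).

Lemma measurable_simple_val {p : nat} (v : 'I_p -> R) (A : 'I_p -> set T) :
  simple_data v A -> measurable_fun setT (simple_val v A : T -> mR).
Proof.
move=> [_ mA _]; rewrite /simple_val.
apply: measurable_sum => i; apply: measurable_funM => //.
exact: measurable_indic (mA i).1.
Qed.

Lemma simple_val_ge0 {p : nat} (v : 'I_p -> R) (A : 'I_p -> set T) x :
  simple_data v A -> 0 <= simple_val v A x.
Proof. by move=> [v0 _ _]; apply: sumr_ge0 => i _; rewrite mulr_ge0// ltW. Qed.

(** As 1 - e^(-ts) is nondecreasing in s, the exponents are monotone integrals, whose limit is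
    [interference_exponent]. Clipping the mark at 0 keeps the limit function nonnegative everywhere
    and does not change it on the nonnegative marks, where the intensity lives. *)
Lemma simple_exponent_cvg (c t r : R) (p : nat -> nat) (v : forall n, 'I_(p n) -> R)
    (A : forall n, 'I_(p n) -> set T) : 0 <= c -> 0 <= t -> 0 < r ->
  (forall n, simple_data (v n) (A n)) ->
  (forall x, nondecreasing_seq (fun n => simple_val (v n) (A n) x)) ->
  (forall x : T, simple_val (v n) (A n) x @[n --> \oo] -->
     c * norm2 (x.1 : R * R) `^ (- alpha) * Num.max x.2 0) ->
  \sum_(i < p n) ppp_mean lam theta r (A n i) * (1 - expR (- (t * v n i))) @[n --> \oo] -->
  2^-1 * pi * lam * r ^+ 2 * (Fhyp alpha (t * c * theta * r `^ (- alpha)) - 1).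
Proof.
move=> c0 t0 r0 sd nd cf.
pose f (x : T) : R := c * norm2 (x.1 : R * R) `^ (- alpha) * Num.max (x.2 : R) 0.
have mf : measurable_fun setT (f : T -> mR).
  apply: measurable_funM; first apply: measurable_funM => //.
    apply: (measurableT_comp (measurable_powR _)).
    by apply: (measurableT_comp measurable_norm2); exact: measurable_fst.
  by apply: measurable_maxr => //; exact: measurable_snd.
have f0 x : 0 <= f x by rewrite !mulr_ge0 ?powR_ge0// le_max lexx orbT.
have mexp (h : T -> mR) : measurable_fun setT h ->
    measurable_fun setT ((fun x => 1 - expR (- (t * h x))) : T -> mR).
  move=> mh; apply: measurable_funB => //.
  apply: (measurableT_comp (@measurable_expR R)).
  by apply: measurable_funN; exact: measurable_funM.
have : ppp_integral lam theta r (fun x => 1 - expR (- (t * simple_val (v n) (A n) x)))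
    @[n --> \oo] --> ppp_integral lam theta r (fun x => 1 - expR (- (t * f x))).
  apply: ppp_integral_cvg => //.
  - by move=> n; apply: mexp; exact: measurable_simple_val.
  - by move=> n x; rewrite subr_ge0 expR_le1 oppr_le0 mulr_ge0// simple_val_ge0.
  - move=> x m n mn; rewrite lerD2l lerN2 ler_expR lerN2 ler_wpM2l//; exact: nd.
  - move=> x; apply: cvgB; first exact: cvg_cst.
    apply: (cvg_comp (fun n => - (t * simple_val (v n) (A n) x)) expR).
      by apply: cvgN; apply: cvgM; [exact: cvg_cst|exact: cf].
    exact: continuous_expR.
rewrite (ppp_integralE lam theta theta0 r (fun x => 1 - expR (- (t * f x)))); last 2 first.
- exact: mexp.
- by move=> x; rewrite subr_ge0 expR_le1 oppr_le0 mulr_ge0.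
have -> : ((lam / 2)%:E * \int[leb]_u \int[leb]_v \int[leb]_(g in `[0%R, +oo[)
     ((1 - expR (- (t * f ((u, v), g)))) * (r < norm2 (u, v))%R%:R
        * (expR (- (g / theta)) / theta))%:E
   = (2^-1 * pi * lam * r ^+ 2 * (Fhyp alpha (t * c * theta * r `^ (- alpha)) - 1))%:E)%E.
  rewrite -(interference_exponent alpha alpha2 lam theta r (t * c) (ltW lam0) theta0 r0 (mulr_ge0 t0 c0)).
  apply: (congr1 (fun X => ((lam / 2)%:E * X)%E)).
  apply: eq_integral => u _; apply: eq_integral => w _.
  apply: eq_integral => g; rewrite inE/= in_itv/= andbT => g0.
  by rewrite /f/= (max_l g0) !mulrA.
under eq_fun do rewrite -(ppp_integral_simple lam theta (ltW lam0) theta0 _ _ _ _ (sd _) t0).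
by move=> /fine_cvgP[].
Qed.

Lemma ppp_mean_neg_mark r (A : set T) : (forall p, A p -> p.2 < 0) ->
  ppp_mean lam theta r A = 0.
Proof.
move=> A0; rewrite /ppp_mean.
have h0 u v : (\int[leb]_(g in `[0%R, +oo[) (((u, v, g) \in A)%:R *
    (r < norm2 (u, v))%R%:R * (expR (- (g / theta)) / theta))%:E = 0)%E.
  apply: integral0_eq => g; rewrite /= in_itv/= andbT => g0.
  rewrite memNset ?mul0r// => /A0/=; by rewrite ltNge g0.
rewrite [X in (_ * X)%E](_ : _ = 0)%E ?mule0//.
by apply: integral0_eq => u _; apply: integral0_eq => w _; exact: h0.
Qed.

(** Any point of this set contributes a strictly positive power, and the set has mean measure of
    order M^2: the two properties behind positivity of the interference. *)
Definition annulus (M : R) : set T :=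
  [set p | 0 < norm2 (p.1 : R * R) /\ norm2 (p.1 : R * R) <= M /\ 0 < (p.2 : R)].

Lemma measurable_annulus M : measurable (annulus M).
Proof.
have mn : measurable_fun setT ((fun p : T => norm2 (p.1 : R * R)) : T -> mR).
  by apply: (measurableT_comp measurable_norm2); exact: measurable_fst.
have m2 : measurable_fun setT ((fun p : T => p.2) : T -> mR) by exact: measurable_snd.
have tr (b : T -> bool) : measurable_fun setT b -> measurable [set p | b p].
  move=> /(_ measurableT [set true]); rewrite setTI; exact.
apply: measurableI; first by apply: tr; exact: measurable_fun_ltr.
apply: measurableI; first by apply: tr; exact: measurable_fun_ler.
by apply: tr; exact: measurable_fun_ltr.
Qed.

Lemma bounded_loc_annulus M : bounded_loc (annulus M).
Proof.
exists M => p [_ [pM _]]; have [h1 h2] := norm2_bound (p.1 : R * R).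
by split; [exact: le_trans h1 pM|exact: le_trans h2 pM].
Qed.

Lemma ppp_mean_annulus r M : 0 < r -> r <= M ->
  ppp_mean lam theta r (annulus M) = lam / 2 * pi * (M ^+ 2 - r ^+ 2).
Proof.
move=> r0 rM; have M0 : 0 < M by exact: lt_le_trans rM.
pose phi (w : mR) : \bar R := (\1_(`](r ^+ 2)%R, (M ^+ 2)%R]%classic : set mR) w)%:E.
have inner (u v : R) : (\int[leb]_(g in `[0%R, +oo[)
     (((u, v, g) \in annulus M)%:R * (r < norm2 (u, v))%R%:R
        * (expR (- (g / theta)) / theta))%:E = phi (u ^+ 2 + v ^+ 2)%R)%E.
  set w := u ^+ 2 + v ^+ 2.
  have w0 : 0 <= w by rewrite addr_ge0 ?sqr_ge0.
  have nE : norm2 (u, v) = Num.sqrt w by [].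
  have rE : (r < norm2 (u, v)) = (r ^+ 2 < w).
    by rewrite nE -{2}(sqr_sqrtr w0) ltr_sqr ?nnegrE ?sqrtr_ge0 ?(ltW r0).
  have ME : (norm2 (u, v) <= M) = (w <= M ^+ 2).
    by rewrite nE -{2}(sqr_sqrtr w0) ler_sqr ?nnegrE ?sqrtr_ge0 ?(ltW M0).
  rewrite /phi indicE mem_setE in_itv/= -rE -ME.
  have [rw|rw] := ltP r (norm2 (u, v)); last first.
    by apply: integral0_eq => g _; rewrite mulr0 mul0r.
  have [wM|wM] := leP (norm2 (u, v)) M; last first.
    apply: integral0_eq => g _; rewrite memNset ?mul0r// => -[_ [/=]].
    by rewrite leNgt wM.
  (* The mark 0 is outside [annulus], so both mark integrals are moved to the open half-line before
     comparing integrands. *)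
  rewrite -(integral_exp_mark1 theta theta0) -!integral_itv_obnd_cbnd; last 2 first.
  - apply/measurable_EFinP; apply: measurable_funTS; apply: measurable_funM => //.
    apply: (measurableT_comp (@measurable_expR R)).
    by apply: measurable_funN; exact: measurable_funM.
  - apply/measurable_EFinP; apply: measurable_funTS.
    apply: measurable_funM; first apply: measurable_funM => //.
      have m1 : measurable_fun setT (\1_(annulus M) : T -> R).
        by apply: measurable_indic; exact: measurable_annulus.
      have mp : measurable_fun [set: mR] ((fun g => (u, v, g)) : mR -> T).
        by apply: measurable_fun_pair => //; exact: measurable_cst.
      exact: (measurableT_comp m1 mp).
    apply: measurable_funM => //; apply: (measurableT_comp (@measurable_expR R)).
    by apply: measurable_funN; exact: measurable_funM.
  apply: eq_integral => g; rewrite inE/= in_itv/= andbT => g0.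
  rewrite mem_set ?mul1r//; split => //; exact: lt_trans rw.
rewrite /ppp_mean; under eq_integral do under eq_integral do rewrite inner.
have mI : measurable (`](r ^+ 2)%R, (M ^+ 2)%R]%classic : set mR) by exact: measurable_itv.
rewrite ge0_integral_radial; last 2 first.
- by apply/measurable_EFinP; exact: measurable_indic.
- by move=> w; rewrite lee_fin.
rewrite integral_indic//.
rewrite setIidl; last first.
  move=> w /=; rewrite !in_itv/= andbT => /andP[rw _].
  by rewrite (le_trans (sqr_ge0 r))// ltW.
rewrite /= lebesgue_measure_itv/= lte_fin.
have : r ^+ 2 <= M ^+ 2 by rewrite ler_sqr ?nnegrE ?(ltW r0) ?(ltW M0).
rewrite le_eqVlt => /predU1P[->|rM2]; first by rewrite ltxx subrr !mulr0 !mule0.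
by rewrite rM2 -EFinB -!EFinM/= mulrA.
Qed.

End mean_measure.

(** * Closure properties of smooth functions and the tail functional *)

Section smooth_closure.
Local Notation "f ^` ()" := (derive1 f) : ring_scope.
Local Notation "f ^` ( n )" := (derive1n n f) : ring_scope.
Context {R : realType}.
Implicit Types f g : R -> R.

(** Finite order, with the derivative taken on the inside: the Leibniz rule produces other
    functions, and the induction can then be generalised over all functions. *)
Fixpoint smooth_upto (n : nat) f : Prop :=
  if n is n'.+1 then (forall x : R, 0 < x -> derivable f x 1) /\ smooth_upto n' f^`()
  else True.

Lemma smooth_uptoP f : smooth_pos f <-> forall n, smooth_upto n f.
Proof.
split=> [sf n|sf m x x0].
  elim: n f sf => [//|n ih] f sf; split; first exact: (sf 0%N).
  by apply: ih => m x x0; have := sf m.+1 x x0; rewrite derive1nSl.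
have {sf} : smooth_upto m.+1 f by [].
elim: m f => [|m ih] f; first by case=> /(_ x x0).
by case=> _ /ih; rewrite derive1nSl.
Qed.

Lemma near_pos_eq f g (x : R) : (forall y : R, 0 < y -> f y = g y) -> 0 < x ->
  \near x, f x = g x.
Proof.
by move=> fg x0; near=> y; apply: fg; near: y; exact: lt_nbhsr.
Unshelve. all: by end_near. Qed.

Lemma smooth_upto_eq n f g : (forall x : R, 0 < x -> f x = g x) ->
  smooth_upto n f -> smooth_upto n g.
Proof.
elim: n f g => [//|n ih] f g fg [df sf]; split.
  by move=> x x0; apply: near_eq_derivable (df x x0); exact: near_pos_eq.
apply: ih sf => x x0; rewrite !derive1E; apply: near_eq_derive.
exact: near_pos_eq.
Qed.

Lemma smooth_upto_le n f : smooth_upto n.+1 f -> smooth_upto n f.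
Proof. by elim: n f => [//|n ih] f [df sf]; split=> //; exact: ih. Qed.

Lemma smooth_uptoD n f g : smooth_upto n f -> smooth_upto n g ->
  smooth_upto n (fun x => f x + g x).
Proof.
elim: n f g => [//|n ih] f g [df sf] [dg sg]; split.
  by move=> x x0; apply: derivableD; [exact: df|exact: dg].
apply: smooth_upto_eq (ih _ _ sf sg) => x x0.
by rewrite !derive1E deriveD//; [exact: df|exact: dg].
Qed.

Lemma smooth_uptoM n f g : smooth_upto n f -> smooth_upto n g ->
  smooth_upto n (fun x => f x * g x).
Proof.
elim: n f g => [//|n ih] f g sf sg; have [df sf'] := sf; have [dg sg'] := sg; split.
  by move=> x x0; apply: derivableM; [exact: df|exact: dg].
have s1 := ih _ _ sf' (smooth_upto_le _ _ sg).
have s2 := ih _ _ (smooth_upto_le _ _ sf) sg'.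
apply: smooth_upto_eq (smooth_uptoD _ _ _ s1 s2) => x x0.
rewrite !derive1E deriveM; [|exact: df|exact: dg].
by rewrite /GRing.scale/= addrC [g x * _]mulrC.
Qed.

Lemma smooth_upto_exp n f : smooth_upto n f -> smooth_upto n (fun x => expR (f x)).
Proof.
elim: n f => [//|n ih] f sf; have [df sf'] := sf.
have dexp (x : R) : 0 < x -> is_derive x 1 (fun x => expR (f x)) (f^`() x * expR (f x)).
  move=> x0; have d1 : is_derive x 1 f (f^`() x).
    by rewrite derive1E; exact/derivableP/df.
  have := @is_derive1_comp _ expR f x _ _ (is_derive_expR (f x)) d1.
  by rewrite mulrC.
split; first by move=> x /dexp[].
apply: smooth_upto_eq (smooth_uptoM _ _ _ sf' (ih f (smooth_upto_le _ _ sf))) => x x0.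
by rewrite [RHS]derive1E; have := dexp x x0 => ?; rewrite derive_val.
Qed.

Lemma smooth_pos_cst (c : R) : smooth_pos (fun=> c).
Proof.
apply/smooth_uptoP => n; elim: n c => [//|n ih] c; split; first by move=> x _.
apply: smooth_upto_eq (ih 0) => x _; by rewrite derive1_cst.
Qed.

Lemma smooth_pos_id : smooth_pos (fun x : R => x).
Proof.
apply/smooth_uptoP => -[//|n]; split; first by move=> x _.
apply: smooth_upto_eq ((smooth_uptoP _).1 (smooth_pos_cst 1) n) => x _.
by rewrite derive1E derive_id.
Qed.

Lemma smooth_posD f g : smooth_pos f -> smooth_pos g -> smooth_pos (fun x => f x + g x).
Proof.
by move=> /smooth_uptoP sf /smooth_uptoP sg; apply/smooth_uptoP => n; exact: smooth_uptoD.
Qed.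

Lemma smooth_posM f g : smooth_pos f -> smooth_pos g -> smooth_pos (fun x => f x * g x).
Proof.
by move=> /smooth_uptoP sf /smooth_uptoP sg; apply/smooth_uptoP => n; exact: smooth_uptoM.
Qed.

Lemma smooth_posZ (c : R) f : smooth_pos f -> smooth_pos (fun x => c * f x).
Proof. by move=> sf; apply: smooth_posM => //; exact: smooth_pos_cst. Qed.

Lemma smooth_pos_exp f : smooth_pos f -> smooth_pos (fun x => expR (f x)).
Proof. by move=> /smooth_uptoP sf; apply/smooth_uptoP => n; exact: smooth_upto_exp. Qed.

Lemma smooth_pos_sum (I : finType) (F : I -> R -> R) :
  (forall i, smooth_pos (F i)) -> smooth_pos (fun x => \sum_i F i x).
Proof.
move=> sF; elim: (index_enum I) => [|i s ih].
  by under eq_fun do rewrite big_nil; exact: smooth_pos_cst.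
by under eq_fun do rewrite big_cons; exact: smooth_posD.
Qed.

Lemma derive1n_scale f (z : R) m (x : R) : smooth_pos f -> 0 < z -> 0 < x ->
  (fun x => f (z * x))^`(m) x = z ^+ m * f^`(m) (z * x).
Proof.
move=> sf z0; elim: m x => [|m ih] x x0; first by rewrite expr0 mul1r.
have d1 : is_derive (z * x) 1 f^`(m) (f^`(m.+1) (z * x)).
  by rewrite derive1nS derive1E; apply/derivableP; apply: sf; exact: mulr_gt0.
have d2 : is_derive x 1 (fun x => z * x) z.
  by apply: is_derive_eq; rewrite /GRing.scale/=; ring.
have d3 := @is_derive1_comp _ f^`(m) (fun x => z * x) x _ _ d1 d2.
have d4 : is_derive x 1 (fun x => z ^+ m * f^`(m) (z * x)) (z ^+ m.+1 * f^`(m.+1) (z * x)).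
  apply: (is_derive_eq (is_deriveZ (z ^+ m) d3)).
  by rewrite /GRing.scale/= exprSr; ring.
rewrite derive1nS derive1E -(@derive_val _ _ _ _ _ _ _ d4); apply: near_eq_derive.
exact: near_pos_eq.
Qed.

Lemma smooth_pos_scale f (z : R) : smooth_pos f -> 0 < z -> smooth_pos (fun x => f (z * x)).
Proof.
move=> sf z0 m x x0.
have d1 : derivable f^`(m) (z * x) 1 by apply: sf; exact: mulr_gt0.
have d2 : is_derive x 1 (fun x => z * x) z.
  by apply: is_derive_eq; rewrite /GRing.scale/=; ring.
have [d3 _] := @is_derive1_comp _ f^`(m) (fun x => z * x) x _ _ (derivableP d1) d2.
have : derivable (fun x => z ^+ m * f^`(m) (z * x)) x 1 by exact: derivableM.
apply: near_eq_derivable; apply: near_pos_eq x0 => y y0.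
by rewrite derive1n_scale.
Qed.

(* For [L] the Laplace transform of a nonnegative [X], this is
   E[gamma_tail k (z * X)] *)
Definition laplace_tail (k : nat) (L : R -> R) (z : R) : R :=
  \sum_(m < k) (- z) ^+ m / m`!%:R * L^`(m) z.

Lemma laplace_tail_cvg k (L_ : nat -> R -> R) (L : R -> R) (z : R) : 0 < z ->
  (forall n, completely_monotone (L_ n)) ->
  (forall x : R, 0 < x -> L_ n x @[n --> \oo] --> L x) -> smooth_pos L ->
  laplace_tail k (L_ n) z @[n --> \oo] --> laplace_tail k L z.
Proof.
move=> z0 cm LL sL; rewrite /laplace_tail; elim: k => [|k ih].
  by under eq_fun do rewrite big_ord0; rewrite big_ord0; exact: cvg_cst.
under eq_fun do rewrite big_ord_recr/=; rewrite big_ord_recr/=.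
apply: cvgD => //; apply: cvgM; first exact: cvg_cst.
exact: cvg_completely_monotone.
Qed.

Lemma continuous_laplace_tail k (L : R -> R) (z : R) : smooth_pos L -> 0 < z ->
  {for z, continuous (laplace_tail k L)}.
Proof.
move=> sL z0; rewrite /laplace_tail; elim: k => [|k ih].
  have -> : (fun z => \sum_(m < 0) (- z) ^+ m / m`!%:R * L^`(m) z) = fun=> 0.
    by apply/funext => y; rewrite big_ord0.
  exact: cvg_cst.
have -> : (fun z => \sum_(m < k.+1) (- z) ^+ m / m`!%:R * L^`(m) z) =
   fun z => \sum_(m < k) (- z) ^+ m / m`!%:R * L^`(m) z + (- z) ^+ k / k`!%:R * L^`(k) z.
  by apply/funext => y; rewrite big_ord_recr.
apply: cvgD; first exact: ih.
apply: cvgM.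
  apply: cvgM; last exact: cvg_cst.
  apply: (cvg_comp (fun z : R => - z) (fun z => z ^+ k)); last exact: exprn_continuous.
  by apply: cvgN; exact: cvg_id.
have : {for z, continuous L^`(k)}.
  by apply: differentiable_continuous; apply/derivable1_diffP; exact: sL.
by [].
Qed.

(** The theorem differentiates in a scale [x] at 1; by the chain rule each derivative yields a
    factor [z], which gives derivatives at [z]. *)
Lemma laplace_tail_scale k (L : R -> R) (z : R) : smooth_pos L -> 0 < z ->
  \sum_(m < k) ((-1) ^+ m / m`!%:R * (fun x => L (z * x))^`(m) 1) = laplace_tail k L z.
Proof.
move=> sL z0; apply: eq_bigr => m _; rewrite derive1n_scale// mulr1.
by rewrite -[- z]mulN1r exprMn; ring.
Qed.

Lemma derive1nZ f (c : R) m (x : R) : smooth_pos f -> 0 < x ->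
  (fun x => c * f x)^`(m) x = c * f^`(m) x.
Proof.
move=> sf; elim: m x => [//|m ih] x x0.
have d1 : is_derive x 1 f^`(m) (f^`(m.+1) x).
  by rewrite derive1nS derive1E; apply/derivableP; exact: sf.
have d2 : is_derive x 1 (fun x => c * f^`(m) x) (c * f^`(m.+1) x).
  exact: (is_deriveZ c d1).
rewrite derive1nS derive1E -(@derive_val _ _ _ _ _ _ _ d2); apply: near_eq_derive.
exact: near_pos_eq.
Qed.

Lemma laplace_tailZ k (c : R) (L : R -> R) (z : R) : smooth_pos L -> 0 < z ->
  laplace_tail k (fun x => c * L x) z = c * laplace_tail k L z.
Proof.
move=> sL z0; rewrite /laplace_tail mulr_sumr; apply: eq_bigr => m _.
by rewrite derive1nZ// mulrCA.
Qed.

Lemma laplace_tail_expsum k (I : finType) (w X : I -> R) (z : R) :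
  laplace_tail k (fun x => \sum_i w i * expR (- (x * X i))) z =
  \sum_i w i * gamma_tail k (z * X i).
Proof.
rewrite /laplace_tail.
under eq_bigr do rewrite derive1n_expsum mulr_sumr.
rewrite exchange_big/=; apply: eq_bigr => i _.
rewrite gamma_tailE mulr_sumr; apply: eq_bigr => m _.
have -> : (z * X i) ^+ m = (- z) ^+ m * (- X i) ^+ m by rewrite -exprMn mulrNN.
by ring.
Qed.

(** The summand of index 0 is [L z], and complete monotonicity makes the others nonnegative. This
    lower bound drives the limit [z -> 0]. *)
Lemma laplace_tail_ge0 k (L : R -> R) (z : R) : completely_monotone L -> 0 < z ->
  L z <= laplace_tail k.+1 L z.
Proof.
move=> [_ L0] z0; rewrite /laplace_tail big_ord_recl/= expr0 fact0 divr1 mul1r lerDl.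
apply: sumr_ge0 => m _; rewrite -[- z]mulN1r exprMn.
have := L0 (bump 0 m) z z0; set d := _^`(_) z => d0.
have -> : (-1) ^+ bump 0 m * z ^+ bump 0 m / (bump 0 m)`!%:R * d =
  z ^+ bump 0 m / (bump 0 m)`!%:R * ((-1) ^+ bump 0 m * d) by ring.
by rewrite mulr_ge0// divr_ge0// exprn_ge0// ltW.
Qed.

End smooth_closure.

(** * Gamma tails averaged over independent Poisson counts *)

Section poisson_mixture.
Context {R : realType} {I : finType}.
Variables (mu v : I -> R) (ka ka0 : R).
Hypotheses (mu0 : forall i, 0 <= mu i) (v0 : forall i, 0 <= v i)
  (ka_ge0 : 0 <= ka) (ka0_ge0 : 0 <= ka0).

Definition mix_weight {M : nat} (n : {ffun I -> 'I_M}) : R :=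
  \prod_i pois (mu i) (n i).

Definition mix_value {M : nat} (n : {ffun I -> 'I_M}) : R :=
  ka * (\sum_i v i * (n i)%:R) + ka0.

(** Laplace transform of an affine function of independent Poisson counts, restricted to all counts
    being less than [M] so that it is a finite sum of exponentials. *)
Definition mix_laplace (M : nat) (x : R) : R :=
  \sum_(n : {ffun I -> 'I_M}) mix_weight n * expR (- (x * mix_value n)).

(** Laplace transform of the full compound Poisson variable, shifted by [ka0]. *)
Definition mix_limit (x : R) : R :=
  expR (- (x * ka0) - \sum_i mu i * (1 - expR (- (x * ka * v i)))).

Lemma pois_ge0 (m : R) n : 0 <= m -> 0 <= pois m n.
Proof. by move=> m0; rewrite mulr_ge0 ?expR_ge0// divr_ge0// exprn_ge0. Qed.

Lemma mix_weight_ge0 M (n : {ffun I -> 'I_M}) : 0 <= mix_weight n.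
Proof. by apply: prodr_ge0 => i _; exact: pois_ge0. Qed.

Lemma mix_value_ge0 M (n : {ffun I -> 'I_M}) : 0 <= mix_value n.
Proof. by rewrite addr_ge0// mulr_ge0// sumr_ge0// => i _; rewrite mulr_ge0. Qed.

Lemma mix_laplaceE M x : mix_laplace M x = expR (- (x * ka0)) *
  \prod_i \sum_(j < M) pois (mu i) j * expR (- (x * ka * v i)) ^+ j.
Proof.
rewrite bigA_distr_bigA/= mulr_sumr; apply: eq_bigr => n _.
rewrite big_split/= mulrCA; congr (_ * _).
rewrite /mix_value mulrDr opprD addrC expRD; congr (_ * _).
rewrite !mulr_sumr -sumrN expR_sum; apply: eq_bigr => i _.
by rewrite -expRM_natr; congr expR; ring.
Qed.

(** The total weight is the transform at 0, a product of Gamma tails. *)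
Lemma mix_weight_sum M : \sum_(n : {ffun I -> 'I_M}) mix_weight n <= 1.
Proof.
have -> : \sum_(n : {ffun I -> 'I_M}) mix_weight n = mix_laplace M 0.
  by apply: eq_bigr => n _; rewrite mul0r oppr0 expR0 mulr1.
rewrite mix_laplaceE mul0r oppr0 expR0 mul1r; apply: prodr_ile1 => i _.
have -> : \sum_(j < M) pois (mu i) j * expR (- (0 * ka * v i)) ^+ j = gamma_tail M (mu i).
  by apply: eq_bigr => j _; rewrite !mul0r oppr0 expR0 expr1n mulr1.
by rewrite gamma_tail_ge0// gamma_tail_le1.
Qed.

Lemma pois_series_cvg (m e : R) : \sum_(j < M) pois m j * e ^+ j @[M --> \oo] -->
  expR (- (m * (1 - e))).
Proof.
have -> : expR (- (m * (1 - e))) = expR (m * e) * expR (- m).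
  by rewrite -expRD; congr expR; ring.
have -> : (fun M => \sum_(j < M) pois m j * e ^+ j) =
    fun M => series (exp_coeff (m * e)) M * expR (- m).
  apply/funext => M; rewrite /series/= big_mkord mulr_suml; apply: eq_bigr => j _.
  by rewrite /pois /exp_coeff/= exprMn; ring.
by apply: cvgM; [exact: is_cvg_series_exp_coeff|exact: cvg_cst].
Qed.

Lemma mix_laplace_cvg x : mix_laplace M x @[M --> \oo] --> mix_limit x.
Proof.
have -> : mix_laplace ^~ x = fun M => expR (- (x * ka0)) *
    \prod_i \sum_(j < M) pois (mu i) j * expR (- (x * ka * v i)) ^+ j.
  by apply/funext => M; rewrite mix_laplaceE.
rewrite /mix_limit expRD -sumrN expR_sum; apply: cvgM; first exact: cvg_cst.
elim: (index_enum I) => [|i s ih].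
  by under eq_fun do rewrite big_nil; rewrite big_nil; exact: cvg_cst.
under eq_fun do rewrite big_cons; rewrite big_cons; apply: cvgM => //.
exact: pois_series_cvg.
Qed.

Lemma smooth_mix_limit : smooth_pos mix_limit.
Proof.
apply: smooth_pos_exp.
have -> : (fun x => - (x * ka0) - \sum_i mu i * (1 - expR (- (x * ka * v i)))) =
   fun x => (- ka0) * x + (-1) * \sum_i mu i * (1 + (-1) * expR ((- (ka * v i)) * x)).
  apply/funext => x; rewrite mulN1r mulNr [ka0 * x]mulrC; congr (_ - _).
  apply: eq_bigr => i _; rewrite mulN1r; congr (_ * (1 - expR _)); ring.
apply: smooth_posD; first by apply: smooth_posZ; exact: smooth_pos_id.
apply: smooth_posZ; apply: smooth_pos_sum => i; apply: smooth_posZ.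
apply: smooth_posD; first exact: smooth_pos_cst.
apply: smooth_posZ; apply: smooth_pos_exp; apply: smooth_posZ; exact: smooth_pos_id.
Qed.

Lemma completely_monotone_mix_laplace M : completely_monotone (mix_laplace M).
Proof.
by apply: completely_monotone_expsum => n; [exact: mix_weight_ge0|exact: mix_value_ge0].
Qed.

Lemma completely_monotone_mix_limit : completely_monotone mix_limit.
Proof.
apply: (@completely_monotone_lim _ mix_laplace); first exact: completely_monotone_mix_laplace.
  by move=> x _; exact: mix_laplace_cvg.
exact: smooth_mix_limit.
Qed.

Lemma mix_tailE k M z : laplace_tail k (mix_laplace M) z =
  \sum_(n : {ffun I -> 'I_M}) mix_weight n * gamma_tail k (z * mix_value n).
Proof. exact: laplace_tail_expsum. Qed.

Lemma mix_tail_bound k M z : 0 < z -> 0 <= laplace_tail k (mix_laplace M) z <= 1.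
Proof.
move=> z0; rewrite mix_tailE.
have X0 n : 0 <= z * @mix_value M n by rewrite mulr_ge0 ?mix_value_ge0// ltW.
apply/andP; split.
  by apply: sumr_ge0 => n _; rewrite mulr_ge0 ?mix_weight_ge0 ?gamma_tail_ge0.
apply: le_trans (mix_weight_sum M); apply: ler_sum => n _.
by rewrite ler_piMr ?mix_weight_ge0// gamma_tail_le1.
Qed.

Lemma mix_tail_cvg k z : 0 < z ->
  laplace_tail k (mix_laplace M) z @[M --> \oo] --> laplace_tail k mix_limit z.
Proof.
move=> z0; apply: laplace_tail_cvg => //.
- exact: completely_monotone_mix_laplace.
- by move=> x _; exact: mix_laplace_cvg.
- exact: smooth_mix_limit.
Qed.

Lemma cvg_bound (u : R^nat) (l : R) : (forall n, 0 <= u n <= 1) -> u @ \oo --> l -> 0 <= l <= 1.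
Proof.
move=> u01 ul; have cu : cvg (u @ \oo) by apply/cvg_ex; exists l.
rewrite -(cvg_lim _ ul)//; apply/andP; split.
  by apply: limr_ge => //; near=> n; have /andP[] := u01 n.
by apply: limr_le => //; near=> n; have /andP[] := u01 n.
Unshelve. all: by end_near. Qed.

Lemma mix_limit_tail_bound k z : 0 < z -> 0 <= laplace_tail k mix_limit z <= 1.
Proof.
by move=> z0; apply: cvg_bound (mix_tail_cvg k z z0) => M; exact: mix_tail_bound.
Qed.

End poisson_mixture.


(** * Densities extended by zero *)

Section positive_density.
Context {R : realType}.
Notation leb := (@lebesgue_measure R).
Local Notation mR := (measurableTypeR R).
Implicit Types f : R -> R.

(** Densities are constrained on the positive half-line only; extension by 0 gives a nonnegative
    measurable function on the whole line. *)
Definition posd f : R -> R := f \_ (`]0%R, +oo[%classic : set R).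

Lemma posdE f x : posd f x = if 0 < x then f x else 0.
Proof. by rewrite /posd patchE mem_setE in_itv/= andbT. Qed.

Lemma measurable_posd f : measurable_fun (`]0%R, +oo[ : set R) f ->
  measurable_fun [set: mR] (posd f : mR -> mR).
Proof.
move=> mf; apply: (measurable_restrictT _ _).1 mf.
exact: measurable_itv.
Qed.

Lemma posd_ge0 f x : (forall y, 0 < y -> 0 <= f y) -> 0 <= posd f x.
Proof. by move=> f0; rewrite posdE; case: ifPn => // /f0. Qed.

Lemma integral_posd f (B : set mR) :
  (\int[leb]_(x in B) (posd f x)%:E = \int[leb]_(x in B `&` `]0%R, +oo[) (f x)%:E)%E.
Proof.
rewrite integral_mkcondr; apply: eq_integral => x _.
by rewrite posdE patchE mem_setE in_itv/= andbT; case: ifP.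
Qed.

End positive_density.

(** * Measurability of limits that may fail to exist *)

Section limn_measurable.
Context {d : measure_display} {T : measurableType d} {R : realType}.

(** Where upper and lower limits agree, [limn] is their common value; elsewhere it is the default
    [point]. This serves the interference series, whose terms may have any sign on a null set. *)
Lemma measurable_fun_limn (u : nat -> T -> \bar R) :
  (forall n, measurable_fun setT (u n)) -> measurable_fun setT (fun x => limn (u ^~ x)).
Proof.
move=> mu.
have ms : measurable_fun setT (fun x => limn_esup (u ^~ x)).
  exact: measurable_fun_limn_esup.
have mi : measurable_fun setT (fun x => limn_einf (u ^~ x)).
  have -> : (fun x => limn_einf (u ^~ x)) = fun x => (- limn_esup (fun n => - u n x))%E.
    by apply/funext => x; rewrite [limn_esup _]limn_esupN oppeK.
  apply/measurableT_comp => //; apply: measurable_fun_limn_esup => n.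
  exact/measurableT_comp.
have -> : (fun x => limn (u ^~ x)) = fun x =>
    if limn_esup (u ^~ x) == limn_einf (u ^~ x) then limn_esup (u ^~ x) else point.
  apply/funext => x; case: ifPn => [/eqP e|/eqP e].
    apply/cvg_lim => //; apply: (@squeeze_cvge _ _ _ _ (einfs (u ^~ x)) _ (esups (u ^~ x))).
    - by near=> n; apply/andP; split;
        [apply: ereal_inf_lbound|apply: ereal_sup_ubound]; exists n => /=.
    - by rewrite e limn_einf_lim; exact: is_cvg_einfs.
    - by rewrite limn_esup_lim; exact: is_cvg_esups.
  apply: dvgP => cu; apply: e.
  by rewrite (is_cvg_limn_esupE cu) (is_cvg_limn_einfE cu).
apply: measurable_fun_ifT => //.
exact: measurable_fun_eqe.
Unshelve. all: by end_near. Qed.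

End limn_measurable.

(** * Monotone convergence for series *)

Section nneseries_monotone.
Context {R : realType}.

(** The series are integrals for the counting measure. *)
Lemma cvg_nneseries_monotone (a : nat -> nat -> \bar R) (b : nat -> \bar R) :
  (forall n j, 0 <= a n j)%E -> (forall j, nondecreasing_seq (a ^~ j)) ->
  (forall j, a n j @[n --> \oo] --> b j) ->
  (\sum_(j <oo) a n j)%E @[n --> \oo] --> (\sum_(j <oo) b j)%E.
Proof.
move=> a0 nda ab.
have b0 j : (0 <= b j)%E.
  by rewrite -(cvg_lim _ (ab j))//; apply: lime_ge; [exact: cvgP (ab j)|exact: nearW].
rewrite -(ge0_integral_count b0).
have -> : (fun n => \sum_(j <oo) a n j)%E =
    fun n => (\int[counting]_j a n j)%E.
  by apply/funext => n; rewrite -ge0_integral_count.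
have -> : (\int[counting]_j b j = \int[counting]_j limn (a ^~ j))%E.
  by apply: eq_integral => j _; apply/esym/cvg_lim => //; exact: ab.
exact: cvg_monotone_convergence.
Qed.

End nneseries_monotone.

(** * Finite partitions, full events and integer counts *)

Section measure_toolkit.
Context {d : measure_display} {T : measurableType d} {R : realType}.

Lemma measure_exists_fin (mu : {measure set T -> \bar R}) (J : finType) (E : J -> set T) :
  (forall j, measurable (E j)) -> (forall i j w, E i w -> E j w -> i = j) ->
  mu [set w | exists j, E j w] = (\sum_j mu (E j))%E.
Proof.
move=> mE tE; have iJ j : j \in index_enum J by exact: mem_index_enum.
have -> : [set w | exists j, E j w] = \bigcup_(j in [set` index_enum J]) E j.
  apply/seteqP; split => [w [j Ejw]|w [j _ Ejw]]; last by exists j.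
  by exists j => //=; exact: iJ.
rewrite measure_fin_bigcup//.
- by rewrite -fsbig_seq// index_enum_uniq.
- by move=> i j _ _ [w [Ei Ej]]; exact: tE Ei Ej.
Qed.

Lemma measureI_full (mu : {measure set T -> \bar R}) (A N : set T) :
  measurable A -> measurable N -> mu (~` N) = 0%E -> mu (A `&` N) = mu A.
Proof.
move=> mA mN N0; rewrite (measureDI mu mA mN) [X in (_ = X + _)%E](_ : _ = 0)%E ?add0e//.
apply: subset_measure0 N0; [exact: measurableD|exact: measurableC|by move=> w []].
Qed.

Lemma bigcap_full (mu : {measure set T -> \bar R}) (N : nat -> set T) :
  (forall n, measurable (N n)) -> (forall n, mu (~` N n) = 0%E) ->
  mu (~` \bigcap_n N n) = 0%E.
Proof.
move=> mN N0; rewrite setC_bigcap.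
have mU : measurable (\bigcup_n ~` N n).
  by apply: bigcup_measurable => n _; exact: measurableC.
apply/(negligibleP _ mU); apply: negligible_bigcup => n.
by apply/negligibleP; [exact: measurableC|exact: N0].
Qed.

Lemma setI_full (mu : {measure set T -> \bar R}) (A B : set T) :
  measurable A -> measurable B -> mu (~` A) = 0%E -> mu (~` B) = 0%E ->
  mu (~` (A `&` B)) = 0%E.
Proof.
move=> mA mB A0 B0; rewrite setCI measureU0//; exact: measurableC.
Qed.

(** The partial sums are bounded integers; once they reach their maximum they are stationary. *)
Lemma nneseries_bool_nat (b : nat -> bool) :
  (\sum_(j <oo) ((b j)%:R : R)%:E < +oo)%E ->
  exists n, (\sum_(j <oo) ((b j)%:R : R)%:E = n%:R%:E)%E.
Proof.
set s := (\sum_(j <oo) _)%E => soo.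
pose S n := (\sum_(0 <= j < n) b j)%N.
have SE n : (\sum_(0 <= j < n) ((b j)%:R : R)%:E = (S n)%:R%:E)%E.
  by rewrite sumEFin /S natr_sum.
have b0 j : (0 <= ((b j)%:R : R)%:E)%E by rewrite lee_fin.
have s0 : (0 <= s)%E by exact: nneseries_ge0.
have Sle n : ((S n)%:R%:E <= s)%E by rewrite -SE; exact: nneseries_lim_ge.
have [m sm] : exists m : nat, (s <= m%:R%:E)%E.
  exists (Num.truncn (fine s)).+1; rewrite -[leLHS]fineK ?ge0_fin_numE// lee_fin.
  exact/ltW/truncnS_gt.
have Sm n : (S n <= m)%N.
  by rewrite -(ler_nat R) -lee_fin; exact: le_trans (Sle n) sm.
have exS : exists v, `[< exists n, S n = v >].
  by exists (S 0%N); apply/asboolP; exists 0%N.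
have bS v : `[< exists n, S n = v >] -> (v <= m)%N by move=> /asboolP[n <-].
case: (ex_maxnP exS bS) => v /asboolP[N SN] vmax; exists v.
apply/cvg_lim => //; apply: cvg_near_cst; near=> n.
rewrite SE; congr (_%:R%:E); apply/eqP; rewrite eqn_leq vmax/=; last by apply/asboolP; exists n.
have Nn : (N <= n)%N by near: n; exact: nbhs_infty_ge.
by rewrite -SN /S [leqRHS](big_cat_nat (n := N))//= leq_addr.
Unshelve. all: by end_near. Qed.

End measure_toolkit.

(** * The layer-cake formula *)

Section layer_cake.
Context {d : measure_display} {Omega : measurableType d} {R : realType}.
Notation leb := (@lebesgue_measure R).
Local Notation mR := (measurableTypeR R).
Variables (P : probability Omega R) (g : Omega -> mR).
Hypothesis mg : measurable_fun setT g.

Lemma integral_inv1D (a b : R) : 0 <= a -> a < b ->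
  (\int[leb]_(z in `]a, b[) ((1 + z)^-1)%:E = (ln (1 + b) - ln (1 + a))%:E)%E.
Proof.
move=> a0 ab.
have p1 (x : R) : a <= x -> 0 < 1 + x by move=> ax; rewrite ltr_pwDl// (le_trans a0).
have dF (x : R) : a <= x -> is_derive x 1 (fun z => ln (1 + z)) (1 + x)^-1.
  move=> ax; have d1 := is_derive1_ln (p1 x ax).
  have d2 : is_derive x 1 (fun z : R => 1 + z) 1.
    rewrite -[X in is_derive _ _ _ X]add0r.
    exact: (is_deriveD (is_derive_cst (1 : R) x 1) (is_derive_id x 1)).
  have := @is_derive1_comp _ (@ln R) (fun z => 1 + z) x _ _ d1 d2.
  by rewrite mulr1.
have cF (x : R) : a <= x -> {for x, continuous (fun z : R => ln (1 + z))}.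
  move=> ax; apply: differentiable_continuous; apply/derivable1_diffP.
  by have [] := dF x ax.
have cf (x : R) : a <= x -> {for x, continuous (fun z : R => (1 + z)^-1)}.
  move=> ax; apply: cvgV; first by rewrite gt_eqF// p1.
  by apply: cvgD; [exact: cvg_cst|exact: cvg_id].
have mf : measurable_fun (`]a, b[ : set mR) (fun z : R => (1 + z)^-1).
  apply: measurable_funTS; apply: (measurableT_comp measurable_invr).
  exact: measurable_funD.
rewrite integral_itv_bndo_bndc; last exact/measurable_EFinP.
rewrite integral_itv_obnd_cbnd; last first.
  apply/measurable_EFinP; apply: measurable_funTS; apply: (measurableT_comp measurable_invr).
  exact: measurable_funD.
rewrite (@continuous_FTC2 _ _ (fun z => ln (1 + z)))//.
- apply: continuous_in_subspaceT => x; rewrite inE/= in_itv/= => /andP[ax _].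
  exact: cf.
- split.
  + move=> x; rewrite in_itv/= => /andP[/ltW ax _].
    by have [] := dF x ax.
  + by apply: cvg_at_right_filter; exact: cF.
  + by apply: cvg_at_left_filter; apply: cF; exact: ltW.
- move=> x; rewrite in_itv/= => /andP[/ltW ax _]; rewrite derive1E.
  by have := dF x ax => ?; rewrite derive_val.
Qed.

(** On the event [a < g w], [ln (1 + g w)] splits into [ln (1 + a)] and the integral of 1/(1+z) from
    [a] to [g w]; Tonelli exchanges the latter with the expectation. *)
Lemma layer_cake_ln (a : R) : 0 < a ->
  (\int[P]_w (ln (1 + g w) * (a < g w)%R%:R)%:E =
   \int[leb]_(z in `]a, +oo[) (P [set w | (z < g w)%R] * ((1 + z)^-1)%:E)
   + (ln (1 + a))%:E * P [set w | (a < g w)%R])%E.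
Proof.
move=> a0.
have ma (z : R) : measurable [set w | (z < g w)%R].
  have := measurable_fun_ltr (measurable_cst z) mg.
  by move=> /(_ measurableT [set true]); rewrite setTI; exact.
pose h (x : Omega * mR) : R := (a < x.2)%R%:R * (x.2 < g x.1)%R%:R * (1 + x.2)^-1.
have h0 x : 0 <= h x.
  rewrite /h; have [ax|ax] := ltP a x.2; last by rewrite !mul0r.
  by rewrite mulr_ge0// invr_ge0 addr_ge0// ltW// (lt_trans a0).
have mh : measurable_fun setT (EFin \o h).
  apply/measurable_EFinP; apply: measurable_funM; first apply: measurable_funM.
  - apply: measurableT_comp => //; apply: measurable_fun_ltr => //; exact: measurable_snd.
  - apply: measurableT_comp => //; apply: measurable_fun_ltr; first exact: measurable_snd.
    by apply: (measurableT_comp mg); exact: measurable_fst.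
  - apply: (measurableT_comp measurable_invr).
    by apply: measurable_funD => //; exact: measurable_snd.
have Eh0 x : (0 <= (EFin \o h) x)%E by rewrite lee_fin.
have inner w : (\int[leb]_z (EFin \o h) (w, z) =
    ((ln (1 + g w) - ln (1 + a)) * (a < g w)%R%:R)%:E)%E.
  have [ag|ag] := ltP a (g w); last first.
    rewrite mulr0; apply: integral0_eq => z _; rewrite /= /h/=.
    have [az|] := ltP a z; last by rewrite !mul0r.
    by rewrite ltNge (le_trans ag (ltW az)) mulr0 mul0r.
  rewrite mulr1 -integral_inv1D ?(ltW a0)// [RHS]integral_mkcond.
  apply: eq_integral => z _; rewrite patchE mem_setE in_itv/= /h/=.
  by case: (a < z) => /=; rewrite ?mul1r ?mul0r//; case: (z < g w); rewrite ?mul1r ?mul0r.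
have ln0 w : a < g w -> 0 <= ln (1 + g w) - ln (1 + a).
  move=> ag; rewrite subr_ge0 ler_ln ?posrE ?lerD2l ?ltW// addr_gt0//.
  exact: lt_trans ag.
transitivity (\int[P]_w (((ln (1 + g w) - ln (1 + a)) * (a < g w)%R%:R)%:E +
    (ln (1 + a) * (a < g w)%R%:R)%:E))%E.
  by apply: eq_integral => w _; rewrite -EFinD; congr EFin; ring.
have mi : measurable_fun setT (fun w => ((a < g w)%R%:R : R)).
  by apply: measurableT_comp => //; exact: measurable_fun_ltr.
have la0 : 0 <= ln (1 + a) by rewrite ln_ge0// lerDl ltW.
rewrite ge0_integralD//; last 4 first.
- by move=> w _; rewrite lee_fin; have [ag|] := ltP a (g w); rewrite ?mulr1 ?mulr0// ln0.
- under eq_fun do rewrite -inner.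
  exact: (measurable_fun_fubini_tonelli_F _ mh Eh0).
- by move=> w _; rewrite lee_fin mulr_ge0.
- by apply/measurable_EFinP; exact: measurable_funM.
congr (_ + _)%E; last first.
  under eq_integral do rewrite EFinM.
  rewrite ge0_integralZl_EFin//; [|exact/measurable_EFinP].
  congr (_ * _)%E; rewrite -[X in _ = P X]setIT -integral_indic//.
  apply: eq_integral => w _; congr (_%:R)%:E; congr nat_of_bool.
  by apply/idP/idP => [ag|]; [rewrite inE|rewrite inE].
under eq_integral do rewrite -inner.
rewrite [LHS](@fubini_tonelli _ _ _ _ _ P leb (EFin \o h) mh Eh0).
rewrite [RHS]integral_mkcond; apply: eq_integral => z _.
rewrite patchE mem_setE in_itv/= andbT; case: ifPn => az; last first.
  by apply: integral0_eq => w _; rewrite /= /h/= (negbTE az) !mul0r.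
have z0 : 0 <= (1 + z)^-1 by rewrite invr_ge0 addr_ge0// ltW// (lt_trans a0).
have mz : measurable_fun setT (fun w => ((z < g w)%R%:R : R)).
  by apply: measurableT_comp => //; exact: measurable_fun_ltr.
transitivity (\int[P]_w (((1 + z)^-1)%:E * ((z < g w)%R%:R)%:E))%E.
  by apply: eq_integral => w _; rewrite /= /h/= az mul1r mulrC.
rewrite ge0_integralZl_EFin//; [|exact/measurable_EFinP].
rewrite muleC; congr (_ * _)%E.
rewrite -[X in _ = P X]setIT -integral_indic//.
apply: eq_integral => w _; congr (_%:R)%:E; congr nat_of_bool.
by apply/idP/idP => [ag|]; [rewrite inE|rewrite inE].
Qed.

End layer_cake.

(** * The STAR-RIS model: consequences of the joint law *)

Section star_model.
Context {R : realType}.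
Notation leb := (@lebesgue_measure R).
Local Notation mR := (measurableTypeR R).
Local Notation T := ((mR * mR) * mR)%type.
Variables (lamB PB Cr thr thI n0 alpha betaT at_ : R) (k : nat).
Hypotheses (hlamB : 0 < lamB) (hPB : 0 < PB) (hCr : 0 < Cr) (hthr : 0 < thr)
  (hthI : 0 < thI) (halpha : 2 < alpha) (hk : (0 < k)%N)
  (hbetaT0 : 0 < betaT) (hbetaT1 : betaT < 1) (hat0 : 0 < at_).
Variable fRU : R -> R.
Hypotheses (hfRU_meas : measurable_fun (`]0%R, +oo[ : set R) fRU)
  (hfRU_ge0 : forall s, 0 < s -> 0 <= fRU s)
  (hfRU_1 : (\int[leb]_(s in `]0%R, +oo[) (fRU s)%:E = 1)%E).
Context {d : measure_display} {Omega : measurableType d}.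
Variables (P : probability Omega R) (r1 r2 G : Omega -> R) (chi : Omega -> bool)
  (xT yT gT xR yR gR : nat -> Omega -> R).
Hypotheses (hr1 : measurable_fun setT r1) (hr2 : measurable_fun setT r2)
  (hG : measurable_fun setT G) (hchi : measurable (chi @^-1` [set true]))
  (hxT : forall j, measurable_fun setT (xT j)) (hyT : forall j, measurable_fun setT (yT j))
  (hgT : forall j, measurable_fun setT (gT j))
  (hxR : forall j, measurable_fun setT (xR j)) (hyR : forall j, measurable_fun setT (yR j))
  (hgR : forall j, measurable_fun setT (gR j)).
Hypothesis hlaw : forall (B C D : set R) (c : bool) (p q : nat)
      (AT : 'I_p -> set ((R * R) * R)) (nT : 'I_p -> nat)
      (AR : 'I_q -> set ((R * R) * R)) (nR : 'I_q -> nat),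
      measurable B -> measurable C -> measurable D ->
      (forall i, measurable (AT i) /\ bounded_loc (AT i)) ->
      (forall i j, i != j -> AT i `&` AT j = set0) ->
      (forall i, measurable (AR i) /\ bounded_loc (AR i)) ->
      (forall i j, i != j -> AR i `&` AR j = set0) ->
      P [set w | B (r1 w) /\ C (r2 w) /\ chi w = c /\ D (G w) /\
                 (forall i, count_in (xT^~ w) (yT^~ w) (gT^~ w) (AT i) = (nT i)%:R%:E) /\
                 (forall i, count_in (xR^~ w) (yR^~ w) (gR^~ w) (AR i) = (nR i)%:R%:E)]
      = (\int[@lebesgue_measure R]_(r in B `&` `]0%R, +oo[)
            (2 * pi * lamB * r * expR (- (pi * lamB * r ^+ 2))
             * \prod_(i < p) pois (ppp_mean lamB thI r (AT i)) (nT i)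
             * \prod_(i < q) pois (ppp_mean lamB thI r (AR i)) (nR i))%:E
         * (\int[@lebesgue_measure R]_(s in C `&` `]0%R, +oo[) (fRU s)%:E)
         * (2^-1)%:E
         * (\int[@lebesgue_measure R]_(g in D `&` `]0%R, +oo[)
              (g ^+ k.-1 * expR (- (g / thr)) / ((k.-1)`!%:R * thr ^+ k))%:E))%E.

Let fB (r : R) : R := 2 * pi * lamB * r * expR (- (pi * lamB * r ^+ 2)).
Let fG (g : R) : R := g ^+ k.-1 * expR (- (g / thr)) / ((k.-1)`!%:R * thr ^+ k).

Let fB_ge0 r : 0 < r -> 0 <= fB r.
Proof. by move=> r0; rewrite !mulr_ge0 ?expR_ge0 ?pi_ge0 ?ltW. Qed.

Let fG_ge0 g : 0 < g -> 0 <= fG g.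
Proof.
by move=> g0; rewrite divr_ge0 ?mulr_ge0 ?exprn_ge0 ?expR_ge0 ?(ltW g0) ?(ltW hthr).
Qed.

Let mfB : measurable_fun (`]0%R, +oo[ : set R) fB.
Proof.
apply: measurable_funTS; apply: measurable_funM; first exact: measurable_funM.
apply: (measurableT_comp (@measurable_expR R)); apply: measurable_funN.
by apply: measurable_funM => //; exact: measurable_funX.
Qed.

Let mfG : measurable_fun (`]0%R, +oo[ : set R) fG.
Proof.
apply: measurable_funTS; apply: measurable_funM => //.
apply: measurable_funM; first exact: measurable_funX.
apply: (measurableT_comp (@measurable_expR R)); apply: measurable_funN.
exact: measurable_funM.
Qed.

Let integral_fG : (\int[leb]_(g in `]0%R, +oo[) (fG g)%:E = 1)%E.
Proof.
rewrite integral_itv_obnd_cbnd; last exact/measurable_EFinP.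
rewrite integral_gamma_tail// mul0r; case: k hk => // k' _.
by rewrite gamma_tail0.
Qed.

Let mchi c : measurable [set w | chi w = c].
Proof.
case: c; first exact: hchi.
have -> : [set w | chi w = false] = ~` (chi @^-1` [set true]).
  by apply/seteqP; split => w /=; [move=> ->|case: (chi w)].
exact: measurableC.
Qed.

Let pw (b : bool) (j : nat) (w : Omega) : T :=
  if b then ((xT j w, yT j w), gT j w) else ((xR j w, yR j w), gR j w).

Let mpw b j : measurable_fun setT (pw b j).
Proof.
case: b.
  exact: (measurable_fun_pair (measurable_fun_pair (hxT j) (hyT j)) (hgT j)).
exact: (measurable_fun_pair (measurable_fun_pair (hxR j) (hyR j)) (hgR j)).
Qed.

Let cnt (b : bool) (A : set T) (w : Omega) : \bar R :=
  (\sum_(j <oo) ((pw b j w \in A)%:R)%:E)%E.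

Let mcnt b A : measurable A -> measurable_fun setT (cnt b A).
Proof.
move=> mA; apply: ge0_emeasurable_sum => // j _.
apply/measurable_EFinP.
have m1 : measurable_fun setT (\1_A : T -> R) by exact: measurable_indic.
exact: (measurableT_comp m1 (mpw b j)).
Qed.

Let mcnt_eq b A n : measurable A -> measurable [set w | cnt b A w = n%:R%:E].
Proof.
move=> mA; have := @measurable_eqe _ _ _ setT measurableT _ _ (mcnt b A mA) (measurable_cst (n%:R%:E)).
by rewrite setTI; congr measurable; apply/seteqP; split => w /= /eqP.
Qed.

Let half : (2^-1)%:E + (2^-1)%:E = 1%:E :> \bar R.
Proof. by rewrite -EFinD; congr EFin; lra. Qed.

Let pweight {p q : nat} (AT : 'I_p -> set T) (nT : 'I_p -> nat)
    (AR : 'I_q -> set T) (nR : 'I_q -> nat) (r : R) : R :=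
  \prod_(i < p) pois (ppp_mean lamB thI r (AT i)) (nT i)
  * \prod_(i < q) pois (ppp_mean lamB thI r (AR i)) (nR i).

Let locsets {p : nat} (A : 'I_p -> set T) : Prop :=
  (forall i, measurable (A i) /\ bounded_loc (A i)) /\
  (forall i j, i != j -> A i `&` A j = set0).

Let locsets0 : locsets (fun _ : 'I_0 => set0).
Proof. by split=> -[]. Qed.

Let cev (c : bool) {p q : nat} (AT : 'I_p -> set T) (nT : 'I_p -> nat)
    (AR : 'I_q -> set T) (nR : 'I_q -> nat) : set Omega :=
  [set w | chi w = c /\ (forall i, cnt true (AT i) w = (nT i)%:R%:E) /\
                        (forall i, cnt false (AR i) w = (nR i)%:R%:E)].

Let mcev c p q (AT : 'I_p -> set T) nT (AR : 'I_q -> set T) nR :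
  locsets AT -> locsets AR -> measurable (cev c AT nT AR nR).
Proof.
move=> [mT _] [mR' _].
have mall (n : nat) (b : bool) (A : 'I_n -> set T) (m : 'I_n -> nat) :
    (forall i, measurable (A i) /\ bounded_loc (A i)) ->
    measurable [set w | forall i, cnt b (A i) w = (m i)%:R%:E].
  move=> mA; have -> : [set w | forall i, cnt b (A i) w = (m i)%:R%:E] =
      \bigcap_(i in [set: 'I_n]) [set w | cnt b (A i) w = (m i)%:R%:E].
    by apply/seteqP; split => w /= h i; [move=> _|]; apply: h.
  apply: fin_bigcap_measurable => // i _; exact: mcnt_eq (mA i).1.
by apply: measurableI; [exact: mchi|apply: measurableI; exact: mall].
Qed.

Let law0 c : P [set w | chi w = c] =
  (\int[leb]_(r in `]0%R, +oo[) (fB r)%:E * (2^-1)%:E)%E.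
Proof.
have nA (X : 'I_0 -> Prop) (i : 'I_0) : X i by case: i.
have := hlaw setT setT setT c 0 0 (fun=> set0) (fun=> 0%N) (fun=> set0) (fun=> 0%N)
  measurableT measurableT measurableT (nA _) (nA _) (nA _) (nA _).
rewrite !setTI hfRU_1 [X in (_ * X)%E]integral_fG !mule1.
have -> : [set w | [set: R] (r1 w) /\ [set: R] (r2 w) /\ chi w = c /\ [set: R] (G w) /\
    (forall i : 'I_0, count_in (xT ^~ w) (yT ^~ w) (gT ^~ w) set0 = 0%:R%:E) /\
    (forall i : 'I_0, count_in (xR ^~ w) (yR ^~ w) (gR ^~ w) set0 = 0%:R%:E)] =
    [set w | chi w = c].
  by apply/seteqP; split => w /=; [tauto|move=> ->; split=> //; split=> //; split=> //; split=> //; split=> -[]].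
move=> ->; congr (_ * _)%E; apply: eq_integral => r _.
by rewrite !big_ord0 !mulr1.
Qed.

(** Read off from the law: each value of [chi] has probability half this integral, and the two
    probabilities sum to 1. *)
Let integral_fB : (\int[leb]_(r in `]0%R, +oo[) (fB r)%:E = 1)%E.
Proof.
have h : (P [set w | chi w = true] + P [set w | chi w = false] = 1)%E.
  rewrite -measureU; [|exact: mchi|exact: mchi|].
    rewrite -(@probability_setT _ _ _ P); congr (P _).
    by apply/seteqP; split => // w _ /=; case: (chi w); [left|right].
  by apply/seteqP; split => // w /= [->].
have X0 : (0 <= \int[leb]_(r in `]0%R, +oo[) (fB r)%:E)%E.
  by apply: integral_ge0 => r; rewrite /= in_itv/= andbT => r0; rewrite lee_fin fB_ge0.
move: h; rewrite !law0 -ge0_muleDr ?lee_fin// half mule1.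
by [].
Qed.

Let mW p q (AT : 'I_p -> set T) nT (AR : 'I_q -> set T) nR :
  locsets AT -> locsets AR ->
  measurable_fun [set: mR] (pweight AT nT AR nR : mR -> mR).
Proof.
have mpois (n : nat) : measurable_fun [set: mR] ((fun m => pois m n) : mR -> mR).
  apply: measurable_funM; first by apply: measurable_funM => //; exact: measurable_funX.
  by apply: (measurableT_comp (@measurable_expR R)); exact: measurable_funN.
have mprod n (A : 'I_n -> set T) m : locsets A -> measurable_fun [set: mR]
    ((fun r => \prod_(i < n) pois (ppp_mean lamB thI r (A i)) (m i)) : mR -> mR).
  move=> [mA _]; apply: measurable_prod => i _; apply: (measurableT_comp (mpois _)).
  by apply: measurable_ppp_mean => //; exact: (mA i).1.
by move=> lT lR; apply: measurable_funM; exact: mprod.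
Qed.

Let W_bound p q (AT : 'I_p -> set T) nT (AR : 'I_q -> set T) nR r :
  locsets AT -> locsets AR -> 0 <= pweight AT nT AR nR r <= 1.
Proof.
have pb (m : R) (n : nat) : 0 <= m -> 0 <= pois m n <= 1.
  move=> m0; rewrite pois_ge0//=; apply: le_trans (gamma_tail_le1 n.+1 m m0).
  by rewrite /gamma_tail big_ord_recr/= lerDr gamma_tail_ge0.
have hb n (A : 'I_n -> set T) m : locsets A ->
    0 <= \prod_(i < n) pois (ppp_mean lamB thI r (A i)) (m i) <= 1.
  move=> [mA _]; have h i : 0 <= pois (ppp_mean lamB thI r (A i)) (m i) <= 1.
    by apply: pb; apply: ppp_mean_ge0; rewrite ?ltW//; exact: (mA i).1.
  by rewrite prodr_ge0 ?prodr_ile1// => i _; have /andP[] := h i.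
move=> /hb - /(_ nT)/andP[a0 a1] /hb - /(_ nR)/andP[b0 b1].
by rewrite mulr_ge0//= mulr_ile1.
Qed.

(** The law in box form, with the factor 1/2 and the count probabilities attached to the integral
    over [r1], the only variable they depend on. *)
Let hlawE (B C D : set mR) c p q (AT : 'I_p -> set T) nT (AR : 'I_q -> set T) nR :
  measurable B -> measurable C -> measurable D -> locsets AT -> locsets AR ->
  P (cev c AT nT AR nR `&` ((r2 @^-1` C) `&` ((r1 @^-1` B) `&` (G @^-1` D)))) =
  (\int[leb]_(s in C `&` `]0%R, +oo[) (fRU s)%:E
   * \int[leb]_(r in B `&` `]0%R, +oo[) (2^-1 * (pweight AT nT AR nR r * fB r))%:E
   * \int[leb]_(g in D `&` `]0%R, +oo[) (fG g)%:E)%E.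
Proof.
move=> mB mC mD [mT tT] [mR' tR].
have := hlaw B C D c p q AT nT AR nR mB mC mD mT tT mR' tR => h.
transitivity (P [set w | B (r1 w) /\ C (r2 w) /\ chi w = c /\ D (G w) /\
    (forall i, count_in (xT^~ w) (yT^~ w) (gT^~ w) (AT i) = (nT i)%:R%:E) /\
    (forall i, count_in (xR^~ w) (yR^~ w) (gR^~ w) (AR i) = (nR i)%:R%:E)]).
  by congr (P _); apply/seteqP; split => w /=; rewrite /cev/= /cnt/= /count_in; tauto.
have -> := h.
set X := (X in (X * _ * _ * _)%E = _); set Y := (X in (_ * X * _ * _)%E = _).
have XE : (\int[leb]_(r in B `&` `]0%R, +oo[) (2^-1 * (pweight AT nT AR nR r * fB r))%:E =
    (2^-1)%:E * X)%E.
  have mBI : measurable (B `&` `]0%R, +oo[ : set mR).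
    by apply: measurableI => //; exact: measurable_itv.
  rewrite -ge0_integralZl_EFin//.
  - by apply: eq_integral => r _; rewrite -EFinM; congr (_ * _)%:E; rewrite mulrC /pweight mulrA.
  - move=> r [_]; rewrite /= in_itv/= andbT => r0; rewrite lee_fin -mulrA mulr_ge0 ?fB_ge0//.
    by have /andP[] := W_bound p q AT nT AR nR r (conj mT tT) (conj mR' tR).
  - apply/measurable_EFinP.
    have -> : (fun r => 2 * pi * lamB * r * expR (- (pi * lamB * r ^+ 2))
       * \prod_(i < p) pois (ppp_mean lamB thI r (AT i)) (nT i)
       * \prod_(i < q) pois (ppp_mean lamB thI r (AR i)) (nR i)) =
       fun r => fB r * pweight AT nT AR nR r by apply/funext => r; rewrite /pweight mulrA.
    apply: measurable_funM.
      by apply: measurable_funS mfB; [exact: measurable_itv|move=> r []].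
    by apply: measurable_funTS; exact: mW (conj mT tT) (conj mR' tR).
rewrite [(X * Y)%E]muleC -[(Y * X * _)%E]muleA [(X * _)%E]muleC.
congr (_ * _ * _)%E; exact/esym.
Qed.


Let mA := measurable_posd fRU hfRU_meas.
Let A_ge0 s : 0 <= posd fRU s. Proof. exact: (posd_ge0 _ _ hfRU_ge0). Qed.
Let A_fin : (\int[leb]_x (posd fRU x)%:E < +oo)%E.
Proof. by rewrite integral_posd setTI hfRU_1 ltry. Qed.
Local Notation lawA := (mdensity leb (posd fRU) mA A_ge0 A_fin).

Let mB := measurable_posd fB mfB.
Let B_ge0 r : 0 <= posd fB r. Proof. exact: (posd_ge0 _ _ fB_ge0). Qed.
Let B_fin : (\int[leb]_x (posd fB x)%:E < +oo)%E.
Proof. by rewrite integral_posd setTI integral_fB ltry. Qed.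
Local Notation lawB := (mdensity leb (posd fB) mB B_ge0 B_fin).

Let mG := measurable_posd fG mfG.
Let G_ge0 g : 0 <= posd fG g. Proof. exact: (posd_ge0 _ _ fG_ge0). Qed.
Let G_fin : (\int[leb]_x (posd fG x)%:E < +oo)%E.
Proof. by rewrite integral_posd setTI integral_fG ltry. Qed.
Local Notation lawG := (mdensity leb (posd fG) mG G_ge0 G_fin).

(** Joint law of [(r2, r1)], in this order: [x.1] stands for [r2] and [x.2] for [r1]. *)
Local Notation Q := (fprod lawA lawB).

Let integral_Q (h : mR * mR -> \bar R) : measurable_fun setT h -> (forall q, 0 <= h q)%E ->
  (\int[Q]_q h q = \int[lawA]_s \int[lawB]_r h (s, r))%E.
Proof. by move=> mh h0; exact: (@fubini_tonelli1 _ _ _ _ _ lawA lawB h mh h0). Qed.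

Let lawG_tail (x : R) : 0 <= x -> lawG `[x, +oo[%classic = (gamma_tail k (x / thr))%:E.
Proof.
move=> x0; rewrite /mdensity integral_posd -integral_gamma_tail//.
have [->|xn0] := eqVneq x 0.
  rewrite setIidr; last by move=> y /=; rewrite !in_itv/= !andbT => /ltW.
  by rewrite integral_itv_obnd_cbnd//; apply/measurable_EFinP; exact: mfG.
rewrite setIidl// => y /=; rewrite !in_itv/= !andbT; apply: lt_le_trans.
by rewrite lt_neqAle eq_sym xn0.
Qed.

Let measurable_gamma_tail : measurable_fun [set: mR] (gamma_tail k : mR -> mR).
Proof. by apply: continuous_measurable_fun; exact: continuous_gamma_tail. Qed.

(** On a count event the triple [(r2, r1, G)] has a product law, and integrating [G] out leaves a
    Gamma tail. *)
Let count_prob (c : bool) p q (AT : 'I_p -> set T) nT (AR : 'I_q -> set T) nR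
    (xi : mR * mR -> mR) : locsets AT -> locsets AR -> measurable_fun setT xi ->
  (forall x, 0 <= xi x) ->
  P (cev c AT nT AR nR `&` [set w | xi (r2 w, r1 w) <= G w]) =
  (\int[Q]_x (2^-1 * (pweight AT nT AR nR x.2 * gamma_tail k (xi x / thr)))%:E)%E.
Proof.
move=> lT lR mxi xi0.
pose W := pweight AT nT AR nR.
have W0 r : 0 <= W r by have /andP[] := W_bound p q AT nT AR nR r lT lR.
have W1 r : W r <= 1 by have /andP[] := W_bound p q AT nT AR nR r lT lR.
have mW' : measurable_fun [set: mR] (W : mR -> mR) by exact: mW.
(* Restricting to the counts only reweights the density of [r1]. *)
pose fW (r : R) := 2^-1 * (W r * fB r).
have mfW : measurable_fun (`]0%R, +oo[ : set R) fW.
  have mW1 : measurable_fun [set: R] W by exact: mW'.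
  apply: measurable_funM; first exact: measurable_cst.
  by apply: measurable_funM mfB; apply: measurable_funTS; exact: mW1.
have h2 : 0 <= 2^-1 :> R by rewrite invr_ge0.
have fW0 r : 0 < r -> 0 <= fW r.
  by move=> r0; apply: mulr_ge0 h2 _; apply: mulr_ge0 (W0 r) _; exact: fB_ge0.
pose mW2 := measurable_posd fW mfW.
pose W2 r : 0 <= posd fW r := posd_ge0 fW r fW0.
have WB r : posd fW r = 2^-1 * (W r * posd fB r).
  by rewrite !posdE; case: ifP => //; rewrite !mulr0.
have W_fin : (\int[leb]_x (posd fW x)%:E < +oo)%E.
  apply: le_lt_trans B_fin; apply: ge0_le_integral => //.
  - by move=> x _; rewrite lee_fin W2.
  - exact/measurable_EFinP.
  - exact/measurable_EFinP.
  - move=> x _; rewrite lee_fin WB mulrA ler_piMl ?B_ge0//.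
    by rewrite mulr_ile1// invf_le1// ler1n.
pose lawW := mdensity leb (posd fW) mW2 W2 W_fin.
have mev := mcev c p q AT nT AR nR lT lR.
have box (B C D : set mR) : measurable B -> measurable C -> measurable D ->
    (P (cev c AT nT AR nR `&` ((r2 : Omega -> mR) @^-1` B `&`
      ((r1 : Omega -> mR) @^-1` C `&` (G : Omega -> mR) @^-1` D))) =
     lawA B * lawW C * lawG D)%E.
  move=> mB' mC mD; rewrite /lawW /mdensity !integral_posd.
  by rewrite (hlawE C B D c p q AT nT AR nR).
have mh : measurable_fun setT ((fun x : mR * mR => gamma_tail k (xi x / thr)) : _ -> mR).
  by apply: (measurableT_comp measurable_gamma_tail); exact: measurable_funM.
have h0 x : 0 <= gamma_tail k (xi x / thr) by rewrite gamma_tail_ge0// divr_ge0// ltW.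
pose Y : set ((mR * mR) * mR) := [set x | xi x.1 <= x.2].
have mY : measurable Y.
  have := @measurable_fun_ler _ _ _ setT (xi \o fst) snd
    (measurableT_comp mxi measurable_fst) measurable_snd.
  by move=> /(_ measurableT [set true]); rewrite setTI; exact.
have := joint_law_product P (r2 : Omega -> mR) (r1 : Omega -> mR) (G : Omega -> mR)
  (cev c AT nT AR nR) hr2 hr1 hG mev lawA lawW lawG box Y mY.
move=> h; transitivity ((fprod lawA lawW \x lawG)%E Y); first exact: h.
transitivity (\int[fprod lawA lawW]_x (gamma_tail k (xi x / thr))%:E)%E.
  apply: eq_integral => x _; rewrite /= -lawG_tail//; congr (lawG _).
  by apply/seteqP; split => g; rewrite /xsection/= inE/= in_itv/= andbT.
pose h1 (x : mR * mR) : mR := gamma_tail k (xi x / thr).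
pose h2' (x : mR * mR) : mR := 2^-1 * (W x.2 * h1 x).
have mh2 : measurable_fun setT h2'.
  apply: measurable_funM; first exact: measurable_cst.
  by apply: measurable_funM mh; exact: (measurableT_comp mW' measurable_snd).
have mE1 : measurable_fun setT (EFin \o h1) by apply/measurable_EFinP; exact: mh.
have mE2 : measurable_fun setT (EFin \o h2') by apply/measurable_EFinP; exact: mh2.
have h20 x : 0 <= h2' x.
  by apply: mulr_ge0 h2 _; apply: mulr_ge0 (W0 _) _; exact: h0.
have E10 x : (0 <= (EFin \o h1) x)%E by rewrite lee_fin; exact: h0.
have E20 x : (0 <= (EFin \o h2') x)%E by rewrite lee_fin; exact: h20.
transitivity (\int[lawA]_s \int[lawB]_r (h2' (s, r))%:E)%E; last first.
  exact/esym/(integral_Q (EFin \o h2') mE2 E20).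
transitivity (\int[lawA]_s \int[lawW]_r (h1 (s, r))%:E)%E.
  exact: (@fubini_tonelli1 _ _ _ _ _ lawA lawW (EFin \o h1) mE1 E10).
apply: eq_integral => s _.
have ms1 : measurable_fun setT (fun r : mR => (h1 (s, r))%:E).
  by apply: (measurableT_comp mE1); exact: measurable_pair1.
have ms2 : measurable_fun setT (fun r : mR => (h2' (s, r))%:E).
  by apply: (measurableT_comp mE2); exact: measurable_pair1.
rewrite (ge0_integral_mdensity _ _ _ _ _ _ ms1 (fun r => E10 (s, r))).
rewrite (ge0_integral_mdensity _ _ _ _ _ _ ms2 (fun r => E20 (s, r))).
apply: eq_integral => r _; rewrite -!EFinM WB; congr EFin; rewrite /h2'/=.
by rewrite mulrCA [h1 _ * (W r * _)]mulrCA !mulrA.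
Qed.


(** * Tail events for simple interference *)

Let den (c : bool) : R := at_ * thr * beta betaT c * PB * Cr.

Let beta_gt0 c : 0 < beta betaT c.
Proof. by case: c => //=; rewrite subr_gt0. Qed.

Let den_gt0 c : 0 < den c.
Proof. by rewrite !mulr_gt0. Qed.

(** Solving [z <= gamma_t] for [G] gives the threshold [z * thr] times an affine function of the
    interference, with slope [ka] and constant [ka0]. The factor [thr] sits in [den], so that the
    Gamma tail of scale 1 is evaluated at [z] times this function. *)
Let ka (c : bool) (r : R) : R := r `^ alpha / den c.
Let ka0 (c : bool) (x : mR * mR) : R := (x.2 * x.1) `^ alpha * n0 ^+ 2 / den c.

Let ka_ge0 c r : 0 <= ka c r. Proof. by rewrite divr_ge0 ?powR_ge0// ltW. Qed.
Let ka0_ge0 c x : 0 <= ka0 c x.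
Proof.
apply: divr_ge0; last exact/ltW/den_gt0.
by apply: mulr_ge0; [exact: powR_ge0|exact: sqr_ge0].
Qed.

Let mka c : measurable_fun [set: mR * mR] ((fun x => ka c x.2) : _ -> mR).
Proof.
apply: measurable_funM => //; apply: (measurableT_comp (measurable_powR _)).
exact: measurable_snd.
Qed.

Let mka0 c : measurable_fun [set: mR * mR] (ka0 c : _ -> mR).
Proof.
apply: measurable_funM => //; apply: measurable_funM => //.
apply: (measurableT_comp (measurable_powR _)).
by apply: measurable_funM; [exact: measurable_snd|exact: measurable_fst].
Qed.

(* With [J] the interference multiplied by [r2 `^ alpha], this is the event
   [z <= gamma_t] on the branch [chi = c]. *)
Let tailev (c : bool) (z : R) (J : Omega -> \bar R) : set Omega :=
  [set w | ((z * thr)%:E * ((ka c (r1 w))%:E * J w + (ka0 c (r2 w, r1 w))%:E) <= (G w)%:E)%E].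

Let mr21 : measurable_fun setT ((fun w => (r2 w, r1 w)) : Omega -> mR * mR).
Proof. exact: (measurable_fun_pair hr2 hr1). Qed.

Let mtailev c z J : measurable_fun setT J -> measurable (tailev c z J).
Proof.
move=> mJ; rewrite -[X in measurable X]setTI; apply: measurable_lee => //.
  apply: measurable_funeM; apply: emeasurable_funD.
    apply: emeasurable_funM => //; apply/measurable_EFinP.
    exact: (measurableT_comp (mka c) mr21).
  by apply/measurable_EFinP; exact: (measurableT_comp (mka0 c) mr21).
by apply/measurable_EFinP; exact: hG.
Qed.

(** Counterpart of [mix_limit] for the two processes together, conditionally on both distances. *)
Let slap (c : bool) {p q : nat} (vT : 'I_p -> R) (AT : 'I_p -> set T)
    (vR : 'I_q -> R) (AR : 'I_q -> set T) (x : mR * mR) (t : R) : R :=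
  expR (- (t * ka0 c x) -
    (\sum_i ppp_mean lamB thI x.2 (AT i) * (1 - expR (- (t * ka c x.2 * vT i))) +
     \sum_i ppp_mean lamB thI x.2 (AR i) * (1 - expR (- (t * ka c x.2 * vR i))))).

Section simple_interference.
Variables (c : bool) (z : R) (p q : nat) (vT : 'I_p -> R) (AT : 'I_p -> set T)
  (vR : 'I_q -> R) (AR : 'I_q -> set T).
Hypotheses (z0 : 0 < z) (sT : simple_data vT AT) (sR : simple_data vR AR).

(** The two processes are conditionally independent, so their count sets form a single family of
    independent Poisson counts. *)
Let I : finType := ('I_p + 'I_q)%type.
Let v (i : I) : R := match i with inl i => vT i | inr i => vR i end.
Let mu (r : R) (i : I) : R :=
  match i with inl i => ppp_mean lamB thI r (AT i) | inr i => ppp_mean lamB thI r (AR i) end.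
Let ci (i : I) (w : Omega) : \bar R :=
  match i with inl i => cnt true (AT i) w | inr i => cnt false (AR i) w end.

Let lT : locsets AT. Proof. by case: sT. Qed.
Let lR : locsets AR. Proof. by case: sR. Qed.

Let v_gt0 i : 0 < v i.
Proof. by case: i => i /=; [case: sT|case: sR]. Qed.

Let mci i : measurable_fun setT (ci i).
Proof. by case: i => i; apply: mcnt; [exact: (lT.1 i).1|exact: (lR.1 i).1]. Qed.

Let mu_ge0 r i : 0 <= mu r i.
Proof.
by case: i => i; apply: ppp_mean_ge0; rewrite ?ltW//; [exact: (lT.1 i).1|exact: (lR.1 i).1].
Qed.

Let Jn (w : Omega) : \bar R := (\sum_i (v i)%:E * ci i w)%E.

Let mJn : measurable_fun setT Jn.
Proof. by apply: emeasurable_sum => i _; exact: measurable_funeM. Qed.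

Let mvalue (n : I -> nat) (x : mR * mR) : R :=
  ka c x.2 * (\sum_i v i * (n i)%:R) + ka0 c x.

Let mvalue_ge0 n x : 0 <= mvalue n x.
Proof.
by rewrite addr_ge0// mulr_ge0// sumr_ge0// => i _; rewrite mulr_ge0// ltW.
Qed.

Let mmvalue n : measurable_fun setT (mvalue n : _ -> mR).
Proof.
apply: measurable_funD; last exact: mka0.
by apply: measurable_funM; [exact: mka|exact: measurable_cst].
Qed.

Let Jn_val (n : I -> nat) w : (forall i, ci i w = (n i)%:R%:E) ->
  Jn w = (\sum_i v i * (n i)%:R)%:E.
Proof.
by move=> wn; rewrite /Jn -sumEFin; apply: eq_bigr => i _; rewrite wn.
Qed.

(** With all counts below [M], the event splits into finitely many cells on each of which the
    interference is a constant. *)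
Let cube M : set Omega :=
  [set w | chi w = c /\ (exists n : {ffun I -> 'I_M}, forall i, ci i w = (n i)%:R%:E) /\
           tailev c z Jn w].

Let cell M (n : {ffun I -> 'I_M}) : set Omega :=
  cev c AT (fun i => n (inl i)) AR (fun i => n (inr i)) `&`
  [set w | z * thr * mvalue (fun i => n i : nat) (r2 w, r1 w) <= G w].

Let mcell M (n : {ffun I -> 'I_M}) : measurable (cell M n).
Proof.
apply: measurableI; first exact: mcev.
have m1 : measurable_fun setT ((fun w => z * thr * mvalue (fun i => n i : nat) (r2 w, r1 w)) : Omega -> R).
  apply: measurable_funM; first exact: measurable_cst.
  exact: (measurableT_comp (mmvalue (fun i => n i : nat)) mr21).
have := measurable_fun_ler m1 hG.
by move=> /(_ measurableT [set true]); rewrite setTI; exact.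
Qed.

Let lee_affine (a b x y g : R) :
  (a%:E * (b%:E * x%:E + y%:E) <= g%:E)%E = (a * (b * x + y) <= g).
Proof. by []. Qed.

Let cubeE M : cube M = [set w | exists n : {ffun I -> 'I_M}, cell M n w].
Proof.
apply/seteqP; split => w.
  move=> [wc [[n wn] we]]; exists n; split.
    by split=> //; split=> i; [exact: (wn (inl i))|exact: (wn (inr i))].
  move: we; rewrite /tailev/= (Jn_val (fun i => n i : nat) w wn) lee_affine.
  by [].
move=> [n [[wc [wT wR]] we]].
have wn i : ci i w = (n i)%:R%:E by case: i => i; [exact: wT|exact: wR].
split=> //; split; first by exists n.
by rewrite /tailev/= (Jn_val (fun i => n i : nat) w wn) lee_affine.
Qed.

Local Notation mixM M x := (mix_laplace (mu x.2) v (ka c x.2) (ka0 c x) M).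

Let pweightE M (n : {ffun I -> 'I_M}) r :
  pweight AT (fun i => n (inl i)) AR (fun i => n (inr i)) r = mix_weight (mu r) n.
Proof. by rewrite /mix_weight big_sumType. Qed.

Let cube_prob M : P (cube M) = (\int[Q]_x (2^-1 * laplace_tail k (mixM M x) z)%:E)%E.
Proof.
rewrite cubeE measure_exists_fin; last 2 first.
- exact: mcell.
- move=> n n' w [[_ [wT wR]] _] [[_ [wT' wR']] _]; apply/ffunP => i; apply/val_inj/eqP.
  rewrite -(eqr_nat R); apply/eqP/EFin_inj.
  by case: i => i; [rewrite -wT -wT'|rewrite -wR -wR'].
pose F (n : {ffun I -> 'I_M}) (x : mR * mR) : R := 2^-1 * (mix_weight (mu x.2) n *
  gamma_tail k (z * mvalue (fun i => n i : nat) x)).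
have mF n : measurable_fun setT (F n : _ -> mR).
  apply: measurable_funM; first exact: measurable_cst.
  apply: measurable_funM.
    under eq_fun do rewrite -pweightE.
    have m1 := mW p q AT (fun i => n (inl i)) AR (fun i => n (inr i)) lT lR.
    exact: (measurableT_comp m1 measurable_snd).
  apply: (measurableT_comp measurable_gamma_tail).
  by apply: measurable_funM; [exact: measurable_cst|exact: mmvalue].
have F0 n x : 0 <= F n x.
  rewrite mulr_ge0 ?invr_ge0// mulr_ge0 ?mix_weight_ge0//.
  by rewrite gamma_tail_ge0// mulr_ge0// ltW.
transitivity (\sum_(n : {ffun I -> 'I_M}) \int[Q]_x (F n x)%:E)%E.
  apply: eq_bigr => n _.
  pose xi (x : mR * mR) : mR := z * thr * mvalue (fun i => n i : nat) x.
  have mxi : measurable_fun setT xi.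
    by apply: measurable_funM; [exact: measurable_cst|exact: mmvalue].
  have xi0 x : 0 <= xi x by rewrite mulr_ge0// mulr_ge0// ltW.
  have h := count_prob c p q AT (fun i => n (inl i)) AR (fun i => n (inr i)) xi lT lR mxi xi0.
  etransitivity; first exact: h.
  apply: eq_integral => x _; congr (_ * _)%:E.
  rewrite pweightE; congr (_ * gamma_tail _ _).
  by rewrite /xi mulrAC mulfK// gt_eqF.
rewrite -ge0_integral_sum//; last 2 first.
- by move=> n; apply/measurable_EFinP; exact: mF.
- by move=> n x _; rewrite lee_fin F0.
apply: eq_integral => x _; rewrite sumEFin mix_tailE; congr EFin.
by rewrite mulr_sumr.
Qed.


Let tail_bound M x : 0 <= laplace_tail k (mixM M x) z <= 1.
Proof. by apply: mix_tail_bound => // i; exact/ltW/v_gt0. Qed.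

Let mtailM M : measurable_fun setT ((fun x => laplace_tail k (mixM M x) z) : mR * mR -> mR).
Proof.
have -> : (fun x => laplace_tail k (mixM M x) z) = fun x : mR * mR =>
    \sum_(n : {ffun I -> 'I_M}) mix_weight (mu x.2) n *
      gamma_tail k (z * mvalue (fun i => n i : nat) x).
  by apply/funext => x; rewrite mix_tailE.
apply: measurable_sum => n; apply: measurable_funM.
  under eq_fun do rewrite -pweightE.
  have m1 := mW p q AT (fun i => n (inl i)) AR (fun i => n (inr i)) lT lR.
  exact: (measurableT_comp m1 measurable_snd).
apply: (measurableT_comp measurable_gamma_tail).
by apply: measurable_funM; [exact: measurable_cst|exact: mmvalue].
Qed.

Local Notation mixL x := (mix_limit (mu x.2) v (ka c x.2) (ka0 c x)).

Let integral_mixM_cvg : (\int[Q]_x (2^-1 * laplace_tail k (mixM M x) z)%:E)%E @[M --> \oo] -->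
  (\int[Q]_x (2^-1 * laplace_tail k (mixL x) z)%:E)%E.
Proof.
apply: (@dominated_cvg _ _ _ Q setT measurableT _ _ (EFin \o cst 1)) => //.
- move=> M; apply/measurable_EFinP; apply: measurable_funM; last exact: mtailM.
  exact: measurable_cst.
- move=> x _; apply: cvg_EFin; first exact: nearW.
  apply: cvgM; first exact: cvg_cst.
  by apply: mix_tail_cvg => // i; exact/ltW/v_gt0.
- exact: finite_measure_integrable_cst.
- move=> M x _; have /andP[t0 t1] := tail_bound M x.
  rewrite /= lee_fin ger0_norm; last by rewrite mulr_ge0// invr_ge0.
  by rewrite mulr_ile1// ?invr_ge0// invf_le1// ler1n.
Qed.

Let mcube M : measurable (cube M).
Proof.
rewrite cubeE; have -> : [set w | exists n : {ffun I -> 'I_M}, cell M n w] =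
    \bigcup_(n in [set: {ffun I -> 'I_M}]) cell M n.
  by apply/seteqP; split => w /= [n]; [move=> wn|move=> _ wn]; exists n.
by apply: fin_bigcup_measurable.
Qed.

Let simple_event : set Omega :=
  [set w | chi w = c /\ (forall i, ci i w < +oo)%E /\ tailev c z Jn w].

Let bigcup_cube : \bigcup_M cube M = simple_event.
Proof.
apply/seteqP; split => w.
  by move=> [M _ [wc [[n wn] we]]]; split=> //; split=> // i; rewrite wn ltry.
move=> [wc [wf we]].
have /choice[n wn] : forall i, exists n : nat, ci i w = n%:R%:E.
  by move=> i; move: (wf i); case: i => i; exact: nneseries_bool_nat.
(* Counts range over ordinals below [M], hence one more than the largest. *)
pose M := (\max_i n i).+1.
have nM i : (n i < M)%N by rewrite ltnS; exact: leq_bigmax.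
exists M => //; split=> //; split=> //.
by exists [ffun i => Ordinal (nM i)] => i; rewrite ffunE wn.
Qed.

Let simple_event_prob : P simple_event =
  (\int[Q]_x (2^-1 * laplace_tail k (mixL x) z)%:E)%E.
Proof.
rewrite -bigcup_cube.
have c1 : P (cube M) @[M --> \oo] --> P (\bigcup_M cube M).
  apply: nondecreasing_cvg_mu => //; first exact: bigcup_measurable.
  move=> M N MN; apply/subsetPset => w [wc [[n wn] we]]; split=> //; split=> //.
  by exists [ffun i => widen_ord MN (n i)] => i; rewrite ffunE wn.
have c2 := integral_mixM_cvg.
have e : (fun M => P (cube M)) =
    fun M => (\int[Q]_x (2^-1 * laplace_tail k (mixM M x) z)%:E)%E.
  by apply/funext => M; exact: cube_prob.
rewrite e in c1.
exact: (cvg_unique _ c1 c2).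
Qed.


Let slapE x : slap c vT AT vR AR x = mixL x.
Proof. by apply/funext => t; rewrite /mix_limit big_sumType. Qed.

Lemma simple_interference_prob :
  P [set w | chi w = c /\ (forall i, cnt true (AT i) w < +oo)%E /\
      (forall i, cnt false (AR i) w < +oo)%E /\
      tailev c z (fun w => \sum_i (vT i)%:E * cnt true (AT i) w +
                           \sum_i (vR i)%:E * cnt false (AR i) w)%E w] =
  (\int[Q]_x (2^-1 * laplace_tail k (slap c vT AT vR AR x) z)%:E)%E.
Proof.
have JE : Jn = (fun w => \sum_i (vT i)%:E * cnt true (AT i) w +
                         \sum_i (vR i)%:E * cnt false (AR i) w)%E.
  by apply/funext => w; rewrite /Jn big_sumType.
transitivity (P simple_event).
  congr (P _); rewrite -JE; apply/seteqP; split => w.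
    by move=> [wc [wT [wR we]]]; split=> //; split=> // -[] i; [exact: wT|exact: wR].
  move=> [wc [wi we]]; split=> //; split; first by move=> i; exact: (wi (inl i)).
  by split=> // i; exact: (wi (inr i)).
by rewrite simple_event_prob; apply: eq_integral => x _; rewrite slapE.
Qed.

Lemma measurable_simple_interference :
  measurable [set w | chi w = c /\ (forall i, cnt true (AT i) w < +oo)%E /\
      (forall i, cnt false (AR i) w < +oo)%E /\
      tailev c z (fun w => \sum_i (vT i)%:E * cnt true (AT i) w +
                           \sum_i (vR i)%:E * cnt false (AR i) w)%E w].
Proof.
have JE : Jn = (fun w => \sum_i (vT i)%:E * cnt true (AT i) w +
                         \sum_i (vR i)%:E * cnt false (AR i) w)%E.
  by apply/funext => w; rewrite /Jn big_sumType.
have : measurable (\bigcup_M cube M) by exact: bigcup_measurable.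
rewrite bigcup_cube; congr measurable; rewrite -JE; apply/seteqP; split => w.
  move=> [wc [wi we]]; split=> //; split; first by move=> i; exact: (wi (inl i)).
  by split=> // i; exact: (wi (inr i)).
by move=> [wc [wT [wR we]]]; split=> //; split=> // -[] i; [exact: wT|exact: wR].
Qed.

Lemma simple_tail_bound (x : mR * mR) :
  0 <= laplace_tail k (slap c vT AT vR AR x) z <= 1.
Proof.
rewrite slapE.
exact: (mix_limit_tail_bound _ _ _ _ (mu_ge0 x.2) (fun i => ltW (v_gt0 i))
  (ka_ge0 c x.2) (ka0_ge0 c x) k z z0).
Qed.

Lemma measurable_simple_tail : measurable_fun setT
  ((fun x : mR * mR => laplace_tail k (slap c vT AT vR AR x) z) : _ -> mR).
Proof.
have mc (x : mR * mR) : laplace_tail k (mixM M x) z @[M --> \oo] --> laplace_tail k (mixL x) z.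
  exact: (mix_tail_cvg _ _ _ _ (mu_ge0 x.2) (fun i => ltW (v_gt0 i))
    (ka_ge0 c x.2) (ka0_ge0 c x) k z z0).
under eq_fun do rewrite slapE.
by apply: (@measurable_fun_cvg _ _ _ setT _ _ mtailM) => x _; exact: mc.
Qed.

Lemma completely_monotone_simple (x : mR * mR) :
  completely_monotone (slap c vT AT vR AR x).
Proof.
rewrite slapE.
exact: (completely_monotone_mix_limit _ _ _ _ (mu_ge0 x.2) (fun i => ltW (v_gt0 i))
  (ka_ge0 c x.2) (ka0_ge0 c x)).
Qed.

End simple_interference.

Let count_law p q (AT : 'I_p -> set T) nT (AR : 'I_q -> set T) nR :
  locsets AT -> locsets AR ->
  P [set w | (forall i, cnt true (AT i) w = (nT i)%:R%:E) /\
             (forall i, cnt false (AR i) w = (nR i)%:R%:E)] =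
  (\int[lawB]_r (pweight AT nT AR nR r)%:E)%E.
Proof.
move=> lT lR; pose W := pweight AT nT AR nR.
have W0 r : 0 <= W r by have /andP[] := W_bound p q AT nT AR nR r lT lR.
have mW' : measurable_fun setT (fun r : mR => (W r)%:E).
  by apply/measurable_EFinP; exact: (mW p q AT nT AR nR lT lR).
have EW0 r : (0 <= (W r)%:E)%E by rewrite lee_fin.
have I0 : (0 <= \int[lawB]_r (W r)%:E)%E by apply: integral_ge0 => r _; rewrite lee_fin.
have h c : P (cev c AT nT AR nR) = ((2^-1)%:E * \int[lawB]_r (W r)%:E)%E.
  have := hlawE _ _ _ c p q AT nT AR nR measurableT measurableT measurableT lT lR.
  rewrite !preimage_setT !setIT !setTI hfRU_1 integral_fG mul1e mule1 => ->.
  rewrite (ge0_integral_mdensity _ _ _ _ _ _ mW' EW0).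
  rewrite -ge0_integralZl_EFin ?invr_ge0//; last 2 first.
  - by move=> r _; apply: mule_ge0; rewrite lee_fin; [exact: W0|exact: B_ge0].
  - by apply: emeasurable_funM => //; apply/measurable_EFinP; exact: mB.
  rewrite [LHS]integral_mkcond; apply: eq_integral => r _.
  rewrite patchE mem_setE in_itv/= andbT posdE -!EFinM.
  by case: ifPn => // _; rewrite !mulr0.
have m c := mcev c p q AT nT AR nR lT lR.
transitivity (P (cev true AT nT AR nR `|` cev false AT nT AR nR)).
  congr (P _); apply/seteqP; split => w.
    by move=> [wT wR]; case wc : (chi w); [left|right].
  by move=> [[]|[]].
rewrite measureU; [|exact: m|exact: m|]; last first.
  by apply/seteqP; split => // w [[w1 _] [w2 _]]; move: w2; rewrite w1.
by rewrite [X in (X + _)%E]h [X in (_ + X)%E]h -ge0_muleDl ?lee_fin ?invr_ge0// half mul1e.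
Qed.

(** Full probability, as the three densities live on the positive half-line; powers of the distances
    behave as expected here. *)
Let posev : set Omega := [set w | 0 < r1 w /\ 0 < r2 w /\ 0 < G w].

Let mposev : measurable posev.
Proof.
have mp (X : Omega -> R) : measurable_fun setT X -> measurable [set w | 0 < X w].
  move=> mX; have := measurable_fun_ltr (measurable_cst (0:R)) mX.
  by move=> /(_ measurableT [set true]); rewrite setTI; exact.
by apply: measurableI; [exact: mp|apply: measurableI; exact: mp].
Qed.

Let posev_full : P (~` posev) = 0%E.
Proof.
have mI : measurable (`]0%R, +oo[%classic : set mR) by exact: measurable_itv.
pose E c := [set w | chi w = c] `&` posev.
have mE c : measurable (E c) by apply: measurableI; [exact: mchi|exact: mposev].
have h c : P (E c) = (2^-1)%:E.
  have := hlawE _ _ _ c 0 0 _ (fun=> 0%N) _ (fun=> 0%N) mI mI mI locsets0 locsets0.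
  rewrite !setIid hfRU_1 integral_fG mul1e mule1 => h.
  transitivity (P (cev c (fun=> set0) (fun _ : 'I_0 => 0%N) (fun=> set0) (fun _ : 'I_0 => 0%N)
     `&` (r2 @^-1` `]0, +oo[%classic `&` (r1 @^-1` `]0, +oo[%classic `&` G @^-1` `]0, +oo[%classic)))).
    congr (P _); apply/seteqP; split => w /=; rewrite !in_itv/= !andbT.
      by move=> [wc [? [? ?]]]; split=> //; split=> //; split=> -[].
    by move=> [[wc _] [? [? ?]]].
  rewrite h -[RHS]mule1 -[in RHS]integral_fB.
  rewrite -ge0_integralZl_EFin//.
  - by apply: eq_integral => r _; rewrite -EFinM /pweight !big_ord0 !mul1r.
  - by move=> r; rewrite /= in_itv/= andbT => r0; rewrite lee_fin fB_ge0.
  - by apply/measurable_EFinP; exact: mfB.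
rewrite probability_setC//; have -> : P posev = 1%E; last by rewrite subee.
have -> : posev = E true `|` E false.
  apply/seteqP; split => w; last by move=> [[]|[]].
  by move=> wp; case wc : (chi w); [left|right].
rewrite measureU//; last first.
  by apply/seteqP; split => // w [[/= w1 _] [/= w2 _]]; move: w2; rewrite w1.
by rewrite [X in (X + _)%E]h [X in (_ + X)%E]h; exact: half.
Qed.


(** * Passage from simple functionals to the shot noise *)

Let f (b : bool) (x : T) : R :=
  beta betaT b * PB * Cr * norm2 (x.1 : R * R) `^ (- alpha) * Num.max (x.2 : R) 0.

Let bPC_gt0 b : 0 < beta betaT b * PB * Cr.
Proof. by rewrite !mulr_gt0 ?beta_gt0. Qed.

Let mf b : measurable_fun setT (f b : T -> mR).
Proof.
apply: measurable_funM; first apply: measurable_funM => //.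
  apply: (measurableT_comp (measurable_powR _)).
  by apply: (measurableT_comp measurable_norm2); exact: measurable_fst.
by apply: measurable_maxr => //; exact: measurable_snd.
Qed.

Let f_ge0 b x : 0 <= f b x.
Proof.
apply: mulr_ge0; last by rewrite le_max lexx orbT.
by apply: mulr_ge0; [exact/ltW/bPC_gt0|exact: powR_ge0].
Qed.

Let J b (w : Omega) : \bar R := (\sum_(j <oo) (f b (pw b j w))%:E)%E.

Let Jtot (w : Omega) : \bar R := (J true w + J false w)%E.

Let mJ b : measurable_fun setT (J b).
Proof.
apply: ge0_emeasurable_sum => [j w _ _|j _]; first by rewrite lee_fin f_ge0.
by apply/measurable_EFinP; exact: (measurableT_comp (mf b) (mpw b j)).
Qed.

Let mJtot : measurable_fun setT Jtot.
Proof. by apply: emeasurable_funD; exact: mJ. Qed.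

Let J_ge0 b w : (0 <= J b w)%E.
Proof. by apply: nneseries_ge0 => j _ _; rewrite lee_fin f_ge0. Qed.

Let simple_series b p (v : 'I_p -> R) (A : 'I_p -> set T) w : simple_data v A ->
  (\sum_i (v i)%:E * cnt b (A i) w = \sum_(j <oo) (simple_val v A (pw b j w))%:E)%E.
Proof.
move=> [v0 _ _].
transitivity (\sum_i \sum_(j <oo) (v i)%:E * ((pw b j w \in A i)%:R)%:E)%E.
  by apply: eq_bigr => i _; rewrite nneseriesZl// => j _; rewrite lee_fin.
rewrite -nneseries_sum; last first.
  by move=> i j _; rewrite mule_ge0// lee_fin ltW.
by apply: eq_eseriesr => j _; rewrite /simple_val -sumEFin.
Qed.

(* Laplace transform, given [(r2, r1) = x] and [chi = c], of the variable [X]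
   such that [z <= gamma_t] reads [z * thr * X <= G]. *)
Let lap (c : bool) (x : mR * mR) (t : R) : R :=
  expR (- (t * ka0 c x) -
    (2^-1 * pi * lamB * x.2 ^+ 2 *
       (Fhyp alpha (t * ka c x.2 * (beta betaT true * PB * Cr) * thI * x.2 `^ (- alpha)) - 1) +
     2^-1 * pi * lamB * x.2 ^+ 2 *
       (Fhyp alpha (t * ka c x.2 * (beta betaT false * PB * Cr) * thI * x.2 `^ (- alpha)) - 1))).

Let smooth_lap c x : 0 < x.2 -> smooth_pos (lap c x).
Proof.
move=> x0; have a0 b : 0 < ka c x.2 * (beta betaT b * PB * Cr) * thI * x.2 `^ (- alpha).
  by rewrite !mulr_gt0 ?powR_gt0 ?invr_gt0 ?den_gt0 ?beta_gt0.
pose C := 2^-1 * pi * lamB * (x.2 : R) ^+ 2.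
pose a b := ka c x.2 * (beta betaT b * PB * Cr) * thI * x.2 `^ (- alpha).
have -> : lap c x = fun t => expR ((- ka0 c x) * t + (- C) *
    ((Fhyp alpha (a true * t) - 1) + (Fhyp alpha (a false * t) - 1))).
  apply/funext => t; rewrite /lap; congr expR.
  have e b : t * ka c x.2 * (beta betaT b * PB * Cr) * thI * x.2 `^ (- alpha) = a b * t.
    by rewrite /a -!mulrA mulrC -!mulrA.
  by rewrite !e -mulrDr -/C; ring.
apply: smooth_pos_exp; apply: smooth_posD; first by apply: smooth_posZ; exact: smooth_pos_id.
apply: smooth_posZ.
have sF b := smooth_pos_scale _ (a b) (smooth_pos_hyp alpha halpha) (a0 b).
exact: (smooth_posD _ _ (sF true) (sF false)).
Qed.

(** The limit transform is computed for a positive [r1] only; the complement is null for [Q]. *)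
Let Dpos : set (mR * mR) := [set x | 0 < (x.2 : R)].

Let mDpos : measurable Dpos.
Proof.
have := measurable_fun_ltr (measurable_cst (0 : R)) (@measurable_snd _ _ mR mR).
by move=> /(_ measurableT [set true]); rewrite setTI; exact.
Qed.

Let Q_Dpos : Q (~` Dpos) = 0%E.
Proof.
have mI : measurable (`]-oo, 0%R]%classic : set mR) by exact: measurable_itv.
have -> : ~` Dpos = [set: mR] `*` (`]-oo, 0%R]%classic : set mR).
  apply/seteqP; split => -[s r] /=; rewrite in_itv/=.
    by move=> /negP; rewrite -leNgt.
  by move=> [_ r0]; apply/negP; rewrite -leNgt.
rewrite /fprod product_measure1E//.
rewrite [X in (_ * X)%E](_ : _ = 0%E) ?mule0//.
rewrite [LHS]integral_posd.
have -> : `]-oo, 0%R]%classic `&` `]0%R, +oo[%classic = set0 :> set mR.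
  apply/seteqP; split => // r /=; rewrite !in_itv/= andbT => -[r0 r1'].
  by move: (lt_le_trans r1' r0); rewrite ltxx.
by rewrite integral_set0.
Qed.

Let integral_Dpos (h : mR * mR -> R) : measurable_fun setT (h : _ -> mR) ->
  (forall x, 0 <= h x) -> (\int[Q]_x (h x)%:E = \int[Q]_(x in Dpos) (h x)%:E)%E.
Proof.
move=> mh h0.
have mN : measurable (~` Dpos) by exact: (measurableC mDpos).
have mE : measurable_fun setT (fun x => (h x)%:E) by apply/measurable_EFinP; exact: mh.
rewrite (ge0_negligible_integral mN measurableT mE _ Q_Dpos); last first.
  by move=> x _; rewrite lee_fin.
by rewrite setTD setCK.
Qed.


Let sinrev c z (Jf : Omega -> \bar R) : set Omega :=
  [set w | chi w = c] `&` posev `&` tailev c z Jf.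

Let msinrev c z Jf : measurable_fun setT Jf -> measurable (sinrev c z Jf).
Proof.
move=> mJf; apply: measurableI; last exact: mtailev.
by apply: measurableI; [exact: mchi|exact: mposev].
Qed.

Let ka_gt0 c w : posev w -> 0 < ka c (r1 w).
Proof. by move=> [r10 _]; rewrite divr_gt0 ?powR_gt0 ?den_gt0. Qed.

(** Infinite interference would require [G] to exceed an infinite threshold. *)
Let tailev_lty c z Jf w : 0 < z -> posev w -> (0 <= Jf w)%E -> tailev c z Jf w ->
  (Jf w < +oo)%E.
Proof.
move=> z0 wp J0; rewrite ltey; apply: contraPneq => Joo; rewrite /tailev/= Joo.
by rewrite gt0_muley ?lte_fin ?ka_gt0// addye// gt0_muley ?lte_fin ?mulr_gt0.
Qed.

Let le_summand (I : finType) (u : I -> \bar R) i : (forall i, 0 <= u i)%E ->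
  (u i <= \sum_i u i)%E.
Proof.
by move=> u0; rewrite (bigD1 i)//= leeDl// sume_ge0.
Qed.

Let cnt_ge0 b A w : (0 <= cnt b A w)%E.
Proof. by apply: nneseries_ge0 => j _ _; rewrite lee_fin. Qed.

Let simple_sinr_prob c z p q (vT : 'I_p -> R) (AT : 'I_p -> set T)
    (vR : 'I_q -> R) (AR : 'I_q -> set T) : 0 < z -> simple_data vT AT -> simple_data vR AR ->
  P (sinrev c z (fun w => \sum_i (vT i)%:E * cnt true (AT i) w +
                          \sum_i (vR i)%:E * cnt false (AR i) w)%E) =
  (\int[Q]_(x in Dpos) (2^-1 * laplace_tail k (slap c vT AT vR AR x) z)%:E)%E.
Proof.
move=> z0 sT sR.
rewrite -integral_Dpos; last 2 first.
- apply: measurable_funM; first exact: measurable_cst.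
  exact: measurable_simple_tail.
- move=> x; have /andP[t0 _] := simple_tail_bound c z p q vT AT vR AR z0 sT sR x.
  by apply: mulr_ge0 t0; rewrite invr_ge0.
rewrite -simple_interference_prob//.
rewrite -[RHS](measureI_full P _ _ _ mposev posev_full); last first.
  by apply: measurable_simple_interference.
congr (P _); apply/seteqP; split => w; last first.
  by move=> [[wc [_ [_ we]]] wp]; split.
move=> [[wc wp] we]; split=> //; split=> //.
have vi n (v : 'I_n -> R) (A : 'I_n -> set T) : simple_data v A -> forall b i,
    (0 <= (v i)%:E * cnt b (A i) w)%E.
  by move=> [v0 _ _] b i; rewrite mule_ge0 ?lee_fin ?(ltW (v0 _))//; exact: cnt_ge0.
have s0 n (v : 'I_n -> R) (A : 'I_n -> set T) b : simple_data v A ->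
    (0 <= \sum_i (v i)%:E * cnt b (A i) w)%E.
  by move=> sv; apply: sume_ge0 => i _; exact: vi.
have cf n (v : 'I_n -> R) (A : 'I_n -> set T) b : simple_data v A ->
    (\sum_i (v i)%:E * cnt b (A i) w < +oo)%E -> forall i, (cnt b (A i) w < +oo)%E.
  move=> sv soo i; rewrite ltey; apply/eqP => ci.
  have := @le_summand _ (fun i => (v i)%:E * cnt b (A i) w)%E i (vi _ _ _ sv b).
  have [v0 _ _] := sv; rewrite ci gt0_muley ?lte_fin// => h.
  by move: (le_lt_trans h soo); rewrite ltxx.
have Joo := tailev_lty c z _ w z0 wp (adde_ge0 (s0 _ _ _ true sT) (s0 _ _ _ false sR)) we.
split; first by apply: (cf _ _ _ _ sT); apply: le_lt_trans Joo; rewrite leeDl// s0.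
by split=> //; apply: (cf _ _ _ _ sR); apply: le_lt_trans Joo; rewrite leeDr// s0.
Qed.

Let slap_cvg c (x : mR * mR) t (p q : nat -> nat) (vT : forall n, 'I_(p n) -> R)
    (AT : forall n, 'I_(p n) -> set T) (vR : forall n, 'I_(q n) -> R)
    (AR : forall n, 'I_(q n) -> set T) : 0 < x.2 -> 0 < t ->
  (forall n, simple_data (vT n) (AT n)) -> (forall n, simple_data (vR n) (AR n)) ->
  (forall y, nondecreasing_seq (fun n => simple_val (vT n) (AT n) y)) ->
  (forall y, nondecreasing_seq (fun n => simple_val (vR n) (AR n) y)) ->
  (forall y : T, simple_val (vT n) (AT n) y @[n --> \oo] --> f true y) ->
  (forall y : T, simple_val (vR n) (AR n) y @[n --> \oo] --> f false y) ->
  slap c (vT n) (AT n) (vR n) (AR n) x t @[n --> \oo] --> lap c x t.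
Proof.
move=> x0 t0 sT sR ndT ndR cT cR.
have tk : 0 <= t * ka c x.2 by rewrite mulr_ge0 ?ka_ge0// ltW.
have b0 b := ltW (bPC_gt0 b).
apply: (cvg_comp _ expR); last exact: continuous_expR.
apply: cvgB; first exact: cvg_cst.
apply: cvgD.
  exact: (simple_exponent_cvg alpha lamB thI halpha hlamB hthI _ _ _ p vT AT (b0 true) tk x0 sT ndT cT).
exact: (simple_exponent_cvg alpha lamB thI halpha hlamB hthI _ _ _ q vR AR (b0 false) tk x0 sR ndR cR).
Qed.

Let half_unit (y : R) : 0 <= y <= 1 -> (`|(2^-1 * y)%:E| <= (1%R : R)%:E)%E.
Proof.
move=> /andP[y0 y1]; rewrite /= lee_fin ger0_norm; last by rewrite mulr_ge0// invr_ge0.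
by rewrite mulr_ile1// ?invr_ge0// invf_le1// ler1n.
Qed.

Let tailprob c z : \bar R :=
  (\int[Q]_(x in Dpos) (2^-1 * laplace_tail k (lap c x) z)%:E)%E.

(** The four facts share one choice of approximating functions. Events converge by continuity from
    above, integrals by domination by a constant, and the integrands because convergence of
    completely monotone transforms extends to their derivatives. *)
Let limit_facts c z : 0 < z ->
  [/\ P (sinrev c z Jtot) = tailprob c z,
      forall x, Dpos x -> 0 <= laplace_tail k (lap c x) z <= 1,
      forall x, Dpos x -> completely_monotone (lap c x) &
      measurable_fun Dpos ((fun x => laplace_tail k (lap c x) z) : _ -> mR)].
Proof.
move=> z0.
have [p [vT [AT [sT ndT cT]]]] := simple_approximation (f true) (mf true) (f_ge0 true).
have [q [vR [AR [sR ndR cR]]]] := simple_approximation (f false) (mf false) (f_ge0 false).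
have lcvg x t : Dpos x -> 0 < t ->
    slap c (vT n) (AT n) (vR n) (AR n) x t @[n --> \oo] --> lap c x t.
  by move=> x0 t0; exact: slap_cvg.
have cm n x : completely_monotone (slap c (vT n) (AT n) (vR n) (AR n) x).
  exact: completely_monotone_simple.
have tcvg x : Dpos x -> laplace_tail k (slap c (vT n) (AT n) (vR n) (AR n) x) z @[n --> \oo]
    --> laplace_tail k (lap c x) z.
  move=> x0; apply: laplace_tail_cvg => //; first by move=> t t0; exact: lcvg.
  exact: smooth_lap.
have tb n x := simple_tail_bound c z _ _ _ _ _ _ z0 (sT n) (sR n) x.
have mt n := measurable_simple_tail c z _ _ _ _ _ _ z0 (sT n) (sR n).
have tb' x : Dpos x -> 0 <= laplace_tail k (lap c x) z <= 1.
  by move=> x0; apply: cvg_bound (tcvg x x0) => n; exact: tb.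
split => //; last first.
- apply: (@measurable_fun_cvg _ _ _ Dpos _ _ _ tcvg) => n.
  by apply: measurable_funTS; exact: mt.
- move=> x x0; apply: completely_monotone_lim (smooth_lap c x x0); first by move=> n; exact: cm.
  by move=> t t0; exact: lcvg.
pose Jn n w := (\sum_i (vT n i)%:E * cnt true (AT n i) w +
                \sum_i (vR n i)%:E * cnt false (AR n i) w)%E.
have sv0 (m : nat) (v : 'I_m -> R) (A : 'I_m -> set T) y : simple_data v A ->
    (0 <= (simple_val v A y)%:E)%E.
  by move=> sv; rewrite lee_fin; exact: simple_val_ge0.
have JnE n w : Jn n w = (\sum_(j <oo) (simple_val (vT n) (AT n) (pw true j w))%:E +
    \sum_(j <oo) (simple_val (vR n) (AR n) (pw false j w))%:E)%E.
  by rewrite /Jn !simple_series.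
have Jn0 n w : (0 <= Jn n w)%E.
  by rewrite JnE adde_ge0//; apply: nneseries_ge0 => j _ _; exact: sv0.
have ndJ w : nondecreasing_seq (Jn ^~ w).
  move=> m n mn; rewrite !JnE; apply: leeD; apply: lee_nneseries.
  - by move=> j _ _; exact: sv0.
  - by move=> j _; rewrite lee_fin; exact: ndT.
  - by move=> j _ _; exact: sv0.
  - by move=> j _; rewrite lee_fin; exact: ndR.
have cJ w : Jn n w @[n --> \oo] --> Jtot w.
  have -> : Jn ^~ w = (fun n => \sum_(j <oo) (simple_val (vT n) (AT n) (pw true j w))%:E +
      \sum_(j <oo) (simple_val (vR n) (AR n) (pw false j w))%:E)%E.
    by apply/funext => n; exact: JnE.
  apply: cvgeD; first by apply: ge0_adde_def; rewrite inE; exact: J_ge0.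
    apply: cvg_nneseries_monotone => [n j|j m n mn|j]; first exact: sv0.
      by rewrite lee_fin; exact: ndT.
    by apply: cvg_EFin; [exact: nearW|exact: cT].
  apply: cvg_nneseries_monotone => [n j|j m n mn|j]; first exact: sv0.
    by rewrite lee_fin; exact: ndR.
  by apply: cvg_EFin; [exact: nearW|exact: cR].
have mJn n : measurable_fun setT (Jn n).
  apply: emeasurable_funD; apply: emeasurable_sum => i _; apply: measurable_funeM => //.
    by have [_ mS _] := sT n; exact: (mcnt true _ (mS i).1).
  by have [_ mS _] := sR n; exact: (mcnt false _ (mS i).1).
have zt : (0 <= (z * thr)%:E)%E by rewrite lee_fin mulr_ge0// ltW.
have kE w : (0 <= (ka c (r1 w))%:E)%E by rewrite lee_fin ka_ge0.
(* The inequality defining [tailev] is weak, so it survives the limit; conversely monotonicity gives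
   it at each n. *)
have capE : \bigcap_n sinrev c z (Jn n) = sinrev c z Jtot.
  apply/seteqP; split => w.
    move=> wn; have [[wc wp] _] := wn 0%N I; split => //.
    have c1 : ((z * thr)%:E * ((ka c (r1 w))%:E * Jn n w + (ka0 c (r2 w, r1 w))%:E))%E
        @[n --> \oo] --> ((z * thr)%:E * ((ka c (r1 w))%:E * Jtot w + (ka0 c (r2 w, r1 w))%:E))%E.
      apply: cvgeZl => //; apply: cvgeD; first exact: fin_num_adde_defl.
        by apply: cvgeZl => //; exact: cJ.
      exact: cvg_cst.
    rewrite /tailev/= -(cvg_lim _ c1)//; apply: lime_le; first exact: cvgP c1.
    by apply: nearW => n; have [_ ] := wn n I.
  move=> [wcp we] n _; split => //; apply: le_trans we.
  apply: lee_wpmul2l => //; apply: leeD => //; apply: lee_wpmul2l => //.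
  rewrite -(cvg_lim _ (cJ w))//; apply: lime_ge; first exact: cvgP (cJ w).
  by exists n => // m /= nm; exact: ndJ.
have c1 : P (sinrev c z (Jn n)) @[n --> \oo] --> P (sinrev c z Jtot).
  rewrite -capE; apply: nonincreasing_cvg_mu.
  - by rewrite (le_lt_trans (probability_le1 _ _)) ?ltry//; exact: msinrev.
  - by move=> n; exact: msinrev.
  - by apply: bigcap_measurable => // n _; exact: msinrev.
  - move=> m n mn; apply/subsetPset => w [wcp we]; split => //; apply: le_trans we.
    apply: lee_wpmul2l => //; apply: leeD => //; apply: lee_wpmul2l => //.
    exact: ndJ.
have c2 : (\int[Q]_(x in Dpos) (2^-1 * laplace_tail k (slap c (vT n) (AT n) (vR n) (AR n) x) z)%:E)%E
    @[n --> \oo] --> tailprob c z.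
  apply: (@dominated_cvg _ _ _ Q Dpos mDpos _ _ (EFin \o cst 1)) => //.
  - move=> n; apply/measurable_EFinP; apply: measurable_funTS.
    by apply: measurable_funM; [exact: measurable_cst|exact: mt].
  - move=> x x0; apply: cvg_EFin; first exact: nearW.
    by apply: cvgM; [exact: cvg_cst|exact: tcvg].
  - exact: (finite_measure_integrable_cst Q 1 mDpos).
  - by move=> n x _; exact: (half_unit _ (tb n x)).
have e : (fun n => P (sinrev c z (Jn n))) = fun n =>
    (\int[Q]_(x in Dpos) (2^-1 * laplace_tail k (slap c (vT n) (AT n) (vR n) (AR n) x) z)%:E)%E.
  by apply/funext => n; exact: simple_sinr_prob.
rewrite e in c1.
exact: (cvg_unique _ c1 c2).
Qed.


(** * Strict inequalities, and almost sure finiteness *)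

Let shift (z : R) (m : nat) : R := z + m.+1%:R^-1.

Let shift_gt z m : z < shift z m.
Proof. by rewrite ltrDl invr_gt0. Qed.

Let shift_cvg z : shift z m @[m --> \oo] --> z.
Proof.
rewrite -[X in _ --> X]addr0; apply: cvgD; first exact: cvg_cst.
exact: cvg_harmonic.
Qed.

Let shift_nonincr z m n : (m <= n)%N -> shift z n <= shift z m.
Proof. by move=> mn; rewrite lerD2l lef_pV2 ?posrE ?ltr0n// ler_nat ltnS. Qed.

Let tailprob_cvg c z : 0 < z -> tailprob c (shift z m) @[m --> \oo] --> tailprob c z.
Proof.
move=> z0; have zm m : 0 < shift z m by exact: lt_trans (shift_gt z m).
apply: (@dominated_cvg _ _ _ Q Dpos mDpos _ _ (EFin \o cst 1)) => //.
- move=> m; apply/measurable_EFinP; apply: measurable_funM; first exact: measurable_cst.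
  by have [_ _ _] := limit_facts c _ (zm m).
- move=> x x0; apply: cvg_EFin; first exact: nearW.
  apply: cvgM; first exact: cvg_cst.
  apply: (cvg_comp (shift z) (laplace_tail k (lap c x)) (shift_cvg z)).
  exact: (continuous_laplace_tail k (lap c x) z (smooth_lap c x x0) z0).
- exact: (finite_measure_integrable_cst Q 1 mDpos).
- move=> m x x0; apply: half_unit.
  by have [_ b _ _] := limit_facts c _ (zm m); exact: b.
Qed.

Let mJoo : measurable [set w | (Jtot w < +oo)%E].
Proof.
rewrite -[X in measurable X]setTI.
exact: (@measurable_lte _ _ _ setT measurableT Jtot (cst +oo%E) mJtot (measurable_cst _)).
Qed.

Let Jtot_ge0 w : (0 <= Jtot w)%E.
Proof. by rewrite adde_ge0 ?J_ge0. Qed.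

(** The events increase as the thresholds decrease to [z], and [tailprob] is continuous along them;
    their union is, up to a null set, the strict tail event. *)
Let bigcup_prob c z : 0 < z ->
  P (\bigcup_m sinrev c (shift z m) Jtot) = tailprob c z.
Proof.
move=> z0; have zm m : 0 < shift z m by exact: lt_trans (shift_gt z m).
have c1 : P (sinrev c (shift z m) Jtot) @[m --> \oo] --> P (\bigcup_m sinrev c (shift z m) Jtot).
  apply: nondecreasing_cvg_mu.
  - by move=> m; exact: (msinrev c _ Jtot mJtot).
  - by apply: bigcup_measurable => m _; exact: (msinrev c _ Jtot mJtot).
  - move=> m n mn; apply/subsetPset => w [wcp we]; split => //; apply: le_trans we.
    apply: lee_wpmul2r.
      by rewrite adde_ge0 ?mule_ge0 ?lee_fin ?ka_ge0 ?ka0_ge0// Jtot_ge0.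
    by rewrite lee_fin ler_wpM2r ?(ltW hthr)//; exact: shift_nonincr.
have e : (fun m => P (sinrev c (shift z m) Jtot)) = fun m => tailprob c (shift z m).
  by apply/funext => m; have [] := limit_facts c _ (zm m).
rewrite e in c1.
exact: (cvg_unique _ c1 (tailprob_cvg c z z0)).
Qed.

Let Q_setT : Q [set: mR * mR] = 1%E.
Proof.
rewrite -setXTT /fprod product_measure1E//.
rewrite [X in (X * _)%E](_ : _ = 1%E); last by rewrite [LHS]integral_posd setTI hfRU_1.
rewrite [X in (_ * X)%E](_ : _ = 1%E); last by rewrite [LHS]integral_posd setTI integral_fB.
by rewrite mule1.
Qed.

Let lap_cvg1 c x : Dpos x -> lap c x (shift 0 m) @[m --> \oo] --> (1 : R).
Proof.
move=> x0; pose u m := shift 0 m.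
have u0 m : 0 < u m by exact: shift_gt.
have cu (K : R) : u m * K @[m --> \oo] --> (0 : R).
  by rewrite -[X in _ --> X](mul0r K); apply: cvgM; [exact: shift_cvg|exact: cvg_cst].
have cF b : Fhyp alpha (u m * ka c x.2 * (beta betaT b * PB * Cr) * thI * x.2 `^ (- alpha)) - 1
    @[m --> \oo] --> (0 : R).
  pose a := ka c x.2 * (beta betaT b * PB * Cr) * thI * x.2 `^ (- alpha).
  have a0 : 0 <= a.
    by rewrite !mulr_ge0 ?powR_ge0 ?invr_ge0 ?(ltW (den_gt0 c)) ?(ltW (beta_gt0 b)) ?ltW.
  have e m : u m * ka c x.2 * (beta betaT b * PB * Cr) * thI * x.2 `^ (- alpha) = u m * a.
    by rewrite /a !mulrA.
  have ua m : 0 <= u m * a by apply: mulr_ge0 a0; exact/ltW/u0.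
  apply: (@squeeze_cvgr _ _ _ _ (cst 0) (fun m => u m * (a * (2 / (alpha - 2))))).
  - near=> m; rewrite e; apply/andP; split; first exact: Fhyp_ge1.
    by rewrite mulrA; exact: Fhyp_le.
  - exact: cvg_cst.
  - exact: cu.
pose C := 2^-1 * pi * lamB * (x.2 : R) ^+ 2.
have ce : - (u m * ka0 c x) -
    (C * (Fhyp alpha (u m * ka c x.2 * (beta betaT true * PB * Cr) * thI * x.2 `^ (- alpha)) - 1) +
     C * (Fhyp alpha (u m * ka c x.2 * (beta betaT false * PB * Cr) * thI * x.2 `^ (- alpha)) - 1))
    @[m --> \oo] --> - 0 - (C * 0 + C * 0).
  apply: cvgB; first by apply: cvgN; exact: cu.
  by apply: cvgD; apply: cvgM; [exact: cvg_cst|exact: cF|exact: cvg_cst|exact: cF].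
have e0 : - 0 - (C * 0 + C * 0) = 0 :> R by rewrite mulr0 addr0 subr0 oppr0.
have -> : 1 = expR (- 0 - (C * 0 + C * 0)) :> R by rewrite e0 expR0.
exact: (cvg_comp _ expR ce (@continuous_expR R _)).
Unshelve. all: by end_near. Qed.

Let tailprob_cvg0 c : tailprob c (shift 0 m) @[m --> \oo] --> (2^-1)%:E.
Proof.
have zm m : 0 < shift 0 m by exact: shift_gt.
have -> : ((2^-1)%:E = \int[Q]_(x in Dpos) (2^-1)%:E)%E.
  have QD : Q Dpos = 1%E.
    by rewrite -Q_setT -(measureI_full Q _ _ measurableT mDpos Q_Dpos) setTI.
  by rewrite integral_cst// [X in (_ * X)%E]QD mule1.
apply: (@dominated_cvg _ _ _ Q Dpos mDpos _ _ (EFin \o cst 1)) => //.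
- move=> m; apply/measurable_EFinP; apply: measurable_funM; first exact: measurable_cst.
  by have [_ _ _] := limit_facts c _ (zm m).
- move=> x x0; apply: cvg_EFin; first exact: nearW.
  rewrite -[X in _ --> X]mulr1; apply: cvgM; first exact: cvg_cst.
  (* The tail lies between the transform, by the summand of index 0 (present since [0 < k]), and
     1. *)
  apply: (@squeeze_cvgr _ _ _ _ (fun m => lap c x (shift 0 m)) (cst 1)).
  + near=> m; have [_ b cm _] := limit_facts c _ (zm m).
    have /andP[_ ->] := b x x0; rewrite andbT.
    case: k hk => // k' _; exact: laplace_tail_ge0 (cm x x0) (zm m).
  + exact: lap_cvg1.
  + exact: cvg_cst.
- exact: (finite_measure_integrable_cst Q 1 mDpos).
- move=> m x x0; apply: half_unit.
  by have [_ b _ _] := limit_facts c _ (zm m); exact: b.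
Unshelve. all: by end_near. Qed.

(** Each tail event with [z > 0] lies in the finiteness event. On either branch its probability
    tends to 1/2 as [z] decreases to 0, so finiteness has probability at least 1/2 there, and the
    two branches fill the space. *)
Let Joo_full : P (~` [set w | (Jtot w < +oo)%E]) = 0%E.
Proof.
pose F c := [set w | chi w = c] `&` [set w | (Jtot w < +oo)%E].
have mF c : measurable (F c) by apply: measurableI; [exact: mchi|exact: mJoo].
have h c : ((2^-1)%:E <= P (F c))%E.
  have zm m : 0 < shift 0 m by exact: shift_gt.
  rewrite -(cvg_lim _ (tailprob_cvg0 c))//; apply: lime_le; first exact: cvgP (tailprob_cvg0 c).
  apply: nearW => m; have [<- _ _ _] := limit_facts c _ (zm m).
  apply: le_measure; rewrite ?inE; [exact: (msinrev c _ Jtot mJtot)|exact: mF|].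
  by move=> w [[wc wp] we]; split => //=; exact: (tailev_lty c _ Jtot w (zm m) wp (Jtot_ge0 w) we).
rewrite probability_setC; last exact: mJoo.
have -> : P [set w | (Jtot w < +oo)%E] = 1%E; last by rewrite subee.
apply/eqP; rewrite eq_le probability_le1 ?mJoo//=.
have -> : [set w | (Jtot w < +oo)%E] = F true `|` F false.
  apply/seteqP; split => w; last by move=> [[]|[]].
  by move=> wp; case wc : (chi w); [left|right].
rewrite measureU; [|exact: mF|exact: mF|]; last first.
  by apply/seteqP; split => // w [[/= w1 _] [/= w2 _]]; move: w2; rewrite w1.
by rewrite -half leeD// h.
Qed.

(** * Signs of the marks, and positivity of the interference *)

Let void_prob b A : measurable A -> bounded_loc A ->
  P [set w | cnt b A w = 0%E] = (\int[lawB]_r (expR (- ppp_mean lamB thI r A))%:E)%E.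
Proof.
move=> mS bS.
have l1 : locsets (fun _ : 'I_1 => A).
  by split=> // i j; rewrite [i]ord1 [j]ord1 eqxx.
have pE r : pois (ppp_mean lamB thI r A) 0 = expR (- ppp_mean lamB thI r A).
  by rewrite /pois expr0 fact0 divr1 mul1r.
case: b.
  have h := count_law 1 0 (fun=> A) (fun=> 0%N) (fun=> set0) (fun=> 0%N) l1 locsets0.
  etransitivity; last (etransitivity; first exact: h).
    by congr (P _); apply/seteqP; split => w /=; [move=> ->; split=> // -[]|move=> [/(_ ord0)]].
  by apply: eq_integral => r _; rewrite /pweight big_ord1 big_ord0 mulr1 pE.
have h := count_law 0 1 (fun=> set0) (fun=> 0%N) (fun=> A) (fun=> 0%N) locsets0 l1.
etransitivity; last (etransitivity; first exact: h).
  by congr (P _); apply/seteqP; split => w /=; [move=> ->; split=> // -[]|move=> [_ /(_ ord0)]].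
by apply: eq_integral => r _; rewrite /pweight big_ord1 big_ord0 mul1r pE.
Qed.

(** Nothing is assumed on the sign of individual marks. These bounded sets have mean 0, hence almost
    surely contain no point, and together they cover all negative marks. *)
Let negmark (M : nat) : set T := [set y | norm2 (y.1 : R * R) <= M%:R /\ (y.2 : R) < 0].

Let mnegmark M : measurable (negmark M).
Proof.
have mn : measurable_fun setT ((fun y : T => norm2 (y.1 : R * R)) : T -> mR).
  by apply: (measurableT_comp measurable_norm2); exact: measurable_fst.
have m2 : measurable_fun setT ((fun y : T => y.2) : T -> mR) by exact: measurable_snd.
have tr (b : T -> bool) : measurable_fun setT b -> measurable [set y | b y].
  move=> /(_ measurableT [set true]); rewrite setTI; exact.
by apply: measurableI; apply: tr; [exact: measurable_fun_ler|exact: measurable_fun_ltr].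
Qed.

Let bnegmark M : bounded_loc (negmark M).
Proof.
exists M%:R => y [yM _]; have [h1 h2] := norm2_bound (y.1 : R * R).
by split; [exact: le_trans h1 yM|exact: le_trans h2 yM].
Qed.

Let lawB_setT : lawB setT = 1%E.
Proof. by rewrite [LHS]integral_posd setTI integral_fB. Qed.

Let mcnt0 b A : measurable A -> measurable [set w | cnt b A w = 0%E].
Proof. exact: (mcnt_eq b A 0). Qed.

Let negmark_full b M : P (~` [set w | cnt b (negmark M) w = 0%E]) = 0%E.
Proof.
rewrite probability_setC; last by apply: mcnt0; exact: mnegmark.
rewrite void_prob; [|exact: mnegmark|exact: bnegmark].
have -> : (\int[lawB]_r (expR (- ppp_mean lamB thI r (negmark M)))%:E = 1)%E.
  transitivity (\int[lawB]_r (cst 1%E r : \bar R))%E.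
    apply: eq_integral => r _; rewrite ppp_mean_neg_mark ?oppr0 ?expR0//.
    by move=> y [].
  by rewrite integral_cst// mul1e; exact: lawB_setT.
by rewrite subee.
Qed.

Let marksev : set Omega := \bigcap_M
  ([set w | cnt true (negmark M) w = 0%E] `&` [set w | cnt false (negmark M) w = 0%E]).

Let mmarksev : measurable marksev.
Proof.
by apply: bigcap_measurable => // M _; apply: measurableI; apply: mcnt0; exact: mnegmark.
Qed.

Let marksev_full : P (~` marksev) = 0%E.
Proof.
apply: bigcap_full => M; first by apply: measurableI; apply: mcnt0; exact: mnegmark.
apply: setI_full; [apply: mcnt0|apply: mcnt0|exact: negmark_full|exact: negmark_full];
  exact: mnegmark.
Qed.

Let cnt0 b A w j : cnt b A w = 0%E -> ~ A (pw b j w).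
Proof.
move=> c0 Aj; have : (1%:E <= cnt b A w)%E.
  apply: le_trans (@nneseries_lim_ge _ _ _ _ j.+1 _); last by move=> n _ _; rewrite lee_fin.
  rewrite big_nat_recr//= mem_set//= leeDr// sume_ge0// => i _; by rewrite lee_fin.
by rewrite c0 lee_fin ler10.
Qed.

Let marks_ge0 w b j : marksev w -> 0 <= ((pw b j w).2 : R).
Proof.
move=> wm; rewrite leNgt; apply/negP => g0.
pose M := (Num.truncn (norm2 ((pw b j w).1 : R * R))).+1.
have nA : negmark M (pw b j w) by split => //; exact/ltW/truncnS_gt.
have [cT cR] := wm M I.
by case: b g0 @M nA cT cR => g0 M nA cT cR; [exact: (cnt0 _ _ _ _ cT nA)|exact: (cnt0 _ _ _ _ cR nA)].
Qed.

(** For fixed [r], once [m] exceeds it, the mean of the annulus is a multiple of m^2 - r^2 and tends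
    to infinity; the density of [r1] dominates. *)
Let void_cvg : (\int[lawB]_r (expR (- ppp_mean lamB thI r (annulus m%:R)))%:E)%E @[m --> \oo] --> 0%E.
Proof.
pose h (m : nat) (r : mR) : R := expR (- ppp_mean lamB thI r (annulus m%:R)).
have mh m : measurable_fun setT (h m : mR -> mR).
  apply: (measurableT_comp (@measurable_expR R)); apply: measurable_funN.
  by apply: measurable_ppp_mean => //; exact: measurable_annulus.
have h0 m r : 0 <= h m r by exact: expR_ge0.
have h1 m r : h m r <= 1.
  rewrite expR_le1 oppr_le0; apply: ppp_mean_ge0; rewrite ?(ltW hlamB)//.
  exact: measurable_annulus.
have e m : (\int[lawB]_r (h m r)%:E = \int[leb]_r (h m r * posd fB r)%:E)%E.
  have mE : measurable_fun setT (fun r => (h m r)%:E) by apply/measurable_EFinP; exact: mh.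
  have E0 r : (0 <= (h m r)%:E)%E by rewrite lee_fin.
  by rewrite (ge0_integral_mdensity _ _ _ _ _ _ mE E0).
under eq_fun do rewrite e.
have -> : (0 = \int[leb]_r (cst 0%E r : \bar R))%E by rewrite integral_cst// mul0e.
apply: (@dominated_cvg _ _ _ leb setT measurableT _ _ (EFin \o posd fB)) => //.
- by move=> m; apply/measurable_EFinP; apply: measurable_funM; [exact: mh|exact: mB].
- move=> r _.
  suff cr : h m r * posd fB r @[m --> \oo] --> (0 : R).
    by apply: cvg_EFin; [exact: nearW|exact: cr].
  have [r0|r0] := ltP 0 r; last first.
    by apply: cvg_near_cst; apply: nearW => m; rewrite posdE ltNge r0 mulr0.
  rewrite -[X in _ --> X](mul0r (posd fB r)); apply: cvgM; last exact: cvg_cst.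
  have lp : 0 < lamB / 2 * pi by rewrite mulr_gt0 ?divr_gt0// pi_gt0.
  have c1 : lamB / 2 * pi * (m%:R ^+ 2 - r ^+ 2) @[m --> \oo] --> +oo.
    apply/cvgryPge => A; near=> m; rewrite -ler_pdivrMl// lerBrDr.
    have mA1 : (lamB / 2 * pi)^-1 * A + r ^+ 2 <= m%:R by near: m; exact: nbhs_infty_ger.
    apply: le_trans mA1 _; rewrite -natrX ler_nat -[leqLHS]expn1.
    case: (m : nat) => // m'; exact: leq_pexp2l.
  have c2 := cvg_comp _ _ c1 (@cvgr_expR R).
  apply: cvg_trans c2; apply: near_eq_cvg; near=> m.
  rewrite /h ppp_mean_annulus//.
  by near: m; exact: nbhs_infty_ger.
- apply/integrableP; split; first by apply/measurable_EFinP; exact: mB.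
  under eq_integral do rewrite gee0_abs ?lee_fin ?B_ge0//.
  exact: B_fin.
- move=> m r _; rewrite /= lee_fin ger0_norm; last by rewrite mulr_ge0 ?B_ge0.
  by rewrite ler_piMl ?B_ge0.
Unshelve. all: by end_near. Qed.

Let mJpos : measurable [set w | (0 < Jtot w)%E].
Proof.
rewrite -[X in measurable X]setTI.
exact: (@measurable_lte _ _ _ setT measurableT (cst 0%E) Jtot (measurable_cst _) mJtot).
Qed.

(** Zero interference forces the first process to avoid every [annulus], so its probability is below
    void probabilities that tend to 0. *)
Let Jpos_full : P (~` [set w | (0 < Jtot w)%E]) = 0%E.
Proof.
apply/eqP; rewrite eq_le measure_ge0 andbT.
rewrite -[leRHS](cvg_lim _ void_cvg)//; apply: lime_ge; first exact: cvgP void_cvg.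
apply: nearW => m.
have mS : measurable (annulus m%:R : set T) by exact: measurable_annulus.
have bS : bounded_loc (annulus m%:R : set T) by exact: bounded_loc_annulus.
rewrite -[leRHS](void_prob true (annulus m%:R) mS bS).
apply: le_measure.
- exact/mem_set/(measurableC mJpos).
- exact/mem_set/(mcnt0 true _ mS).
move=> w /=; rewrite lt_neqAle Jtot_ge0 andbT => /negP; rewrite negbK => /eqP J0.
have JT0 : J true w = 0%E.
  apply/eqP; rewrite eq_le J_ge0 andbT J0 /Jtot leeDl//; exact: J_ge0.
apply: eseries0 => j _ _; rewrite memNset// => -[n0' [_ g0]].
have : (0 < J true w)%E; last by rewrite JT0 ltxx.
apply: (@lt_le_trans _ _ (f true (pw true j w))%:E).
  rewrite lte_fin /f mulr_gt0//; last by rewrite lt_max g0.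
  by rewrite mulr_gt0 ?bPC_gt0 ?powR_gt0.
apply: le_trans (@nneseries_lim_ge _ _ _ _ j.+1 _); last by move=> n _ _; rewrite lee_fin.
by rewrite big_nat_recr//= leeDr// sume_ge0// => i _; rewrite lee_fin.
Qed.

(** * Identification of the real-valued quantities on a full event *)

Let good : set Omega := posev `&` marksev `&`
  ([set w | (0 < Jtot w)%E] `&` [set w | (Jtot w < +oo)%E]).

Let mgood : measurable good.
Proof. by apply: measurableI; apply: measurableI. Qed.

Let good_full : P (~` good) = 0%E.
Proof.
apply: setI_full; [exact: measurableI|exact: measurableI| |]; exact: setI_full.
Qed.

Let Sp (w : Omega) : R := beta betaT (chi w) * PB * Cr * (r1 w * r2 w) `^ (- alpha) * G w.

Let It (w : Omega) : R :=
  fine (\sum_(j <oo) (betaT * PB * Cr * (norm2 (xT j w, yT j w) * r2 w) `^ (- alpha)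
                        * gT j w)%:E
        + \sum_(j <oo) ((1 - betaT) * PB * Cr * (norm2 (xR j w, yR j w) * r2 w) `^ (- alpha)
                        * gR j w)%:E)%E.

Let gam (w : Omega) : R := at_ * Sp w / (It w + n0 ^+ 2).

(** Nonnegative marks make the clipping in [f] invisible, and finiteness makes [fine]
    multiplicative. *)
Let It_good w : good w -> It w = r2 w `^ (- alpha) * fine (Jtot w).
Proof.
move=> [[[r10 [r20 _]] wm] [J0 Joo]].
have p0 : (0 <= (r2 w `^ (- alpha))%:E)%E by rewrite lee_fin powR_ge0.
have sE b (a x y g : R) : 0 <= g -> a = beta betaT b ->
    a * PB * Cr * (norm2 (x, y) * r2 w) `^ (- alpha) * g =
    r2 w `^ (- alpha) * f b ((x, y), g).
  move=> g0 ->; rewrite /f/= (max_l g0) powRM ?sqrtr_ge0 ?(ltW r20)//.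
  by rewrite [norm2 _ `^ _ * _]mulrC !mulrA; congr (_ * _ * _); rewrite mulrC !mulrA.
have eT : (\sum_(j <oo) (betaT * PB * Cr * (norm2 (xT j w, yT j w) * r2 w) `^ (- alpha)
    * gT j w)%:E = (r2 w `^ (- alpha))%:E * J true w)%E.
  rewrite -nneseriesZl; last by move=> j _; rewrite lee_fin f_ge0.
  apply: eq_eseriesr => j _; rewrite -EFinM; congr EFin.
  by apply: (sE true) => //; exact: (marks_ge0 w true j wm).
have eR : (\sum_(j <oo) ((1 - betaT) * PB * Cr * (norm2 (xR j w, yR j w) * r2 w) `^ (- alpha)
    * gR j w)%:E = (r2 w `^ (- alpha))%:E * J false w)%E.
  rewrite -nneseriesZl; last by move=> j _; rewrite lee_fin f_ge0.
  apply: eq_eseriesr => j _; rewrite -EFinM; congr EFin.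
  by apply: (sE false) => //; exact: (marks_ge0 w false j wm).
rewrite /It eT eR -ge0_muleDr ?J_ge0//.
by rewrite fineM// ge0_fin_numE ?Jtot_ge0.
Qed.

Let thresh (w : Omega) : R :=
  thr * (ka (chi w) (r1 w) * fine (Jtot w) + ka0 (chi w) (r2 w, r1 w)).

Let fineJ_gt0 w : good w -> 0 < fine (Jtot w).
Proof. by move=> [_ [J0 Joo]]; apply: fine_gt0; rewrite J0. Qed.

Let thresh_gt0 w : good w -> 0 < thresh w.
Proof.
move=> wg; rewrite mulr_gt0// ltr_pwDl ?ka0_ge0// mulr_gt0 ?fineJ_gt0//.
by apply: ka_gt0; case: wg => -[].
Qed.

Let noise_gt0 w : good w -> 0 < It w + n0 ^+ 2.
Proof.
move=> wg; rewrite ltr_pwDl ?sqr_ge0// It_good// mulr_gt0 ?fineJ_gt0// powR_gt0//.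
by case: wg => -[[_ []]].
Qed.

Let gamE w : good w -> gam w = G w / thresh w.
Proof.
move=> wg; have Jp := fineJ_gt0 w wg; have Xp := thresh_gt0 w wg; have Np := noise_gt0 w wg.
move: Np Xp; rewrite /gam It_good// /thresh /ka /ka0 /Sp /den /=.
case: wg => -[[r10 [r20 _]] _] _.
rewrite !powRN !powRM ?(ltW r10) ?(ltW r20)//.
have a0 : 0 < r1 w `^ alpha by exact: powR_gt0.
have b0 : 0 < r2 w `^ alpha by exact: powR_gt0.
have c0 := beta_gt0 (chi w).
move: (r1 w `^ alpha) (r2 w `^ alpha) (beta betaT (chi w)) (fine (Jtot w)) a0 b0 c0 Jp.
move=> a b c j a0 b0 c0 j0 N0 X0.
have M0 : 0 < j + b * n0 ^+ 2 by rewrite ltr_pwDl// mulr_ge0 ?sqr_ge0// ltW.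
have M1 : 0 < j + n0 ^+ 2 * b by rewrite [n0 ^+ 2 * b]mulrC.
have M2 : 0 < a * j + a * b * n0 ^+ 2 by rewrite -mulrA -mulrDr mulr_gt0.
by field; rewrite !gt_eqF.
Qed.

Let tailevE c z w : good w -> chi w = c -> tailev c z Jtot w <-> z * thresh w <= G w.
Proof.
move=> wg wc; have Jf : Jtot w = (fine (Jtot w))%:E.
  by rewrite fineK// ge0_fin_numE ?Jtot_ge0//; case: wg => _ [].
rewrite /tailev /thresh wc/= {1}Jf mulrA.
by [].
Qed.

Let tail_ident c z : 0 < z ->
  [set w | chi w = c] `&` [set w | z < gam w] `&` good =
  (\bigcup_m sinrev c (shift z m) Jtot) `&` good.
Proof.
move=> z0; apply/seteqP; split => w.
  move=> [[wc zg] wg]; split=> //.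
  have X0 := thresh_gt0 w wg; move: zg; rewrite /= gamE// ltr_pdivlMr// => zg.
  have D0 : 0 < G w - z * thresh w by rewrite subr_gt0.
  (* The shift 1/(m+1) times [thresh w] must not exceed the gap [G w - z * thresh w], so m+1 has to
     reach this quotient. *)
  exists (Num.truncn (thresh w / (G w - z * thresh w))) => //.
  split; first by split=> //; case: wg => -[].
  apply/(tailevE c _ w wg wc); rewrite /shift mulrDl -lerBrDl ler_pdivrMl//.
  by rewrite -ler_pdivrMr//; exact/ltW/truncnS_gt.
move=> [[m _ [[wc wp] we]] wg]; split=> //; split=> //=.
move/(tailevE c _ w wg wc) : we => we.
rewrite gamE// ltr_pdivlMr ?thresh_gt0//; apply: lt_le_trans we.
by rewrite ltr_pM2r ?thresh_gt0//; exact: shift_gt.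
Qed.

(** The marks are not clipped here, so the partial sums need not be monotone. *)
Let measurable_power_series (x y g : nat -> Omega -> R) (a : R) :
  (forall j, measurable_fun setT (x j)) -> (forall j, measurable_fun setT (y j)) ->
  (forall j, measurable_fun setT (g j)) ->
  measurable_fun setT (fun w =>
    (\sum_(j <oo) (a * PB * Cr * (norm2 (x j w, y j w) * r2 w) `^ (- alpha) * g j w)%:E)%E).
Proof.
move=> mx my mgg; have mt j : measurable_fun setT (fun w =>
    (a * PB * Cr * (norm2 (x j w, y j w) * r2 w) `^ (- alpha) * g j w)%:E).
  apply/measurable_EFinP; apply: measurable_funM => //; apply: measurable_funM => //.
  apply: (measurableT_comp (measurable_powR _)); apply: measurable_funM => //.
  apply: (measurableT_comp measurable_norm2).
  exact: (measurable_fun_pair (mx j) (my j)).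
by apply: measurable_fun_limn => n; apply: emeasurable_sum.
Qed.

Let mIt : measurable_fun setT It.
Proof.
rewrite /It; apply: measurableT_comp; first exact: fine_measurable.
apply: emeasurable_funD.
  exact: measurable_power_series.
exact: measurable_power_series.
Qed.

Let mSp : measurable_fun setT Sp.
Proof.
apply: measurable_funM => //; apply: measurable_funM; last first.
  by apply: (measurableT_comp (measurable_powR _)); exact: measurable_funM.
apply: measurable_funM => //; apply: measurable_funM => //.
have mc : measurable_fun setT chi.
  apply: (measurable_fun_bool true); rewrite setTI; exact: hchi.
rewrite /beta; exact: measurable_fun_ifT.
Qed.

Let mgam : measurable_fun setT gam.
Proof.
apply: measurable_funM; first exact: measurable_funM.
by apply: (measurableT_comp measurable_invr); exact: measurable_funD.
Qed.

Let mgam_gt z : measurable [set w | z < gam w].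
Proof.
have := measurable_fun_ltr (measurable_cst z) mgam.
by move=> /(_ measurableT [set true]); rewrite setTI; exact.
Qed.

Let gam_tail z : 0 < z ->
  P [set w | z < gam w] = (tailprob true z + tailprob false z)%E.
Proof.
move=> z0; pose E c := [set w | chi w = c] `&` [set w | z < gam w].
have mE c : measurable (E c) by apply: measurableI; [exact: mchi|exact: mgam_gt].
have h c : P (E c) = tailprob c z.
  rewrite -(measureI_full P _ _ (mE c) mgood good_full) tail_ident//.
  have mU : measurable (\bigcup_m sinrev c (shift z m) Jtot).
    by apply: bigcup_measurable => m _; exact: (msinrev c _ Jtot mJtot).
  by rewrite (measureI_full P _ _ mU mgood good_full); exact: bigcup_prob.
have -> : [set w | z < gam w] = E true `|` E false.
  apply/seteqP; split => w; last by move=> [[]|[]].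
  by move=> wp; case wc : (chi w); [left|right].
rewrite measureU; [|exact: mE|exact: mE|]; last first.
  by apply/seteqP; split => // w [[/= w1 _] [/= w2 _]]; move: w2; rewrite w1.
by congr (_ + _)%E; exact: h.
Qed.

(** * The closed formula for the tail *)

(** Writing each [Fhyp] as 1 plus the rest splits off e^(-pi lamB r^2), which is the exponential in
    the density of [r1]. *)
Let expV c z (s r : R) : 0 < r -> 0 < z ->
  (fun x => expR (Vchi lamB PB Cr thr thI n0 alpha betaT at_ c z r s x)) =
  (fun x => expR (- (pi * lamB * r ^+ 2)) * lap c (s, r) (z * x)).
Proof.
move=> r0 z0; apply/funext => x; rewrite /lap -expRD; congr expR.
have ra : 0 < r `^ alpha by exact: powR_gt0.
have e b : z * x * ka c r * (b * PB * Cr) * thI * r `^ (- alpha) =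
    thI * z * b / (at_ * thr * beta betaT c) * x.
  rewrite /ka /den powRN; have c0 := beta_gt0 c.
  by field; rewrite !gt_eqF.
rewrite /Vchi /= !e /ka0 /den/=.
have c0 := beta_gt0 c.
by field; rewrite !gt_eqF.
Qed.

Let summand_formula c z (s r : R) : 0 < r -> 0 < z ->
  \sum_(m < k) ((-1) ^+ m / (m`!)%:R *
    derive1n m (fun x => expR (Vchi lamB PB Cr thr thI n0 alpha betaT at_ c z r s x)) 1) =
  expR (- (pi * lamB * r ^+ 2)) * laplace_tail k (lap c (s, r)) z.
Proof.
move=> r0 z0; have sl : smooth_pos (lap c (s, r)) by exact: smooth_lap.
rewrite expV//; pose L t := expR (- (pi * lamB * r ^+ 2)) * lap c (s, r) t.
have sL : smooth_pos L by exact: smooth_posZ.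
by rewrite (laplace_tail_scale k L z sL z0) laplace_tailZ.
Qed.

Let tailprob_formula c z : 0 < z -> tailprob c z =
  (\int[leb]_(s in `]0%R, +oo[) \int[leb]_(r in `]0%R, +oo[)
      (pi * lamB * r * fRU s *
        \sum_(m < k) ((-1) ^+ m / (m`!)%:R *
          derive1n m (fun x => expR (Vchi lamB PB Cr thr thI n0 alpha betaT at_ c z r s x)) 1))%:E)%E.
Proof.
move=> z0; have [_ tb _ mt] := limit_facts c z z0.
pose H : mR * mR -> \bar R := (EFin \o (fun x => 2^-1 * laplace_tail k (lap c x) z)) \_ Dpos.
have mH : measurable_fun setT H.
  apply: (measurable_restrictT _ mDpos).1; apply/measurable_EFinP.
  by apply: measurable_funM; [exact: measurable_cst|exact: mt].
have H0 x : (0 <= H x)%E.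
  rewrite /H patchE; case: ifPn => // /set_mem xD; rewrite /= lee_fin.
  by have /andP[t0 _] := tb x xD; rewrite mulr_ge0// invr_ge0.
rewrite /tailprob integral_mkcond (integral_Q H mH H0).
pose F (s : mR) : \bar R := (\int[lawB]_r H (s, r))%E.
have mF : measurable_fun setT F by exact: (measurable_fun_fubini_tonelli_F _ mH H0).
have F0 s : (0 <= F s)%E by apply: integral_ge0 => r _; exact: H0.
rewrite [LHS](ge0_integral_mdensity _ _ _ _ _ _ mF F0) [RHS]integral_mkcond.
apply: eq_integral => s _; rewrite patchE mem_setE in_itv/= andbT posdE.
case: ifPn => s0; last by rewrite mule0.
have mHs : measurable_fun setT (fun r : mR => H (s, r)).
  by apply: (measurableT_comp mH); exact: measurable_pair1.
rewrite /F (ge0_integral_mdensity _ _ _ _ _ _ mHs (fun r => H0 (s, r))).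
rewrite -ge0_integralZr//; last 3 first.
- by apply: emeasurable_funM => //; apply/measurable_EFinP; exact: mB.
- by move=> r _; rewrite mule_ge0// lee_fin; exact: B_ge0.
- by rewrite lee_fin; exact: hfRU_ge0.
rewrite [RHS]integral_mkcond; apply: eq_integral => r _.
rewrite patchE mem_setE in_itv/= andbT posdE.
case: ifPn => r0; last by rewrite mule0 mul0e.
rewrite /H patchE mem_set//= -!EFinM; congr EFin.
(* The branch probability 1/2 cancels the 2 in the density of [r1]; its exponential comes from
   [summand_formula]. *)
rewrite summand_formula// /fB; lra.
Qed.

Lemma star_tail z : 0 < z ->
  P [set w | z < gam w] = Fbar_formula lamB PB Cr thr thI n0 alpha betaT at_ k fRU z.
Proof.
move=> z0; rewrite [LHS](gam_tail z z0) /Fbar_formula.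
rewrite [RHS]big_cons [X in _ = (_ + X)%E]big_cons big_nil [X in _ = (_ + X)%E]adde0.
congr (_ + _)%E; exact: tailprob_formula.
Qed.

(** * The ergodic rate *)

Let Sp_gt0 w : good w -> 0 < Sp w.
Proof.
move=> [[[r10 [r20 G0]] _] _].
by rewrite mulr_gt0// mulr_gt0 ?bPC_gt0// powR_gt0// mulr_gt0.
Qed.

(** With positive denominators, both inequalities say that [tauc] times interference plus noise is
    less than [(ac - at_ * tauc) * Sp w]. *)
Let decoding_event ac tauc w : 0 < tauc -> at_ * tauc < ac -> good w ->
  (tauc < ac * Sp w / (at_ * Sp w + It w + n0 ^+ 2)) =
  (at_ * (tauc / (ac - at_ * tauc)) < gam w).
Proof.
move=> t0 act wg; have S0 := Sp_gt0 w wg; have N0 := noise_gt0 w wg.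
have d0 : 0 < ac - at_ * tauc by rewrite subr_gt0.
rewrite -addrA ltr_pdivlMr; last by rewrite addr_gt0// mulr_gt0.
rewrite /gam -[at_ * Sp w / _]mulrA ltr_pM2l// ltr_pdivrMr// mulrAC ltr_pdivlMr//.
by rewrite -subr_gt0 -[RHS]subr_gt0; congr (0 < _); ring.
Qed.

Lemma star_rate (ac tauc : R) : 0 < tauc -> at_ * tauc < ac ->
  (\int[P]_w (log2 (1 + gam w) *
     (tauc < ac * Sp w / (at_ * Sp w + It w + n0 ^+ 2))%R%:R)%:E =
   (ln 2)^-1%:E * \int[leb]_(z in `](at_ * (tauc / (ac - at_ * tauc)))%R, +oo[)
      (Fbar_formula lamB PB Cr thr thI n0 alpha betaT at_ k fRU z * ((1 + z)^-1)%:E)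
   + (log2 (1 + at_ * (tauc / (ac - at_ * tauc))))%:E *
     Fbar_formula lamB PB Cr thr thI n0 alpha betaT at_ k fRU
       (at_ * (tauc / (ac - at_ * tauc)))%R)%E.
Proof.
move=> t0 act; set a := at_ * (tauc / (ac - at_ * tauc)).
have a0 : 0 < a by rewrite mulr_gt0// divr_gt0// subr_gt0.
have l2 : 0 < ln 2 :> R by rewrite ln_gt0// ltr1n.
have ml : measurable_fun setT (fun w => log2 (1 + gam w)).
  apply: measurable_funM => //; apply: (measurableT_comp (@measurable_ln R)).
  exact: measurable_funD.
(* The two indicators agree on [good] only, so the integrals are compared almost everywhere. *)
transitivity (\int[P]_w (log2 (1 + gam w) * (a < gam w)%R%:R)%:E)%E.
  apply: ae_eq_integral => //.
  - apply/measurable_EFinP; apply: measurable_funM => //; apply: measurableT_comp => //.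
    apply: measurable_fun_ltr => //; apply: measurable_funM; first exact: measurable_funM.
    apply: (measurableT_comp measurable_invr); apply: measurable_funD => //.
    by apply: measurable_funD => //; exact: measurable_funM.
  - apply/measurable_EFinP; apply: measurable_funM => //; apply: measurableT_comp => //.
    exact: measurable_fun_ltr.
  - exists (~` good); split; [exact: measurableC|exact: good_full|].
    move=> w /= nw wg; apply: nw => _; by rewrite (decoding_event ac tauc w t0 act wg).
have h := layer_cake_ln P gam mgam a a0.
have lc : (\int[P]_w (log2 (1 + gam w) * (a < gam w)%R%:R)%:E =
    (ln 2)^-1%:E * \int[P]_w (ln (1 + gam w) * (a < gam w)%R%:R)%:E)%E.
  rewrite -ge0_integralZl_EFin//.
  - by apply: eq_integral => w _; rewrite -EFinM; congr EFin; rewrite /log2; ring.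
  - move=> w _; rewrite lee_fin; have [ag|] := ltP a (gam w); last by rewrite mulr0.
    by rewrite mulr1 ln_ge0// lerDl (le_trans (ltW a0))// ltW.
  - apply/measurable_EFinP; apply: measurable_funM.
      by apply: (measurableT_comp (@measurable_ln R)); exact: measurable_funD.
    by apply: measurableT_comp => //; exact: measurable_fun_ltr.
  - by rewrite invr_ge0 ltW.
have la0 : 0 <= ln (1 + a) by rewrite ln_ge0// lerDl ltW.
rewrite lc h ge0_muleDr; last 2 first.
- apply: integral_ge0 => z; rewrite /= in_itv/= andbT => az.
  by rewrite mule_ge0// lee_fin invr_ge0 addr_ge0// (le_trans (ltW a0))// ltW.
- by rewrite mule_ge0// lee_fin.
congr (_ + _)%E.
  congr (_ * _)%E; apply: eq_integral => z; rewrite inE/= in_itv/= andbT => az.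
  by congr (_ * _)%E; apply: star_tail; exact: lt_trans az.
rewrite muleA -EFinM; congr (_ * _)%E; last exact: star_tail.
by rewrite /log2 mulrC.
Qed.

End star_model.

Theorem theorem3 (R : realType)
  (* system parameters *)
  (lamB PB Cr thr thI n0 alpha betaT at_ ac tauc : R) (k : nat)
  (hlamB : 0 < lamB) (hPB : 0 < PB) (hCr : 0 < Cr) (hthr : 0 < thr) (hthI : 0 < thI)
  (halpha : 2 < alpha) (hk : (0 < k)%N)
  (hbetaT0 : 0 < betaT) (hbetaT1 : betaT < 1)
  (hat0 : 0 < at_) (hatac : at_ < ac) (hsum : at_ + ac = 1)
  (htauc : 0 < tauc) (hac : at_ * tauc < ac)
  (* density f_RU of r2 on (0, oo) *)
  (fRU : R -> R)
  (hfRU_meas : measurable_fun (`]0%R, +oo[ : set R) fRU)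
  (hfRU_ge0 : forall s, 0 < s -> 0 <= fRU s)
  (hfRU_1 : (\int[@lebesgue_measure R]_(s in `]0%R, +oo[) (fRU s)%:E = 1)%E)
  (* probability space and random elements *)
  (d : measure_display) (Omega : measurableType d) (P : probability Omega R)
  (r1 r2 G : Omega -> R) (chi : Omega -> bool)
  (xT yT gT xR yR gR : nat -> Omega -> R)
  (hr1 : measurable_fun setT r1) (hr2 : measurable_fun setT r2)
  (hG : measurable_fun setT G) (hchi : measurable (chi @^-1` [set true]))
  (hxT : forall j, measurable_fun setT (xT j)) (hyT : forall j, measurable_fun setT (yT j))
  (hgT : forall j, measurable_fun setT (gT j))
  (hxR : forall j, measurable_fun setT (xR j)) (hyR : forall j, measurable_fun setT (yR j))
  (hgR : forall j, measurable_fun setT (gR j))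
  (* joint law: r1 has density 2 pi lamB r e^{-pi lamB r^2}; r2 has density fRU;
     chi uniform on {T (= true), R (= false)}; G ~ Gamma(k, thr); all independent;
     conditionally on r1, the marked point processes
     Phi^T = {((xT j, yT j), gT j)} and Phi^R = {((xR j, yR j), gR j)} are
     independent Poisson point processes of intensity lamB/2 on {||y|| > r1}
     with i.i.d. exponential marks of mean thI, independent of r2, chi, G
     (characterised through their joint finite-dimensional count distributions) *)
  (hlaw : forall (B C D : set R) (c : bool) (p q : nat)
      (AT : 'I_p -> set ((R * R) * R)) (nT : 'I_p -> nat)
      (AR : 'I_q -> set ((R * R) * R)) (nR : 'I_q -> nat),
      measurable B -> measurable C -> measurable D ->
      (forall i, measurable (AT i) /\ bounded_loc (AT i)) ->
      (forall i j, i != j -> AT i `&` AT j = set0) ->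
      (forall i, measurable (AR i) /\ bounded_loc (AR i)) ->
      (forall i j, i != j -> AR i `&` AR j = set0) ->
      P [set w | B (r1 w) /\ C (r2 w) /\ chi w = c /\ D (G w) /\
                 (forall i, count_in (xT^~ w) (yT^~ w) (gT^~ w) (AT i) = (nT i)%:R%:E) /\
                 (forall i, count_in (xR^~ w) (yR^~ w) (gR^~ w) (AR i) = (nR i)%:R%:E)]
      = (\int[@lebesgue_measure R]_(r in B `&` `]0%R, +oo[)
            (2 * pi * lamB * r * expR (- (pi * lamB * r ^+ 2))
             * \prod_(i < p) pois (ppp_mean lamB thI r (AT i)) (nT i)
             * \prod_(i < q) pois (ppp_mean lamB thI r (AR i)) (nR i))%:E
         * (\int[@lebesgue_measure R]_(s in C `&` `]0%R, +oo[) (fRU s)%:E)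
         * (2^-1)%:E
         * (\int[@lebesgue_measure R]_(g in D `&` `]0%R, +oo[)
              (g ^+ k.-1 * expR (- (g / thr)) / ((k.-1)`!%:R * thr ^+ k))%:E))%E) :
  let S := fun w => beta betaT (chi w) * PB * Cr * (r1 w * r2 w) `^ (- alpha) * G w in
  let It := fun w : Omega =>
    fine (\sum_(j <oo) (betaT * PB * Cr * (norm2 (xT j w, yT j w) * r2 w) `^ (- alpha)
                          * gT j w)%:E
          + \sum_(j <oo) ((1 - betaT) * PB * Cr * (norm2 (xR j w, yR j w) * r2 w) `^ (- alpha)
                          * gR j w)%:E)%E in
  let gamma_tc := fun w => ac * S w / (at_ * S w + It w + n0 ^+ 2) in
  let gamma_t := fun w => at_ * S w / (It w + n0 ^+ 2) in
  let tau_s := tauc / (ac - at_ * tauc) in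
  let Rt := (\int[P]_w (log2 (1 + gamma_t w) * (tauc < gamma_tc w)%R%:R)%:E)%E in
  let Fbar := Fbar_formula lamB PB Cr thr thI n0 alpha betaT at_ k fRU in
  (forall z : R, 0 < z -> P [set w | z < gamma_t w] = Fbar z) /\
  Rt = ((ln 2)^-1%:E * \int[@lebesgue_measure R]_(z in `](at_ * tau_s)%R, +oo[)
           (Fbar z * ((1 + z)^-1)%:E)
        + (log2 (1 + at_ * tau_s))%:E * Fbar (at_ * tau_s)%R)%E.
Proof.
move=> S It gamma_tc gamma_t tau_s Rt Fbar; split.
  move=> z z0.
  by apply: (star_tail lamB PB Cr thr thI n0 alpha betaT at_ k hlamB hPB hCr hthr hthI
    halpha hk hbetaT0 hbetaT1 hat0 fRU hfRU_meas hfRU_ge0 hfRU_1 P r1 r2 G chi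
    xT yT gT xR yR gR).
by apply: (star_rate lamB PB Cr thr thI n0 alpha betaT at_ k hlamB hPB hCr hthr hthI
  halpha hk hbetaT0 hbetaT1 hat0 fRU hfRU_meas hfRU_ge0 hfRU_1 P r1 r2 G chi
  xT yT gT xR yR gR).
Qed.
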